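(* Let $A\in\mathbf{M}_n(\mathbb{C})$ and let $E$ be the fundamental solution of the symmetric hyperbolic system $\partial_tu+A_1\partial_{x_1}u+A_2\partial_{x_2}u=0$ in $\mathbb{R}\times\mathbb{R}^2$, where $A_1=(A+A^* )/2$ and $A_2=(A-A^* )/(2i)$. Then $E(t,x)=0$ for all $(t,x)\in(0,\infty)\times\mathbb{R}^2$ such that $\frac{x}{t}\in\Pi_A$, where $\Pi_A=\{z\in\mathbb{C}\setminus\Sigma_A : N(z)=n\}$ is viewed as a subset of $\mathbb{R}^2\simeq\mathbb{C}$.
   Context: The fundamental solution $E$ is the unique $\mathbf{M}_n(\mathbb{C})$-valued distribution on $\mathbb{R}\times\mathbb{R}^2$, supported in $\mathbb{R}_+\times\mathbb{R}^2$, such that $\partial_tE+A_1\partial_{x_1}E+A_2\partial_{x_2}E=I_n\,\delta_{t=0}\otimes\delta_{x=0}$; it is smooth on $\{(t,x):t>0,\ x/t\notin\Sigma_A\}$. $\Sigma_A\subset\mathbb{C}\simeq\mathbb{R}^2$ is the set of critical values of the numerical map $\Phi_A(x)=\langle Ax,x\rangle=x^*Ax$ from the unit sphere of $\mathbb{C}^n$ to $\mathbb{C}$, i.e. the images of the points where the $\mathbb{R}$-linear differential of $\Phi_A$ is not onto $\mathbb{C}$. Definition of $N(z)$. Let $H(\theta)=\frac12(e^{-i\theta}A+e^{i\theta}A^* )$, $\theta\in\mathbb{R}$. There are an integer $m\le n$ and real-analytic functions $\lambda_1,\dots,\lambda_m:\mathbb{R}\to\mathbb{R}$ such that $\sigma(H(\theta))=\{\lambda_1(\theta),\dots,\lambda_m(\theta)\}$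 for all $\theta$, and such that, except for $\theta$ in a set having finitely many points in each compact interval, the $\lambda_j(\theta)$ are pairwise distinct eigenvalues of constant multiplicities; let $m(j)$ be the multiplicity of $\lambda_j(\theta)$ for such $\theta$. Put $C_A=\bigcup_{j=1}^m\{e^{i\theta}(\lambda_j(\theta)+i\lambda_j'(\theta)):\theta\in\mathbb{R}\}\subset\Sigma_A$; this curve is the envelope of the lines $L_j(\theta)=\{z:\mathrm{Re}(ze^{-i\theta})=\lambda_j(\theta)\}$, which are its tangent lines. For $z\in\mathbb{C}\setminus C_A$, $N(z)$ is the number of tangent lines to $C_A$ passing through $z$, counted with multiplicity: $N(z)=\sum_{j=1}^m m(j)\cdot\#\{\theta\in[0,\pi):\lambda_j(\theta)=\mathrm{Re}(ze^{-i\theta})\}$. *)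

(* Defs.v *)
From HB Require Import structures.
From mathcomp Require Import all_boot all_order all_algebra.
From mathcomp Require Import finmap.
From mathcomp Require Import spectral complex.
From mathcomp Require Import all_classical all_reals all_analysis.

Set Implicit Arguments.
Unset Strict Implicit.
Unset Printing Implicit Defensive.

Import Order.TTheory GRing.Theory Num.Theory.
Import numFieldNormedType.Exports.

Local Open Scope classical_set_scope.
Local Open Scope complex_scope.
Local Open Scope sesquilinear_scope.
Local Open Scope ring_scope.

(** * Smooth functions, test functions and distributions on R x R^2 *)

(* The space R x R^2 of the points (t, (x1, x2)). *)
Notation spacetime R := (R * (R * R))%type.

(* The library's sigma-finiteness instance for a product of sigma-finite
   measures is shadowed by the one for subprobabilities, hence the explicit
   instance below, which is needed to form the product with R. *)
Definition plane_measure (R : realType) :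
  set (measurableTypeR R * measurableTypeR R) -> \bar R :=
  (@lebesgue_measure R \x @lebesgue_measure R)%E.
HB.instance Definition _ (R : realType) := Measure.on (@plane_measure R).

Lemma plane_measure_sigma_finite (R : realType) :
  sigma_finite setT (@plane_measure R).
Proof.
have /sigma_finiteP[F [TF ndF Foo]] := sigma_finiteT (@lebesgue_measure R).
exists (fun n => F n `*` F n).
  rewrite -setXTT TF predeqE => -[x y]; split.
    move=> [/= [n _ Fnx] [k _ Fky]]; exists (maxn n k) => //; split.
    - by move: x Fnx; exact/subsetPset/ndF/leq_maxl.
    - by move: y Fky; exact/subsetPset/ndF/leq_maxr.
  by move=> [n _ []/= ? ?]; split; exists n.
move=> k; have [? ?] := Foo k; split; first exact: measurableX.
by rewrite /plane_measure product_measure1E// lte_mul_pinfty// ge0_fin_numE.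
Qed.

HB.instance Definition _ (R : realType) :=
  Measure_isSigmaFinite.Build _ _ _ (@plane_measure R)
    (@plane_measure_sigma_finite R).

Definition spacetime_measure (R : realType) :
  set (measurableTypeR R * (measurableTypeR R * measurableTypeR R)) -> \bar R :=
  (@lebesgue_measure R \x @plane_measure R)%E.
HB.instance Definition _ (R : realType) := Measure.on (@spacetime_measure R).

(* The coordinate directions: 0 is t, 1 is x1, 2 is x2. *)
Definition axis (R : realType) (k : 'I_3) : spacetime R :=
  ((k == 0%N :> nat)%:R, ((k == 1%N :> nat)%:R, (k == 2%N :> nat)%:R)).

Definition pd (R : realType) (k : 'I_3) (f : spacetime R -> R) :
  spacetime R -> R := fun p => 'D_(axis R k) f p.

Definition pds (R : realType) (s : seq 'I_3) (f : spacetime R -> R) :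
  spacetime R -> R := foldr (@pd R) f s.

(* C^oo on the open set W: all the iterated partial derivatives exist and are
   continuous on W. *)
Definition smooth_on (R : realType) (W : set (spacetime R))
    (f : spacetime R -> R) : Prop :=
  forall (s : seq 'I_3) (p : spacetime R), W p ->
    {for p, continuous (pds s f)} /\
    forall k : 'I_3, derivable (pds s f) p (axis R k).

Definition supp (R : realType) (f : spacetime R -> R) : set (spacetime R) :=
  closure [set p | f p != 0].

Definition test_function (R : realType) (f : spacetime R -> R) : Prop :=
  smooth_on setT f /\ compact (supp f).

(* A complex-valued distribution is determined by its R-linear restriction to
   the real-valued test functions, so a distribution with values in M_n(C) is
   an R-linear map from these to M_n(C); its values at functions which are not
   test functions are irrelevant. Continuity is expressed, on each compact set
   K, by a bound by the derivatives up to some order k: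
   |E(f)_ij| <= C max_{|s| <= k} sup |d^s f|  when supp f is included in K. *)
Definition is_distribution (R : realType) (n : nat)
    (E : (spacetime R -> R) -> 'M[R[i]]_n) : Prop :=
  (forall (a : R) (f g : spacetime R -> R),
     test_function f -> test_function g ->
     E (fun p => a * f p + g p) = a%:C *: E f + E g) /\
  (forall K : set (spacetime R), compact K ->
     exists (C : R) (k : nat), forall (f : spacetime R -> R) (M : R),
       test_function f -> supp f `<=` K ->
       (forall (s : seq 'I_3) (p : spacetime R),
          (size s <= k)%N -> `|pds s f p| <= M) ->
       forall i j : 'I_n, `|E f i j| <= (C * M)%:C).

Definition dist_pd (R : realType) (n : nat) (k : 'I_3)
    (E : (spacetime R -> R) -> 'M[R[i]]_n) : (spacetime R -> R) -> 'M[R[i]]_n :=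
  fun f => - E (pd k f).

Definition dist_represented_on (R : realType) (n : nat)
    (E : (spacetime R -> R) -> 'M[R[i]]_n) (W : set (spacetime R))
    (u : spacetime R -> 'M[R[i]]_n) : Prop :=
  forall f : spacetime R -> R, test_function f -> supp f `<=` W ->
    E f = \matrix_(i, j)
      (\int[@spacetime_measure R]_p (f p * complex.Re (u p i j)) +i*
       \int[@spacetime_measure R]_p (f p * complex.Im (u p i j))).

(* [dist_value E p v] means that E is a smooth function in a neighbourhood of p
   and that the value at p of this (unique) function is v, i.e. E(p) = v. *)
Definition dist_value (R : realType) (n : nat)
    (E : (spacetime R -> R) -> 'M[R[i]]_n) (p : spacetime R)
    (v : 'M[R[i]]_n) : Prop :=
  exists (W : set (spacetime R)) (u : spacetime R -> 'M[R[i]]_n),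
    [/\ open W, W p,
        forall i j : 'I_n, smooth_on W (fun q => complex.Re (u q i j)) /\
                           smooth_on W (fun q => complex.Im (u q i j)),
        dist_represented_on E W u & u p = v].

(** * The hyperbolic system *)

Definition A1 (R : realType) (n : nat) (A : 'M[R[i]]_n) : 'M[R[i]]_n :=
  2^-1 *: (A + A ^t*).

Definition A2 (R : realType) (n : nat) (A : 'M[R[i]]_n) : 'M[R[i]]_n :=
  (2 * 'i%C)^-1 *: (A - A ^t*).

(* These conditions determine E on the test functions. *)
Definition fundamental_solution (R : realType) (n : nat) (A : 'M[R[i]]_n)
    (E : (spacetime R -> R) -> 'M[R[i]]_n) : Prop :=
  [/\ is_distribution E,
      forall f, test_function f -> supp f `<=` [set p | p.1 < 0] -> E f = 0 &
      forall f, test_function f ->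
        dist_pd 0 E f + A1 A *m dist_pd 1 E f + A2 A *m dist_pd 2 E f
        = ((f (0, (0, 0)))%:C)%:M].

(** * The numerical map and its critical values *)

Definition unit_sphere (R : realType) (n : nat) : set 'cV[R[i]]_n :=
  [set x | (x ^t* *m x) 0 0 = 1].

Definition numerical_map (R : realType) (n : nat) (A : 'M[R[i]]_n)
    (x : 'cV[R[i]]_n) : R[i] := (x ^t* *m A *m x) 0 0.

(* The R-linear differential at x of the numerical map on C^n, in the
   direction y. *)
Definition numerical_diff (R : realType) (n : nat) (A : 'M[R[i]]_n)
    (x y : 'cV[R[i]]_n) : R[i] :=
  derive1 (fun s : R => complex.Re (numerical_map A (x + s%:C *: y))) 0 +i*
  derive1 (fun s : R => complex.Im (numerical_map A (x + s%:C *: y))) 0.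

(* The tangent space at x of the unit sphere, a real manifold of dimension
   2n - 1. *)
Definition sphere_tangent (R : realType) (n : nat) (x : 'cV[R[i]]_n) :
  set 'cV[R[i]]_n := [set y | complex.Re ((x ^t* *m y) 0 0) = 0].

Definition Sigma_A (R : realType) (n : nat) (A : 'M[R[i]]_n) : set R[i] :=
  numerical_map A @`
    [set x | @unit_sphere R n x /\
             numerical_diff A x @` sphere_tangent x != setT].

(** * Analytic eigenvalues of H(theta) and the number N(z) *)

Definition expi (R : realType) (theta : R) : R[i] := cos theta +i* sin theta.

Definition Hmx (R : realType) (n : nat) (A : 'M[R[i]]_n) (theta : R) :
  'M[R[i]]_n := 2^-1 *: (expi (- theta) *: A + expi theta *: A ^t*).

Definition real_analytic (R : realType) (f : R -> R) : Prop :=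
  forall x : R, exists (a : nat -> R) (r : R), 0 < r /\
    forall y : R, `|y - x| < r ->
      series (fun k => a k * (y - x) ^+ k) @ \oo --> f y.

(* The multiplicity of an eigenvalue is its multiplicity as a root of the
   characteristic polynomial. *)
Definition eigenvalue_branches (R : realType) (n : nat) (A : 'M[R[i]]_n)
    (m : nat) (lambda : 'I_m -> R -> R) (mult : 'I_m -> nat) : Prop :=
  [/\ (m <= n)%N,
      forall j, real_analytic (lambda j),
      forall theta (w : R[i]),
        eigenvalue (Hmx A theta) w <-> exists j, w = (lambda j theta)%:C &
      exists S : set R,
        (forall a b : R, finite_set (S `&` [set` `[a, b]])) /\
        (forall theta, ~ S theta ->
           injective (fun j => lambda j theta) /\
           forall j, mup (lambda j theta)%:C (char_poly (Hmx A theta)) = mult j)].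

(* For z outside C_A, in particular outside Sigma_A A, the sets below are finite:
   otherwise lambda_j(theta) = Re(z e^{-i theta}) for all theta, by analyticity,
   hence z = e^{i theta}(lambda_j(theta) + i lambda_j'(theta)) is in C_A.
   ([fset_set] of an infinite set would be empty.) *)
Definition tangent_count (R : realType) (m : nat) (lambda : 'I_m -> R -> R)
    (mult : 'I_m -> nat) (z : R[i]) : nat :=
  (\sum_(j < m) mult j *
    #|` fset_set [set theta : R | (0 <= theta < pi)%R /\
                    lambda j theta = complex.Re (z * expi (- theta))%R] |)%N.

Definition Pi_A (R : realType) (n : nat) (A : 'M[R[i]]_n)
    (m : nat) (lambda : 'I_m -> R -> R) (mult : 'I_m -> nat) : set R[i] :=
  [set z | ~ Sigma_A A z /\ tangent_count lambda mult z = n].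

(* Main.v *)
Require Import Defs.
From mathcomp Require Import all_boot all_order all_algebra.
From mathcomp Require Import perm.
From mathcomp Require Import finmap.
From mathcomp Require Import spectral complex.
From mathcomp Require Import all_classical all_reals all_analysis.
From mathcomp Require Import ring lra.

Set Implicit Arguments.
Unset Strict Implicit.
Unset Printing Implicit Defensive.

Import Order.TTheory GRing.Theory Num.Theory.
Import numFieldNormedType.Exports.

Local Open Scope classical_set_scope.
Local Open Scope complex_scope.
Local Open Scope sesquilinear_scope.
Local Open Scope ring_scope.

(** For q = (t, x), with x in the plane identified with C, put X_q = x - t A, whose Hermitian parts
    are x1 - t A1 and x2 - t A2. A matrix X is called [good] if no nonzero v for which X v and the
    image of v under the adjoint of X are linearly dependent satisfies <X v, v> = 0. The proof shows
    that E vanishes on the open set of all q with X_q good, and that this set contains every (t, x)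
    with t > 0 and x/t in [Pi_A].

    Algebra ([lacuna_good]). A tangent line through z with angle theta makes Re(z e^{-i theta}) an
    eigenvalue of H(theta), so Re(z e^{-i theta}) - H(theta) has a kernel whose dimension is at
    least the total multiplicity of the branches concerned ([branch_rank]). Kernels for different
    angles in [0, pi) are orthogonal for both Hermitian parts of z - A, and since z is not critical
    they contain no nonzero isotropic vector ([noncritical_form]). Hence their sum is direct; it is
    all of C^n because N(z) = n, and goodness of z - A is read off from this decomposition
    ([kernel_sum_good]).

    Analysis ([kernel_to0]). Let K_eps(q) be the integral over theta in [0, 2 pi] of (cos theta (x1
    - t A1) + sin theta (x2 - t A2) - i eps)^{-2}, plus its adjoint. It is a superposition of plane
    waves solving the adjoint system, and at t = 0 it is a negative constant times a Poisson kernel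
    of width eps times the identity ([kernel_initial]). The claim is that K_eps tends to 0 locally
    uniformly where X_q is good. A good matrix is diagonalised by congruence ([good_diag]). From the
    diagonal entries one builds a shift s(theta) such that along the complex angles theta - i sg
    s(theta) the matrix stays invertible down to eps = 0 ([sfield_sign], [Mx_unit]), and the shift
    does not change the integral ([deformation]). At eps = 0 the entries are combinations of
    integrals of products of two reciprocal linear forms in cosine and sine. Those scalar integrals
    are purely imaginary ([Re_zero_pair]), so adding the adjoint gives 0 ([zero_limit]).

    Duality ([E_vanish]). Let f be a test function supported where X_q is good. The equation of E is
    applied to the function of p given by the integral of f(p + q) K_eps(q) over a large box of q
    with t in [0, T]. After integration by parts the interior terms cancel because K_eps solves the
    adjoint system; the face t = T gives a function supported in the past, where E is zero; the
    lateral faces are small because X_q is good when |x| is large compared with t ([far_good]); the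
    value at the origin is small because K_eps is small on the support of f. What remains, E applied
    to the spatial average of f against the Poisson kernel, is therefore small. That average is
    close, together with its derivatives, to a multiple of f with coefficient bounded below, and E
    has finite order on compact sets, so E f = 0. *)

Section SegmentIntegral.
Variable R : realType.
Implicit Types (a b x u M : R) (f g F : R -> R).

(** * Integrals of continuous functions over a segment *)

Definition RI a b f : R := \int[@lebesgue_measure R]_(x in `[a, b]) f x.

(** Continuity is that of [f] on the whole line at each point of the segment, endpoints included, so
    it passes to sums and products without subspace topologies. *)
Definition conton a b f := forall x, a <= x <= b -> {for x, continuous f}.

Lemma contonE a b f : conton a b f -> {within `[a, b], continuous f}.
Proof.
move=> cf; apply: continuous_in_subspaceT => x; rewrite inE /= in_itv /=.
exact: cf.
Qed.

Lemma continuous_conton a b f : continuous f -> conton a b f.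
Proof. by move=> cf x _; exact: cf. Qed.

Lemma RI_integrable a b f : conton a b f ->
  (@lebesgue_measure R).-integrable `[a, b] (EFin \o f).
Proof.
move=> cf; apply: continuous_compact_integrable; first exact: segment_compact.
exact: contonE.
Qed.

Lemma eq_RI a b f g : (forall x, a <= x <= b -> f x = g x) ->
  RI a b f = RI a b g.
Proof.
by move=> fg; apply: eq_Rintegral => x; rewrite inE /= in_itv /=; exact: fg.
Qed.

Lemma RID a b f g : conton a b f -> conton a b g ->
  RI a b (fun x => f x + g x) = RI a b f + RI a b g.
Proof. by move=> cf cg; rewrite /RI RintegralD //; exact: RI_integrable. Qed.

Lemma RIB a b f g : conton a b f -> conton a b g ->
  RI a b (fun x => f x - g x) = RI a b f - RI a b g.
Proof. by move=> cf cg; rewrite /RI RintegralB //; exact: RI_integrable. Qed.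

Lemma RIZ a b f r : conton a b f ->
  RI a b (fun x => r * f x) = r * RI a b f.
Proof. by move=> cf; rewrite /RI RintegralZl //; exact: RI_integrable. Qed.

Lemma RIN a b f : conton a b f -> RI a b (fun x => - f x) = - RI a b f.
Proof.
move=> cf; rewrite -mulN1r -RIZ //; apply: eq_RI => x _; exact/esym/mulN1r.
Qed.

Lemma RI0 a b : RI a b (fun=> 0) = 0.
Proof. by rewrite /RI Rintegral_cst // mul0r. Qed.

Lemma RI_cst a b r : a <= b -> RI a b (fun=> r) = r * (b - a).
Proof.
move=> ab; rewrite /RI Rintegral_cst //; congr (_ * _).
have := lebesgue_measure_itv `[a, b] => /= mE.
apply: (@etrans _ _ (fine (if (a%:E < b%:E)%E then (b%:E - a%:E)%E else 0%E))).
  by congr fine; exact: mE.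
case: ifPn => //=; rewrite lte_fin -leNgt => ba; rewrite (_ : b = a) ?subrr//.
by apply/eqP; rewrite eq_le ba.
Qed.

Lemma RI_sum a b (I : Type) (r : seq I) (P : pred I) (F : I -> R -> R) :
  (forall i, conton a b (F i)) ->
  RI a b (fun x => \sum_(i <- r | P i) F i x) = \sum_(i <- r | P i) RI a b (F i).
Proof.
move=> cF; elim: r => [|i r ih].
  by rewrite big_nil -[RHS](RI0 a b); apply: eq_RI => x _; rewrite big_nil.
rewrite big_cons -ih; case: ifP => Pi; last first.
  by apply: eq_RI => x _; rewrite big_cons Pi.
rewrite -RID //.
  by apply: eq_RI => x _; rewrite big_cons Pi.
move=> x xab; elim: r {ih} => [|k r ih].
  have -> : (fun y => \sum_(i <- [::] | P i) F i y) = cst 0.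
    by apply/funext => y; rewrite big_nil.
  exact: cst_continuous.
have -> : (fun y => \sum_(i <- k :: r | P i) F i y) =
    if P k then (fun y => F k y + \sum_(i <- r | P i) F i y)
    else (fun y => \sum_(i <- r | P i) F i y).
  by apply/funext => y; rewrite big_cons; case: ifP.
by case: ifP => Pk //; apply: cvgD => //; exact: cF.
Qed.

Lemma conton_norm a b f : conton a b f -> conton a b (fun x => `|f x|).
Proof. by move=> cf x xab; apply: cvg_norm; exact: cf. Qed.

Lemma le_RI a b f g : conton a b f -> conton a b g ->
  (forall x, a <= x <= b -> f x <= g x) -> RI a b f <= RI a b g.
Proof.
move=> cf cg fg; apply: le_Rintegral => //; try exact: RI_integrable.
Qed.

Lemma le_norm_RI a b f : conton a b f ->
  `|RI a b f| <= RI a b (fun x => `|f x|).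
Proof. by move=> cf; apply: le_normr_Rintegral => //; exact: RI_integrable. Qed.

Lemma RI_bound a b f M : a <= b -> conton a b f ->
  (forall x, a <= x <= b -> `|f x| <= M) -> `|RI a b f| <= M * (b - a).
Proof.
move=> ab cf fM; apply: (le_trans (le_norm_RI cf)).
rewrite -RI_cst //; apply: le_RI => //; first exact: conton_norm.
by move=> x _; exact: cst_continuous.
Qed.

Lemma RI_FTC a b f F : a < b -> conton a b f ->
  (forall x, a <= x <= b -> is_derive x 1 F (f x)) ->
  RI a b f = F b - F a.
Proof.
move=> ab cf dF.
have cF x : a <= x <= b -> {for x, continuous F}.
  move=> /dF [dx _]; exact/differentiable_continuous/derivable1_diffP.
rewrite /RI /Rintegral (@continuous_FTC2 R f F) //.
- exact: contonE.
- split.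
  + move=> x; rewrite in_itv /= => /andP[ax xb].
    by have [] := dF x; rewrite ?(ltW ax) ?(ltW xb).
  + by apply: cvg_at_right_filter; apply: cF; rewrite lexx ltW.
  + by apply: cvg_at_left_filter; apply: cF; rewrite lexx ltW.
- move=> x; rewrite in_itv /= => /andP[ax xb].
  rewrite derive1E; have [| _ ->//] := dF x.
  by rewrite ?(ltW ax) ?(ltW xb).
Qed.

(** The tube lemma: compactness of the segment turns a condition holding near each point (t0, x)
    into one holding for all x at once when t is near t0. *)
Lemma segment_near (T : topologicalType) (t0 : T) a b (P : T -> R -> Prop) :
  (forall x, a <= x <= b -> \forall z \near (t0, x), P z.1 z.2) ->
  \forall t \near t0, forall x, a <= x <= b -> P t x.
Proof.
move=> h.
have /compact_near_coveringP cK := @segment_compact R a b.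
have H x : `[a, b]%classic x -> \forall x' \near x & t \near t0, P t x'.
  rewrite /= in_itv /= => xab.
  have [[U V] [/= Ut Vx] UV] :
    filter_prod (nbhs t0) (nbhs x) (fun z => P z.1 z.2) := h x xab.
  by exists (V, U) => //= -[y t] [/= Vy Utt]; exact: (UV (t, y)).
apply: filterS (cK T (nbhs t0) P _ H) => t At x xab.
by apply: At; rewrite /= in_itv.
Qed.

Lemma RI_continuous_at (T : topologicalType) (t0 : T) (h : T -> R -> R) a b :
  a <= b ->
  (forall x, a <= x <= b -> {for (t0, x), continuous (fun z => h z.1 z.2)}) ->
  (\forall t \near t0, conton a b (h t)) ->
  {for t0, continuous (fun t => RI a b (h t))}.
Proof.
move=> ab ch nh.
apply/cvgrPdist_le => /= e e0.
(* Adding 1 to the length keeps the divisor positive when [a = b]. *)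
have d0 : 0 < e / (b - a + 1) by rewrite divr_gt0 // ltr_wpDl // subr_ge0.
have d20 : 0 < e / (b - a + 1) / 2 by rewrite divr_gt0.
have c0 : conton a b (h t0) by exact: nbhs_singleton nh.
have nd : \forall t \near t0, forall x, a <= x <= b ->
    `|h t0 x - h t x| <= e / (b - a + 1).
  apply: segment_near => x xab.
  have := ch x xab => /cvgrPdist_le/(_ _ d20) /= n1.
  have n2 : \forall z \near (t0, x), `|h t0 x - h t0 z.2| <= e / (b - a + 1) / 2.
    have /cvgrPdist_le/(_ _ d20) /= := c0 x xab.
    move=> [r /= r0 H]; exists (setT, ball x r) => /=.
      by split; [exact: filterT | exact: nbhsx_ballx].
    by move=> [z y] /= [_ yx]; exact: H.
  near=> z.
  rewrite (_ : _ - _ = (h t0 x - h z.1 z.2) - (h t0 x - h t0 z.2)); last by ring.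
  rewrite (le_trans (ler_normB _ _)) // [leRHS]splitr lerD //; by near: z.
near=> t.
have ct : conton a b (h t) by near: t.
rewrite -RIB //.
apply: (@le_trans _ _ (e / (b - a + 1) * (b - a))).
  apply: RI_bound => //; last by near: t.
  by move=> x xab; apply: cvgB; [exact: c0 | exact: ct].
rewrite mulrAC ler_pdivrMr ?ltr_wpDl ?subr_ge0 //.
by rewrite ler_wpM2l ?ltW // ltrDl.
Unshelve. all: by end_near. Qed.

Lemma RI_continuous (T : topologicalType) (h : T -> R -> R) a b :
  a <= b -> continuous (fun z => h z.1 z.2) ->
  continuous (fun t => RI a b (h t)).
Proof.
move=> ab ch t0; apply: RI_continuous_at => //; first by move=> x _; exact: ch.
apply: filterE => t x _.
apply: (@cvg_comp _ _ _ (fun y => (t, y)) (fun z => h z.1 z.2) _ (nbhs (t, x))).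
  exact: (cvg_pair (cvg_cst t) cvg_id).
exact: (ch (t, x)).
Qed.

Lemma conton_bounded a b f : a <= b -> conton a b f ->
  exists M, forall x, a <= x <= b -> `|f x| <= M.
Proof.
move=> ab /conton_norm/contonE cf.
have [c _ cM] := EVT_max ab cf.
by exists `|f c| => x xab; apply: cM; rewrite in_itv.
Qed.

(** Dominated differentiation: the tube lemma bounds [h' w x] by a single constant for w near u and
    x in the segment, and this constant is the integrable majorant. *)
Lemma RI_derive (h h' : R -> R -> R) u a b : a <= b ->
  (\forall w \near u, conton a b (h w)) ->
  (\forall w \near u, forall x, a <= x <= b -> is_derive (w : R) (1 : R) (h ^~ x) (h' w x)) ->
  (forall x, a <= x <= b -> {for (u, x), continuous (fun z => h' z.1 z.2)}) ->
  conton a b (h' u) ->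
  is_derive u (1 : R) (fun w => RI a b (h w)) (RI a b (h' u)).
Proof.
move=> ab nc nd ch' c0.
have [M HM] := conton_bounded ab c0.
have nM : \forall w \near u, forall x, a <= x <= b -> `|h' w x| <= M + 1.
  apply: segment_near => x xab.
  have := ch' x xab => /cvgrPdist_le/(_ _ ltr01) /= n1.
  near=> z.
  rewrite -[h' _ _](subrK (h' u x)) (le_trans (ler_normD _ _)) // addrC lerD ?HM //.
  by rewrite distrC; near: z.
have [r /= r0 Hr] : \forall w \near u, [/\ conton a b (h w),
    forall x, a <= x <= b -> is_derive (w : R) (1 : R) (h ^~ x) (h' w x) &
    forall x, a <= x <= b -> `|h' w x| <= M + 1].
  by near=> w; split; near: w.
have M0 : 0 <= M + 1.
  by rewrite addr_ge0 // (le_trans _ (HM a _)) // lexx.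
have Hu w : w \in `]u - r, u + r[ -> ball u r w.
  by rewrite in_itv /= => /andP[h1 h2]; rewrite /ball /= ltr_distlC h1 h2.
pose D := `[a, b]%classic : set R.
have key := @cvg_differentiation_under_integral R _ _
  (@lebesgue_measure R) h D (measurable_itv _) u (u - r) (u + r).
have := key _ _ _ (fun=> M + 1) (fun=> M0) _ _.
have dE : \int[@lebesgue_measure R]_(y in D) partial1of2 h u y = RI a b (h' u).
  apply: eq_RI => x xab; rewrite partial1of2E.
  have [_ H _] := Hr u (ballxx _ r0); have [_ ->] := H x xab; by [].
rewrite dE; move=> H.
have {H} H : h0^-1 *: (RI a b (h (h0 + u)) - RI a b (h u)) @[h0 --> 0^'] --> RI a b (h' u).
  apply: H.
  - by rewrite /= in_itv /= ltrBlDr ltrDl r0.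
  - by move=> w /= wI; apply: RI_integrable; have [] := Hr w (Hu _ wI).
  - move=> w x wI; rewrite /D /= in_itv /= => xab.
    by have [_ H _] := Hr w (Hu _ wI); have [] := H x xab.
  - apply: (@RI_integrable a b (fun=> M + 1)) => x _; exact: cst_continuous.
  - move=> w x wI; rewrite /D /= in_itv /= => xab; rewrite partial1of2E.
    have [_ H1 H2] := Hr w (Hu _ wI); have [_ ->] := H1 x xab; exact: H2.
have H' : h0^-1 *: (((fun w => RI a b (h w)) \o shift u) (h0 *: 1%R) -
    RI a b (h u)) @[h0 --> 0^'] --> RI a b (h' u).
  apply: cvg_trans H; apply: near_eq_cvg; apply: filterE => w /=.
  by rewrite [w *: 1]mulr1.
split; first by apply/cvg_ex; exists (RI a b (h' u)).
exact: cvg_lim H'.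
Unshelve. all: by end_near. Qed.

End SegmentIntegral.

(** * Directional derivatives of real-valued functions *)

Section RealDerive.
Context {R : realType} {V : normedModType R}.
Implicit Types (f g : V -> R) (x v : V).

Lemma eq_derive_val f x v l k : is_derive x v f l -> l = k -> is_derive x v f k.
Proof. by move=> ? <-. Qed.

Lemma dD f g x v l k : is_derive x v f l -> is_derive x v g k ->
  is_derive x v (fun t => f t + g t) (l + k).
Proof. by move=> df dg; exact: is_deriveD. Qed.

Lemma dN f x v l : is_derive x v f l -> is_derive x v (fun t => - f t) (- l).
Proof. by move=> df; exact: is_deriveN. Qed.

Lemma dB f g x v l k : is_derive x v f l -> is_derive x v g k ->
  is_derive x v (fun t => f t - g t) (l - k).
Proof. by move=> df dg; exact: is_deriveB. Qed.

Lemma dM f g x v l k : is_derive x v f l -> is_derive x v g k ->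
  is_derive x v (fun t => f t * g t) (l * g x + f x * k).
Proof.
move=> df dg; apply: eq_derive_val (is_deriveM df dg) _.
by rewrite /GRing.scale /= addrC mulrC.
Qed.

Lemma dX2 f x v l : is_derive x v f l ->
  is_derive x v (fun t => f t ^+ 2) (2 * f x * l).
Proof.
move=> df; rewrite (_ : (fun t => _) = (fun t => f t * f t)); last first.
  by apply/funext => t; rewrite expr2.
by apply: eq_derive_val (dM df df) _; ring.
Qed.

Lemma dV f x v l : f x != 0 -> is_derive x v f l ->
  is_derive x v (fun t => (f t)^-1) (- l / f x ^+ 2).
Proof.
move=> fx0 [df dl]; have dV := derivableV fx0 df.
split; first exact: dV.
by rewrite deriveV // dl /GRing.scale /= !mulNr mulrC.
Qed.

Lemma dcst (c : R) x v : is_derive x v (fun=> c) 0.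
Proof. exact: is_derive_cst. Qed.

End RealDerive.

(** * Complex-valued functions through real and imaginary parts *)

Section ComplexCalculus.
Variable R : realType.
Local Notation C := R[i].

Lemma cReD (x y : C) : complex.Re (x + y) = complex.Re x + complex.Re y.
Proof. by case: x y => a b [c d]. Qed.
Lemma cImD (x y : C) : complex.Im (x + y) = complex.Im x + complex.Im y.
Proof. by case: x y => a b [c d]. Qed.
Lemma cReN (x : C) : complex.Re (- x) = - complex.Re x.
Proof. by case: x. Qed.
Lemma cImN (x : C) : complex.Im (- x) = - complex.Im x.
Proof. by case: x. Qed.
Lemma cReM (x y : C) : complex.Re (x * y) =
  complex.Re x * complex.Re y - complex.Im x * complex.Im y.
Proof. by case: x y => a b [c d]. Qed.
Lemma cImM (x y : C) : complex.Im (x * y) =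
  complex.Re x * complex.Im y + complex.Im x * complex.Re y.
Proof. by case: x y => a b [c d]. Qed.
Lemma cReV (x : C) : complex.Re x^-1 =
  complex.Re x / (complex.Re x ^+ 2 + complex.Im x ^+ 2).
Proof. by case: x. Qed.
Lemma cImV (x : C) : complex.Im x^-1 =
  - (complex.Im x / (complex.Re x ^+ 2 + complex.Im x ^+ 2)).
Proof. by case: x. Qed.
Lemma cReJ (x : C) : complex.Re x^* = complex.Re x.
Proof. by case: x. Qed.
Lemma cImJ (x : C) : complex.Im x^* = - complex.Im x.
Proof. by case: x. Qed.

Lemma complexP (x y : C) :
  complex.Re x = complex.Re y -> complex.Im x = complex.Im y -> x = y.
Proof. by case: x y => a b [c d] /= -> ->. Qed.

Lemma sumsqr_neq0 (x : C) : x != 0 -> complex.Re x ^+ 2 + complex.Im x ^+ 2 != 0.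
Proof.
case: x => a b; rewrite eq_complex /= => h; apply: contra h => /eqP h.
have a0 := sqr_ge0 a; have b0 := sqr_ge0 b.
by rewrite -(sqrf_eq0 a) -(sqrf_eq0 b); apply/andP; split; apply/eqP; lra.
Qed.

Lemma cRe_sum I (r : seq I) (P : pred I) (F : I -> C) :
  complex.Re (\sum_(i <- r | P i) F i) = \sum_(i <- r | P i) complex.Re (F i).
Proof. by apply: (big_morph _ cReD). Qed.
Lemma cIm_sum I (r : seq I) (P : pred I) (F : I -> C) :
  complex.Im (\sum_(i <- r | P i) F i) = \sum_(i <- r | P i) complex.Im (F i).
Proof. by apply: (big_morph _ cImD). Qed.

Definition ccont (T : topologicalType) (x : T) (F : T -> C) : Prop :=
  continuous_at x (fun t => complex.Re (F t)) /\
  continuous_at x (fun t => complex.Im (F t)).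

Section ccont.
Variables (T : topologicalType) (x : T).
Implicit Types F G : T -> C.

Lemma ccont_cst c : ccont x (fun=> c).
Proof. by split; exact: cst_continuous. Qed.

Lemma ccont_real (f : T -> R) : {for x, continuous f} ->
  ccont x (fun t => (f t)%:C).
Proof. by split => //=; exact: cst_continuous. Qed.

Lemma eq_ccont F G : F =1 G -> ccont x F -> ccont x G.
Proof. by move=> /funext ->. Qed.

Lemma ccontD F G : ccont x F -> ccont x G -> ccont x (fun t => F t + G t).
Proof.
move=> [F1 F2] [G1 G2]; split; under eq_fun do rewrite ?(cReD, cImD);
  exact: cvgD.
Qed.

Lemma ccontN F : ccont x F -> ccont x (fun t => - F t).
Proof.
move=> [F1 F2]; split; under eq_fun do rewrite ?(cReN, cImN); exact: cvgN.
Qed.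

Lemma ccontB F G : ccont x F -> ccont x G -> ccont x (fun t => F t - G t).
Proof. by move=> cF cG; apply: ccontD => //; exact: ccontN. Qed.

Lemma ccontM F G : ccont x F -> ccont x G -> ccont x (fun t => F t * G t).
Proof.
move=> [F1 F2] [G1 G2]; split; under eq_fun do rewrite ?(cReM, cImM).
  by apply: cvgB; apply: cvgM.
by apply: cvgD; apply: cvgM.
Qed.

Lemma ccontV F : F x != 0 -> ccont x F -> ccont x (fun t => (F t)^-1).
Proof.
move=> /sumsqr_neq0 Fx0 [F1 F2].
have c2 : continuous_at x (fun t => (complex.Re (F t) ^+ 2 + complex.Im (F t) ^+ 2)^-1).
  by apply: cvgV => //; apply: cvgD; apply: cvgM.
split; under eq_fun do rewrite ?(cReV, cImV).
  exact: cvgM.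
by apply: cvgN; exact: cvgM.
Qed.

Lemma ccontJ F : ccont x F -> ccont x (fun t => (F t)^*).
Proof.
move=> [F1 F2]; split; under eq_fun do rewrite ?(cReJ, cImJ); first exact: F1.
exact: cvgN.
Qed.

Lemma ccont_sum I (r : seq I) (P : pred I) (F : I -> T -> C) :
  (forall i, ccont x (F i)) -> ccont x (fun t => \sum_(i <- r | P i) F i t).
Proof.
move=> cF; elim: r => [|i r ih].
  by apply: eq_ccont (ccont_cst _) => t; rewrite big_nil.
case Pi : (P i); last by apply: eq_ccont ih => t; rewrite big_cons Pi.
by apply: eq_ccont (ccontD (cF i) ih) => t; rewrite big_cons Pi.
Qed.

Lemma ccont_prod I (r : seq I) (P : pred I) (F : I -> T -> C) :
  (forall i, ccont x (F i)) -> ccont x (fun t => \prod_(i <- r | P i) F i t).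
Proof.
move=> cF; elim: r => [|i r ih].
  by apply: eq_ccont (ccont_cst _) => t; rewrite big_nil.
case Pi : (P i); last by apply: eq_ccont ih => t; rewrite big_cons Pi.
by apply: eq_ccont (ccontM (cF i) ih) => t; rewrite big_cons Pi.
Qed.

Lemma ccont_neq0 F : ccont x F -> F x != 0 -> \forall t \near x, F t != 0.
Proof.
move=> [F1 F2] /sumsqr_neq0 Fx0.
have c2 : continuous_at x (fun t => complex.Re (F t) ^+ 2 + complex.Im (F t) ^+ 2).
  by apply: cvgD; apply: cvgM.
have n2 : \forall t \near x, complex.Re (F t) ^+ 2 + complex.Im (F t) ^+ 2 != 0.
  exact: cvgr_neq0 c2 Fx0.
apply: filterS n2 => t; apply: contra => /eqP ->.
by rewrite /= !expr0n /= addr0.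
Qed.

End ccont.

Lemma ccont_comp (T U : topologicalType) (x : T) (g : T -> U) (F : U -> C) :
  {for x, continuous g} -> ccont (g x) F -> ccont x (fun t => F (g t)).
Proof.
move=> cg [F1 F2]; split.
  exact: (continuous_comp cg F1).
exact: (continuous_comp cg F2).
Qed.

Definition cder (u : R) (F : R -> C) (l : C) : Prop :=
  is_derive u (1 : R) (fun t => complex.Re (F t)) (complex.Re l) /\
  is_derive u (1 : R) (fun t => complex.Im (F t)) (complex.Im l).

Section cder.
Variable u : R.
Implicit Types F G : R -> C.

Lemma cder_eq F l l' : cder u F l -> l = l' -> cder u F l'.
Proof. by move=> ? <-. Qed.

Lemma eq_cder F G l : F =1 G -> cder u F l -> cder u G l.
Proof. by move=> /funext ->. Qed.

Lemma cder_cst c : cder u (fun=> c) 0.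
Proof. by split; exact: is_derive_cst. Qed.

Lemma cder_real (f : R -> R) (l : R) : is_derive u (1 : R) f l ->
  cder u (fun t => (f t)%:C) l%:C.
Proof. by split => //=; exact: is_derive_cst. Qed.

Lemma cderD F G l k : cder u F l -> cder u G k ->
  cder u (fun t => F t + G t) (l + k).
Proof.
move=> [F1 F2] [G1 G2]; split; under eq_fun do rewrite ?(cReD, cImD);
  rewrite ?(cReD, cImD); exact: is_deriveD.
Qed.

Lemma cderN F l : cder u F l -> cder u (fun t => - F t) (- l).
Proof.
move=> [F1 F2]; split; under eq_fun do rewrite ?(cReN, cImN);
  rewrite ?(cReN, cImN); exact: is_deriveN.
Qed.

Lemma cderB F G l k : cder u F l -> cder u G k ->
  cder u (fun t => F t - G t) (l - k).
Proof. by move=> cF cG; apply: cderD => //; exact: cderN. Qed.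

Lemma cderM F G l k : cder u F l -> cder u G k ->
  cder u (fun t => F t * G t) (l * G u + F u * k).
Proof.
move=> [F1 F2] [G1 G2]; split.
  under eq_fun do rewrite cReM.
  by apply: eq_derive_val (dB (dM F1 G1) (dM F2 G2)) _; rewrite cReD !cReM; ring.
under eq_fun do rewrite cImM.
by apply: eq_derive_val (dD (dM F1 G2) (dM F2 G1)) _; rewrite cImD !cImM; ring.
Qed.

Lemma cderV F l : F u != 0 -> cder u F l ->
  cder u (fun t => (F t)^-1) (- l / F u ^+ 2).
Proof.
move=> Fu0 [F1 F2]; have n0 := sumsqr_neq0 Fu0.
have D0 := dD (dX2 F1) (dX2 F2).
have D2 := @dV _ _ (fun t => complex.Re (F t) ^+ 2 + complex.Im (F t) ^+ 2)
  u 1 _ n0 D0.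
split.
  under eq_fun do rewrite cReV.
  apply: eq_derive_val (dM F1 D2) _; rewrite ?(cReM, cReN, cReV, cImN, cImV, cImM, expr2).
  have m0 : (complex.Re (F u) * complex.Re (F u) - complex.Im (F u) * complex.Im (F u)) ^+ 2
    + (complex.Re (F u) * complex.Im (F u) + complex.Im (F u) * complex.Re (F u)) ^+ 2 != 0.
    rewrite (_ : _ + _ = (complex.Re (F u) ^+ 2 + complex.Im (F u) ^+ 2) ^+ 2); last by ring.
    by rewrite expf_neq0.
  by field; rewrite -!expr2 m0 n0.
under eq_fun do rewrite cImV.
apply: eq_derive_val (dN (dM F2 D2)) _; rewrite ?(cReM, cReN, cReV, cImN, cImV, cImM, expr2).
have m0 : (complex.Re (F u) * complex.Re (F u) - complex.Im (F u) * complex.Im (F u)) ^+ 2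
    + (complex.Re (F u) * complex.Im (F u) + complex.Im (F u) * complex.Re (F u)) ^+ 2 != 0.
    rewrite (_ : _ + _ = (complex.Re (F u) ^+ 2 + complex.Im (F u) ^+ 2) ^+ 2); last by ring.
    by rewrite expf_neq0.
by field; rewrite -!expr2 m0 n0.
Qed.

End cder.
End ComplexCalculus.

(** * Integrals of complex-valued functions *)

Section ComplexIntegral.
Variable R : realType.
Local Notation C := R[i].
Implicit Types (a b u : R) (F G : R -> C).

Definition CI a b F : C :=
  RI a b (fun t => complex.Re (F t)) +i* RI a b (fun t => complex.Im (F t)).

Definition cconton a b F := forall x, a <= x <= b -> ccont x F.

Lemma cconton_re a b F : cconton a b F -> conton a b (fun t => complex.Re (F t)).
Proof. by move=> cF x /cF []. Qed.
Lemma cconton_im a b F : cconton a b F -> conton a b (fun t => complex.Im (F t)).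
Proof. by move=> cF x /cF []. Qed.

Lemma eq_CI a b F G : (forall x, a <= x <= b -> F x = G x) -> CI a b F = CI a b G.
Proof.
by move=> FG; rewrite /CI; congr (_ +i* _); apply: eq_RI => x xab; rewrite FG.
Qed.

Lemma CID a b F G : cconton a b F -> cconton a b G ->
  CI a b (fun x => F x + G x) = CI a b F + CI a b G.
Proof.
move=> cF cG; apply: complexP; rewrite ?cReD ?cImD /= -RID.
- by apply: eq_RI => x _; rewrite cReD.
- exact: cconton_re.
- exact: cconton_re.
- by apply: eq_RI => x _; rewrite cImD.
- exact: cconton_im.
- exact: cconton_im.
Qed.

Lemma CIZ a b (c : C) F : cconton a b F ->
  CI a b (fun x => c * F x) = c * CI a b F.
Proof.
move=> cF; have cr := cconton_re cF; have ci := cconton_im cF.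
have cZ k f : conton a b f -> conton a b (fun x => k * f x).
  by move=> cf x xab; apply: cvgM; [exact: cst_continuous | exact: cf].
apply: complexP; rewrite ?cReM ?cImM /=.
  transitivity (RI a b (fun x => complex.Re c * complex.Re (F x) -
      complex.Im c * complex.Im (F x))).
    by apply: eq_RI => x _; rewrite cReM.
  by rewrite RIB ?RIZ //; exact: cZ.
transitivity (RI a b (fun x => complex.Re c * complex.Im (F x) +
    complex.Im c * complex.Re (F x))).
  by apply: eq_RI => x _; rewrite cImM.
by rewrite RID ?RIZ //; exact: cZ.
Qed.

Lemma CIZr a b (c : C) F : cconton a b F ->
  CI a b (fun x => F x * c) = CI a b F * c.
Proof.
by move=> cF; rewrite mulrC -CIZ //; apply: eq_CI => x _; rewrite mulrC.
Qed.

Lemma CI0 a b : CI a b (fun=> 0) = 0.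
Proof. by rewrite /CI !RI0. Qed.

Lemma CIJ a b F : cconton a b F -> CI a b (fun x => (F x)^*) = (CI a b F)^*.
Proof.
move=> cF; apply: complexP; rewrite ?cReJ ?cImJ /= -?RIN.
- by apply: eq_RI => x _; rewrite cReJ.
- by apply: eq_RI => x _; rewrite cImJ.
- exact: cconton_im.
Qed.

Lemma CI_sum a b I (r : seq I) (P : pred I) (F : I -> R -> C) :
  (forall i, cconton a b (F i)) ->
  CI a b (fun x => \sum_(i <- r | P i) F i x) = \sum_(i <- r | P i) CI a b (F i).
Proof.
move=> cF; elim: r => [|i r ih].
  by rewrite big_nil -[RHS](CI0 a b); apply: eq_CI => x _; rewrite big_nil.
rewrite big_cons -ih; case: ifP => Pi; last first.
  by apply: eq_CI => x _; rewrite big_cons Pi.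
rewrite -CID //; last by move=> x xab; apply: ccont_sum => j; exact: cF.
by apply: eq_CI => x _; rewrite big_cons Pi.
Qed.

Lemma CI_FTC a b F G : a < b -> cconton a b F ->
  (forall x, a <= x <= b -> cder x G (F x)) -> CI a b F = G b - G a.
Proof.
move=> ab cF dG; apply: complexP; rewrite ?(cReD, cImD, cReN, cImN) /=.
  apply: (@RI_FTC _ _ _ _ (fun t => complex.Re (G t))) => //.
    exact: cconton_re.
  by move=> x /dG [].
apply: (@RI_FTC _ _ _ _ (fun t => complex.Im (G t))) => //.
  exact: cconton_im.
by move=> x /dG [].
Qed.

Lemma CI_ccont (T : topologicalType) (t0 : T) (h : T -> R -> C) a b :
  a <= b ->
  (forall x, a <= x <= b -> ccont (t0, x) (fun z => h z.1 z.2)) ->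
  (\forall t \near t0, cconton a b (h t)) ->
  ccont t0 (fun t => CI a b (h t)).
Proof.
move=> ab ch nh; split.
  apply: (@RI_continuous_at _ _ _ (fun t x => complex.Re (h t x))) => //.
    by move=> x /ch [].
  by apply: filterS nh => t; exact: cconton_re.
apply: (@RI_continuous_at _ _ _ (fun t x => complex.Im (h t x))) => //.
  by move=> x /ch [].
by apply: filterS nh => t; exact: cconton_im.
Qed.

Lemma CI_cder (h h' : R -> R -> C) u a b : a <= b ->
  (\forall w \near u, cconton a b (h w)) ->
  (\forall w \near u, forall x, a <= x <= b -> cder w (h ^~ x) (h' w x)) ->
  (forall x, a <= x <= b -> ccont (u, x) (fun z => h' z.1 z.2)) ->
  cconton a b (h' u) ->
  cder u (fun w => CI a b (h w)) (CI a b (h' u)).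
Proof.
move=> ab nc nd ch' c0; split.
  apply: (@RI_derive _ (fun w x => complex.Re (h w x)) (fun w x => complex.Re (h' w x))) => //.
  - by apply: filterS nc => t; exact: cconton_re.
  - by apply: filterS nd => t H x /H [].
  - by move=> x /ch' [].
  - exact: cconton_re.
apply: (@RI_derive _ (fun w x => complex.Im (h w x)) (fun w x => complex.Im (h' w x))) => //.
- by apply: filterS nc => t; exact: cconton_im.
- by apply: filterS nd => t H x /H [].
- by move=> x /ch' [].
- exact: cconton_im.
Qed.

End ComplexIntegral.

(** * Continuity and derivatives of matrix-valued functions *)

Section MatrixCalculus.
Variable R : realType.
Local Notation C := R[i].

Definition mcont (T : topologicalType) (x : T) m n (F : T -> 'M[C]_(m, n)) :=
  forall i j, ccont x (fun t => F t i j).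

Definition mder (u : R) m n (F : R -> 'M[C]_(m, n)) (L : 'M[C]_(m, n)) :=
  forall i j, cder u (fun t => F t i j) (L i j).

Definition cdif (u : R) (F : R -> C) := exists l, cder u F l.

Section mcont.
Variables (T : topologicalType) (x : T).

Lemma near_eq_ccont (F G : T -> C) : (\forall t \near x, F t = G t) ->
  ccont x F -> ccont x G.
Proof.
move=> FG [H1 H2]; have e0 := nbhs_singleton FG.
split; rewrite /continuous_at /= -e0.
  by apply/(cvg_trans _ H1)/near_eq_cvg; apply: filterS FG => t ->.
by apply/(cvg_trans _ H2)/near_eq_cvg; apply: filterS FG => t ->.
Qed.

Lemma mcont_cst m n (A : 'M[C]_(m, n)) : mcont x (fun=> A).
Proof. by move=> i j; exact: ccont_cst. Qed.

Lemma mcontD m n (F G : T -> 'M[C]_(m, n)) : mcont x F -> mcont x G ->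
  mcont x (fun t => F t + G t).
Proof.
by move=> cF cG i j; apply: eq_ccont (ccontD (cF i j) (cG i j)) => t; rewrite mxE.
Qed.

Lemma mcontN m n (F : T -> 'M[C]_(m, n)) : mcont x F -> mcont x (fun t => - F t).
Proof.
by move=> cF i j; apply: eq_ccont (ccontN (cF i j)) => t; rewrite mxE.
Qed.

Lemma mcontB m n (F G : T -> 'M[C]_(m, n)) : mcont x F -> mcont x G ->
  mcont x (fun t => F t - G t).
Proof. by move=> cF cG; apply: mcontD => //; exact: mcontN. Qed.

Lemma mcontZ m n (f : T -> C) (F : T -> 'M[C]_(m, n)) : ccont x f -> mcont x F ->
  mcont x (fun t => f t *: F t).
Proof.
by move=> cf cF i j; apply: eq_ccont (ccontM cf (cF i j)) => t; rewrite mxE.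
Qed.

Lemma mcont_scalar n (f : T -> C) : ccont x f -> mcont x (fun t => (f t)%:M : 'M[C]_n).
Proof.
move=> cf i j; have [->|ij] := eqVneq i j.
  by apply: eq_ccont cf => t; rewrite mxE eqxx.
by apply: eq_ccont (ccont_cst _ 0) => t; rewrite mxE (negbTE ij).
Qed.

Lemma mcontM m n p (F : T -> 'M[C]_(m, n)) (G : T -> 'M[C]_(n, p)) :
  mcont x F -> mcont x G -> mcont x (fun t => F t *m G t).
Proof.
move=> cF cG i j.
have := @ccont_sum _ _ x _ (index_enum 'I_n) xpredT (fun k t => F t i k * G t k j)
  (fun k => ccontM (cF i k) (cG k j)).
by apply: eq_ccont => t; rewrite mxE.
Qed.

Lemma ccont_det n (F : T -> 'M[C]_n) : mcont x F -> ccont x (fun t => \det (F t)).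
Proof.
move=> cF; apply: ccont_sum => s; apply: ccontM; first exact: ccont_cst.
by apply: ccont_prod => i; exact: cF.
Qed.

Lemma mcont_adj n (F : T -> 'M[C]_n) : mcont x F -> mcont x (fun t => \adj (F t)).
Proof.
move=> cF i j.
have := @ccont_det _ (fun t => row' j (col' i (F t))) => H.
apply: eq_ccont (ccontM (ccont_cst x ((-1) ^+ (j + i))) (H _)) => [t|k l].
  by rewrite mxE.
by apply: eq_ccont (cF (lift j k) (lift i l)) => t; rewrite !mxE.
Qed.

(** By Cramer's rule the inverse is the adjugate over the determinant, and the determinant stays
    nonzero near x. *)
Lemma mcont_inv n (F : T -> 'M[C]_n) : F x \in unitmx -> mcont x F ->
  (\forall t \near x, F t \in unitmx) /\ mcont x (fun t => invmx (F t)).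
Proof.
move=> Fx cF; have cd := ccont_det cF.
have dx : \det (F x) != 0 by rewrite -unitfE -unitmxE.
have nu : \forall t \near x, F t \in unitmx.
  by apply: filterS (ccont_neq0 cd dx) => t dt; rewrite unitmxE unitfE.
split=> // i j.
have H := ccontM (ccontV dx cd) (mcont_adj cF i j).
have nE : \forall t \near x, (\det (F t))^-1 * (\adj (F t)) i j = (invmx (F t)) i j.
  by apply: filterS nu => t ut; rewrite /invmx ut [RHS]mxE.
exact: near_eq_ccont nE H.
Qed.

Lemma mcont_trC m n (F : T -> 'M[C]_(m, n)) : mcont x F -> mcont x (fun t => (F t) ^t*).
Proof.
by move=> cF i j; apply: eq_ccont (ccontJ (cF j i)) => t; rewrite !mxE.
Qed.

End mcont.

Section mder.
Variable u : R.

Lemma mder_cst m n (A : 'M[C]_(m, n)) : mder u (fun=> A) 0.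
Proof. by move=> i j; rewrite mxE; exact: cder_cst. Qed.

Lemma mderD m n (F G : R -> 'M[C]_(m, n)) L K : mder u F L -> mder u G K ->
  mder u (fun t => F t + G t) (L + K).
Proof.
move=> cF cG i j; rewrite mxE.
by apply: eq_cder (cderD (cF i j) (cG i j)) => t; rewrite mxE.
Qed.

Lemma mderN m n (F : R -> 'M[C]_(m, n)) L : mder u F L -> mder u (fun t => - F t) (- L).
Proof.
by move=> cF i j; rewrite mxE; apply: eq_cder (cderN (cF i j)) => t; rewrite mxE.
Qed.

Lemma mderB m n (F G : R -> 'M[C]_(m, n)) L K : mder u F L -> mder u G K ->
  mder u (fun t => F t - G t) (L - K).
Proof. by move=> cF cG; apply: mderD => //; exact: mderN. Qed.

Lemma mderZ m n (f : R -> C) (F : R -> 'M[C]_(m, n)) l L : cder u f l -> mder u F L ->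
  mder u (fun t => f t *: F t) (l *: F u + f u *: L).
Proof.
move=> cf cF i j; rewrite !mxE.
by apply: eq_cder (cderM cf (cF i j)) => t; rewrite mxE.
Qed.

Lemma mder_scalar n (f : R -> C) l : cder u f l ->
  mder u (fun t => (f t)%:M : 'M[C]_n) l%:M.
Proof.
move=> cf i j; rewrite mxE; have [->|ij] := eqVneq i j.
  by rewrite mulr1n; apply: eq_cder cf => t; rewrite mxE eqxx.
by rewrite mulr0n; apply: eq_cder (cder_cst u 0) => t; rewrite mxE (negbTE ij).
Qed.

Lemma cder_sum I (r : seq I) (P : pred I) (F : I -> R -> C) (l : I -> C) :
  (forall i, cder u (F i) (l i)) ->
  cder u (fun t => \sum_(i <- r | P i) F i t) (\sum_(i <- r | P i) l i).
Proof.
move=> cF; elim: r => [|i r ih].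
  by rewrite big_nil; apply: eq_cder (cder_cst u 0) => t; rewrite big_nil.
rewrite big_cons; case: ifP => Pi.
  by apply: eq_cder (cderD (cF i) ih) => t; rewrite big_cons Pi.
by apply: eq_cder ih => t; rewrite big_cons Pi.
Qed.

Lemma mderM m n p (F : R -> 'M[C]_(m, n)) (G : R -> 'M[C]_(n, p)) L K :
  mder u F L -> mder u G K ->
  mder u (fun t => F t *m G t) (L *m G u + F u *m K).
Proof.
move=> cF cG i j.
have := @cder_sum _ (index_enum 'I_n) xpredT (fun k t => F t i k * G t k j) _
  (fun k => cderM (cF i k) (cG k j)).
rewrite big_split !mxE /= => H.
by apply: eq_cder H => t; rewrite mxE.
Qed.

Lemma cdif_sum I (r : seq I) (P : pred I) (F : I -> R -> C) :
  (forall i, cdif u (F i)) -> cdif u (fun t => \sum_(i <- r | P i) F i t).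
Proof.
move=> /choice [l cF]; exists (\sum_(i <- r | P i) l i); exact: cder_sum.
Qed.

Lemma cdif_prod I (r : seq I) (P : pred I) (F : I -> R -> C) :
  (forall i, cdif u (F i)) -> cdif u (fun t => \prod_(i <- r | P i) F i t).
Proof.
move=> cF; elim: r => [|i r [l ih]].
  by exists 0; apply: eq_cder (cder_cst u 1) => t; rewrite big_nil.
have [k ck] := cF i; case Pi : (P i).
  by eexists; apply: eq_cder (cderM ck ih) => t; rewrite big_cons Pi.
by exists l; apply: eq_cder ih => t; rewrite big_cons Pi.
Qed.

Lemma cdif_det n (F : R -> 'M[C]_n) : (forall i j, cdif u (fun t => F t i j)) ->
  cdif u (fun t => \det (F t)).
Proof.
move=> cF; apply: cdif_sum => s.
have [l H] := @cdif_prod _ (index_enum 'I_n) xpredT (fun i t => F t i (s i))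
  (fun i => cF i _).
by eexists; exact: cderM (cder_cst u _) H.
Qed.

Lemma cder_ccont F l : cder u F l -> ccont u F.
Proof.
by move=> [[d1 _] [d2 _]]; split;
  exact/differentiable_continuous/derivable1_diffP.
Qed.

Lemma mder_mcont m n (F : R -> 'M[C]_(m, n)) L : mder u F L -> mcont u F.
Proof. by move=> cF i j; exact: cder_ccont (cF i j). Qed.

Lemma cder_uniq F l k : cder u F l -> cder u F k -> l = k.
Proof.
by move=> [[_ d1] [_ d2]] [[_ e1] [_ e2]]; apply: complexP; rewrite -?e1 -?e2.
Qed.

Lemma near_eq_cder F G l : (\forall t \near u, F t = G t) -> cder u F l -> cder u G l.
Proof.
move=> FG [d1 d2]; split.
  by apply: near_eq_is_derive d1; apply: filterS FG => t ->.
by apply: near_eq_is_derive d2; apply: filterS FG => t ->.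
Qed.

(** Cramer's rule shows that the entries of the inverse are differentiable; the value of the
    derivative then comes from differentiating the identity F F^{-1} = 1. *)
Lemma mder_inv n (F : R -> 'M[C]_n) L : F u \in unitmx -> mder u F L ->
  mder u (fun t => invmx (F t)) (- (invmx (F u) *m L *m invmx (F u))).
Proof.
move=> Fu dF; have [nu cI] := mcont_inv Fu (mder_mcont dF).
have dx : \det (F u) != 0 by rewrite -unitfE -unitmxE.
have fF i j : cdif u (fun t => F t i j) by exists (L i j).
have [ld Dd] := cdif_det fF.
have dI i j : cdif u (fun t => invmx (F t) i j).
  have [la Da] : cdif u (fun t => \det (row' j (col' i (F t)))).
    apply: cdif_det => k l; exists (L (lift j k) (lift i l)).
    by apply: eq_cder (dF (lift j k) (lift i l)) => t; rewrite !mxE.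
  have D1 := cderM (cderV dx Dd) (cderM (cder_cst u ((-1) ^+ (j + i))) Da).
  eexists; apply: near_eq_cder D1; apply: filterS nu => t ut.
  by rewrite /invmx ut !mxE.
have [K DK] : exists K, mder u (fun t => invmx (F t)) K.
  have /choice [f Hf] : forall i, exists g : 'I_n -> C, forall j, cder u (fun t => invmx (F t) i j) (g j).
    by move=> i; have [g Hg] := choice (dI i); exists g.
  by exists (\matrix_(i, j) f i j) => i j; rewrite mxE.
have E : L *m invmx (F u) + F u *m K = 0.
  apply/matrixP => i j.
  apply: cder_uniq (mderM dF DK i j) _; rewrite mxE.
  apply: near_eq_cder (cder_cst u ((1%:M : 'M[C]_n) i j)).
  by apply: filterS nu => t ut; rewrite mulmxV.
suff -> : - (invmx (F u) *m L *m invmx (F u)) = K by [].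
move/eqP: E; rewrite addr_eq0 => /eqP E.
by rewrite -mulmxA E mulmxN opprK mulKmx.
Qed.

End mder.
End MatrixCalculus.

(** * Good matrices and their diagonalisation by congruence *)

Section Pencil.
Variable R : realType.
Local Notation C := R[i].

Lemma adjM m n p (A : 'M[C]_(m, n)) (B : 'M[C]_(n, p)) :
  (A *m B) ^t* = B ^t* *m A ^t*.
Proof. by rewrite trmx_mul map_mxM. Qed.

Lemma adjD m n (A B : 'M[C]_(m, n)) : (A + B) ^t* = A ^t* + B ^t*.
Proof. by rewrite linearD /= map_mxD. Qed.

Lemma adjN m n (A : 'M[C]_(m, n)) : (- A) ^t* = - A ^t*.
Proof. by rewrite linearN /= map_mxN. Qed.

Lemma adjZ m n (c : C) (A : 'M[C]_(m, n)) : (c *: A) ^t* = c^* *: A ^t*.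
Proof. by rewrite linearZ /= map_mxZ. Qed.

Lemma adjK m n (A : 'M[C]_(m, n)) : A ^t* ^t* = A.
Proof. exact: trmxCK. Qed.

Lemma adj_unit n (A : 'M[C]_n) : (A ^t* \in unitmx) = (A \in unitmx).
Proof. by rewrite map_unitmx unitmx_tr. Qed.

Lemma adj_inv n (A : 'M[C]_n) : (invmx A) ^t* = invmx (A ^t*).
Proof. by rewrite trmx_inv map_invmx. Qed.

Lemma adj_scalar n (c : C) : ((c%:M : 'M[C]_n) ^t*) = (c^*)%:M.
Proof. by rewrite tr_scalar_mx map_scalar_mx. Qed.

Definition form n (X : 'M[C]_n) (u v : 'cV[C]_n) : C := (u ^t* *m X *m v) 0 0.

(** The vectors v in question are the eigenvectors of the pencil formed by X and its adjoint, the
    ratio of [mu] and [nu] being allowed to be infinite; the condition says that none of them is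
    isotropic for the form of X. It is invariant under congruence. *)
Definition good n (X : 'M[C]_n) : Prop :=
  forall (v : 'cV[C]_n) (mu nu : C), v != 0 -> (mu, nu) != (0, 0) ->
    mu *: (X *m v) = nu *: (X ^t* *m v) -> form X v v != 0.

Lemma form_congr n (X V : 'M[C]_n) u v :
  form (V ^t* *m X *m V) u v = form X (V *m u) (V *m v).
Proof. by rewrite /form adjM !mulmxA. Qed.

Lemma good_congr n (X V : 'M[C]_n) : V \in unitmx -> good X ->
  good (V ^t* *m X *m V).
Proof.
move=> uV gX v mu nu v0 munu E.
have Vv0 : V *m v != 0.
  by apply: contra v0 => /eqP Vv; rewrite -[v](mulKmx uV) Vv mulmx0.
have uVt : V ^t* \in unitmx by rewrite adj_unit.
rewrite form_congr; apply: (gX _ _ _ Vv0 munu).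
apply: (can_inj (mulKmx uVt)).
by move: E; rewrite !adjM adjK -!scalemxAr !mulmxA.
Qed.

(** A kernel vector of X is an isotropic eigenvector of the pencil, for the pair (1, 0). *)
Lemma good_unit n (X : 'M[C]_n) : good X -> X \in unitmx.
Proof.
move=> gX; rewrite -unitmx_tr -row_free_unit -kermx_eq0.
apply/rowV0P => r /sub_kermxP rX.
have XrT : X *m r^T = 0 by rewrite -[X]trmxK -trmx_mul rX trmx0.
apply/eqP/negPn/negP => r0.
have := gX r^T 1 0; rewrite xpair_eqE oner_eq0 /= XrT scaler0 scale0r.
have -> : r^T != 0 by rewrite -(inj_eq (@trmx_inj _ _ _)) trmxK trmx0.
by move=> /(_ isT isT erefl); rewrite /form -mulmxA XrT mulmx0 mxE eqxx.
Qed.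

Lemma good_dsub n (x : 'M[C]_1) (Y : 'M[C]_n) :
  good (block_mx x 0 0 Y) -> good Y.
Proof.
move=> gX v mu nu v0 munu E.
have w0 : col_mx (0 : 'cV[C]_1) v != 0.
  by apply: contra v0 => /eqP E0; rewrite -[v](@col_mxKd C 1 n 1 0) E0 linear0.
have H : form (block_mx x 0 0 Y) (col_mx 0 v) (col_mx 0 v) = form Y v v.
  rewrite /form -mulmxA mul_block_col !mul0mx mulmx0 !add0r.
  by rewrite tr_col_mx map_row_mx mul_row_col mulmx0 add0r mulmxA.
rewrite -H; apply: (gX _ _ _ w0 munu).
rewrite tr_block_mx map_block_mx !mul_block_col !trmx0 !map_mx0 !mul0mx !mulmx0.
by rewrite !add0r !scale_col_mx E !scaler0.
Qed.

(** The adjoint of X is invertible, so an eigenvector of its inverse times X, which exists over an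
    algebraically closed field, is an eigenvector of the pencil. *)
Lemma good_eigen n (X : 'M[C]_n.+1) : good X ->
  exists (a : C) (v : 'cV[C]_n.+1), v != 0 /\ X *m v = a *: (X ^t* *m v).
Proof.
move=> gX; have uXt : X ^t* \in unitmx by rewrite adj_unit good_unit.
have [a /eigenvalueP [r rE r0]] :=
  @eigenvalue_closed _ n.+1 ((invmx (X ^t*) *m X)^T) isT.
exists a, r^T; split; first by rewrite -(inj_eq (@trmx_inj _ _ _)) trmxK trmx0.
rewrite -[X in LHS](mulKVmx uXt) -mulmxA scalemxAr; congr (_ *m _).
by rewrite -[_ *m X]trmxK -trmx_mul rE linearZ.
Qed.

Lemma scale_comm m n (p q : C) (w : 'M[C]_(m, n)) : p *: (q *: w) = q *: (p *: w).
Proof. by rewrite !scalerA mulrC. Qed.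

(** A Gram-Schmidt step for a form that is not Hermitian. If X v = a X' v, where X' is the adjoint,
    the left and right orthogonal complements of v for the form of X coincide; as v is not
    isotropic, one congruence clears both the row and the column of the pivot. *)
Lemma good_split n (X : 'M[C]_(1 + n)) : good X ->
  exists (P : 'M[C]_(1 + n)) (x : 'M[C]_1) (Y : 'M[C]_n),
    P \in unitmx /\ P ^t* *m X *m P = block_mx x 0 0 Y.
Proof.
move=> gX; have [a [v [v0 vE]]] := good_eigen gX.
pose L : 'M[C]_(1 + n) := col_ebase v.
have uL : L \in unitmx by exact: col_ebase_unit.
have rk1 : \rank v = 1%N.
  by apply/eqP; rewrite eqn_leq rank_leq_col lt0n mxrank_eq0.
pose e0 : 'cV[C]_(1 + n) := col_mx 1%:M 0.
have eE : e0 = pid_mx 1.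
  by rewrite -[RHS]vsubmxK /e0; congr col_mx; apply/matrixP => i j; rewrite !mxE ?ord1.
(* Since [v] has rank one, the column base [L] sends the first basis vector to a scalar multiple of
   [v], hence to an eigenvector of the pencil. *)
have wE : X *m (L *m e0) = a *: (X ^t* *m (L *m e0)).
  have vL : v = row_ebase v 0 0 *: (L *m e0).
    rewrite -[LHS]mulmx_ebase rk1 -eE [row_ebase v]mx11_scalar.
    by rewrite mul_mx_scalar mxE eqxx mulr1n.
  have e00 : row_ebase v 0 0 != 0.
    by apply: contra v0 => /eqP h; rewrite vL h scale0r.
  have : X *m v = a *: (X ^t* *m v) by exact: vE.
  rewrite vL -!scalemxAr => vE'; apply: (scalerI e00).
  exact: etrans vE' (scale_comm _ _ _).
have gX1 := good_congr uL gX.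
set X1 := L ^t* *m X *m L in gX1.
have X1E : X1 *m e0 = a *: (X1 ^t* *m e0).
  rewrite /X1 !adjM adjK -!mulmxA wE; exact/esym/scalemxAr.
have e0n : e0 != 0.
  apply/eqP => /matrixP /(_ (lshift n 0) 0); rewrite col_mxEu !mxE eqxx => /eqP.
  by rewrite oner_eq0.
have f0 : form X1 e0 e0 != 0.
  apply: (gX1 _ 1 a e0n); first by rewrite xpair_eqE oner_eq0.
  by rewrite scale1r.
pose x := @ulsubmx C 1 n 1 n X1; pose r1 := @ursubmx C 1 n 1 n X1.
pose c := @dlsubmx C 1 n 1 n X1; pose Y := @drsubmx C 1 n 1 n X1.
have XB : X1 = block_mx x r1 c Y by rewrite -[LHS](@submxK C 1 n 1 n).
pose x0 := x 0 0.
have xE : x = x0%:M by exact: mx11_scalar.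
have x00 : x0 != 0.
  move: f0; rewrite /form XB /e0 -mulmxA mul_block_col !mulmx0 !addr0 !mulmx1.
  by rewrite tr_col_mx map_row_mx mul_row_col trmx0 map_mx0 mul0mx addr0 trmx1 map_mx1 mul1mx.
(* The pencil relation for the first basis vector, read blockwise: it ties the first column to the
   conjugate of the first row. *)
have [xa ca] : x0 = a * x0^* /\ c = a *: r1 ^t*.
  move: X1E; rewrite XB tr_block_mx map_block_mx /e0 !mul_block_col !mulmx0 !addr0 !mulmx1.
  rewrite scale_col_mx => /eq_col_mx [/matrixP /(_ 0 0)]; rewrite xE !mxE eqxx !mulr1n => E1 E2.
  by split; [exact: E1 | exact: E2].
(* This choice clears the upper right block; the two relations just obtained make it clear the lower
   left block as well. *)
pose s := - x0^-1 *: r1.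
pose T : 'M[C]_(1 + n) := block_mx 1%:M s 0 1%:M.
have uT : T \in unitmx by rewrite unitmxE det_ublock !det1 mulr1 unitr1.
have X2E : T ^t* *m X1 *m T = block_mx x 0 0 (c *m s + Y).
  rewrite -mulmxA XB /T mulmx_block tr_block_mx map_block_mx mulmx_block.
  rewrite !trmx1 !map_mx1 !trmx0 !map_mx0 !mulmx1 !mulmx0 !mul0mx !mul1mx !addr0.
  have -> : x *m s + r1 = 0.
    by rewrite xE mul_scalar_mx /s scalerA mulrN mulfV // scaleN1r addNr.
  rewrite mulmx0 add0r; congr block_mx.
  rewrite /s adjZ xE mul_mx_scalar ca scalerA -scalerDl.
  rewrite (_ : _ + a = 0) ?scale0r //.
  rewrite rmorphN mulrN fmorphV {1}xa -mulrA mulfV ?mulr1 ?addNr //.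
  by rewrite fmorph_eq0.
exists (L *m T), x, (c *m s + Y); split; first by rewrite unitmx_mul uL.
by rewrite -X2E /X1 adjM !mulmxA.
Qed.

Lemma good_diag n (X : 'M[C]_n) : good X ->
  exists (V : 'M[C]_n) (d : 'rV[C]_n), V \in unitmx /\ V ^t* *m X *m V = diag_mx d.
Proof.
elim: n X => [|n IH] X gX.
  by exists 1%:M, 0; split; [exact: unitmx1 | apply/matrixP => -[]].
have [Q [x [Y [uQ QE]]]] := @good_split n X gX.
have gX2 : good (block_mx x 0 0 Y) by rewrite -QE; exact: good_congr.
have [V [d [uV dE]]] := IH _ (good_dsub gX2).
pose P : 'M[C]_(1 + n) := block_mx 1%:M 0 0 V.
have uP : P \in unitmx by rewrite unitmxE det_ublock det1 mul1r -unitmxE.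
exists (Q *m P), (row_mx x d).
split; first by rewrite unitmx_mul uQ uP.
have -> : (Q *m P) ^t* *m X *m (Q *m P) = P ^t* *m (Q ^t* *m X *m Q) *m P.
  by rewrite adjM !mulmxA.
rewrite QE /P tr_block_mx map_block_mx !mulmx_block.
rewrite !trmx1 !map_mx1 !trmx0 !map_mx0 !mulmx1 !mulmx0 !mul0mx !mul1mx !addr0 !add0r.
rewrite dE; apply: etrans (esym (diag_mx_row x d)); congr block_mx.
  by apply/matrixP => i j; rewrite !ord1 !mxE.
by rewrite mul0mx.
Qed.

Lemma diag_mulv n (d : 'rV[C]_n) (w : 'cV[C]_n) i :
  (diag_mx d *m w) i 0 = d 0 i * w i 0.
Proof. by rewrite mul_diag_mx mxE. Qed.

Lemma adj_diag n (d : 'rV[C]_n) : (diag_mx d) ^t* = diag_mx (map_mx Num.conj d).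
Proof. by rewrite tr_diag_mx map_diag_mx. Qed.

Lemma form_diag n (d : 'rV[C]_n) (w : 'cV[C]_n) :
  form (diag_mx d) w w = \sum_i d 0 i * (w i 0 * (w i 0)^*).
Proof.
rewrite /form -mulmxA mxE; apply: eq_bigr => i _; rewrite diag_mulv !mxE.
by rewrite mulrCA; congr (_ * _); rewrite mulrC.
Qed.

Lemma good_diag_neq0 n (d : 'rV[C]_n) j : good (diag_mx d) -> d 0 j != 0.
Proof.
move=> gd; apply/eqP => dj0.
pose w : 'cV[C]_n := delta_mx j 0.
have w0 : w != 0.
  by apply/eqP => /matrixP /(_ j 0); rewrite !mxE !eqxx => /eqP; rewrite oner_eq0.
have : form (diag_mx d) w w != 0.
  apply: (gd w 1 0 w0); first by rewrite xpair_eqE oner_eq0.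
  rewrite scale1r scale0r; apply/matrixP => i k; rewrite ord1 diag_mulv !mxE.
  by have [->|ij] := eqVneq i j; rewrite ?dj0 ?mul0r //= mulr0.
rewrite form_diag big1 ?eqxx // => i _; rewrite !mxE.
by have [->|ij] := eqVneq i j; rewrite ?dj0 ?mul0r ?mulr0 /= ?mul0r ?mulr0.
Qed.

(** Two entries on opposite rays from the origin would allow a vector supported on the coordinates j
    and k, with suitable weights, that is an isotropic eigenvector of the pencil. So diagonal
    entries on a common real line lie on the same ray. *)
Lemma good_diag_same_side n (d : 'rV[C]_n) j k : good (diag_mx d) ->
  complex.Im (d 0 k * (d 0 j)^*) = 0 -> 0 < complex.Re (d 0 k * (d 0 j)^*).
Proof.
move=> gd im0; rewrite ltNge; apply/negP => re0.
have dj := good_diag_neq0 j gd; have dk := good_diag_neq0 k gd.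
have [jk|jk] := eqVneq k j.
  have := sumsqr_neq0 dj; move: re0 (sqr_ge0 (complex.Re (d 0 j))) (sqr_ge0 (complex.Im (d 0 j))).
  by rewrite jk cReM cReJ cImJ mulrN opprK -!expr2 => h1 h2 h3 /eqP; apply; lra.
pose r := (Num.sqrt (- complex.Re (d 0 k * (d 0 j)^*)))%:C.
pose q := `|d 0 j|.
have q0 : q != 0 by rewrite normr_eq0.
have q2 : q * q^* = d 0 j * (d 0 j)^*.
  by rewrite -[RHS]normCK expr2; congr (_ * _); apply/CrealP; rewrite normr_real.
have r2 : r * r^* = - (d 0 k * (d 0 j)^*).
  rewrite [r^*]conjc_real -rmorphM -expr2 sqr_sqrtr ?oppr_ge0 //.
  by apply: complexP; rewrite ?cReN ?cImN //= im0 oppr0.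
(* The weights are |r|^2 = - d_k conj(d_j) and |q|^2 = d_j conj(d_j), so that d_j |r|^2 + d_k |q|^2
   = 0. The pencil relation holds with mu = conj(d_j) and nu = d_j because d_k conj(d_j) is real. *)
pose w : 'cV[C]_n := \col_i (if i == j then r else if i == k then q else 0).
have w0 : w != 0.
  by apply/eqP => /matrixP /(_ k 0); rewrite !mxE (negbTE jk) eqxx; exact/eqP.
have : form (diag_mx d) w w != 0.
  apply: (gd w (d 0 j)^* (d 0 j) w0); first by rewrite xpair_eqE (negbTE dj) andbF.
  rewrite adj_diag; apply/matrixP => i l; rewrite ord1 mxE [in RHS]mxE !diag_mulv !mxE.
  have [->|ij] := eqVneq i j; first by rewrite mulrCA.
  have [->|ik] := eqVneq i k; last by rewrite !mulr0.
  rewrite !mulrA; congr (_ * _).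
  have : (d 0 k * (d 0 j)^*)^* = d 0 k * (d 0 j)^*.
    by apply: complexP; rewrite ?cReJ ?cImJ // im0 oppr0.
  by rewrite rmorphM /= conjCK mulrC => ->; rewrite mulrC.
rewrite form_diag (bigD1 j) //= (bigD1 k) //= big1 => [|i /andP[ij ik]].
  rewrite !mxE eqxx (negbTE jk) eqxx q2 r2 addr0 => /eqP; apply; ring.
by rewrite !mxE (negbTE ij) (negbTE ik) mul0r mulr0.
Qed.

End Pencil.

(** * Cosine and sine of a complex angle *)

Section ComplexAngle.
Variable R : realType.
Local Notation C := R[i].
Implicit Types (x t u : R).

Definition ch x : R := (expR x + expR (- x)) / 2.
Definition sh x : R := (expR x - expR (- x)) / 2.

Lemma ch2_sh2 x : ch x ^+ 2 - sh x ^+ 2 = 1.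
Proof.
have e : expR x * expR (- x) = 1 by rewrite -expRD subrr expR0.
rewrite (_ : _ - _ = expR x * expR (- x)) //.
by rewrite /ch /sh; field.
Qed.

Lemma ch_gt0 x : 0 < ch x.
Proof. by rewrite divr_gt0 // addr_gt0 // expR_gt0. Qed.

Lemma sh0 : sh 0 = 0.
Proof. by rewrite /sh oppr0 subrr mul0r. Qed.

Lemma ch0 : ch 0 = 1.
Proof. by rewrite /ch oppr0 expR0; lra. Qed.

Lemma sh_gt0 x : 0 < x -> 0 < sh x.
Proof. by move=> x0; rewrite divr_gt0 // subr_gt0 ltr_expR gtrN. Qed.

Lemma shN x : sh (- x) = - sh x.
Proof. by rewrite /sh opprK; ring. Qed.

Lemma is_derive_comp1 (f g : R -> R) u a b :
  is_derive (g u) (1 : R) f a -> is_derive u (1 : R) g b ->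
  is_derive u (1 : R) (fun t => f (g t)) (b * a).
Proof.
move=> df dg; apply: eq_derive_val (is_derive1_comp df dg) _.
by rewrite /GRing.scale /= mulrC.
Qed.

Lemma d_expN x : is_derive x (1 : R) (fun t => expR (- t)) (- expR (- x)).
Proof.
apply: eq_derive_val (is_derive_comp1 (is_derive_expR _) (dN (is_derive_id _ _))) _.
by rewrite mulN1r.
Qed.

Lemma d_ch x : is_derive x (1 : R) ch (sh x).
Proof.
apply: eq_derive_val (dM (dD (is_derive_expR x) (d_expN x)) (dcst 2^-1 _ _)) _.
by rewrite mulr0 addr0.
Qed.

Lemma d_sh x : is_derive x (1 : R) sh (ch x).
Proof.
apply: eq_derive_val (dM (dB (is_derive_expR x) (d_expN x)) (dcst 2^-1 _ _)) _.
by rewrite mulr0 addr0 opprK.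
Qed.

Lemma derive_cts (f : R -> R) (u l : R) : is_derive u (1 : R) f l -> {for u, continuous f}.
Proof. by move=> [df _]; exact/differentiable_continuous/derivable1_diffP. Qed.

(** [k1 t x] and [k2 t x] are the cosine and the sine of the complex angle t - i x. *)
Definition k1 t x : C := (cos t * ch x) +i* (sin t * sh x).
Definition k2 t x : C := (sin t * ch x) +i* (- (cos t * sh x)).

Lemma k_sqr t x : k1 t x ^+ 2 + k2 t x ^+ 2 = 1.
Proof.
have := cos2Dsin2 t => h1; have h2 := ch2_sh2 x.
apply: complexP; rewrite !expr2 ?(cReD, cImD) !(cReM, cImM) /=; last by ring.
transitivity ((cos t ^+ 2 + sin t ^+ 2) * (ch x ^+ 2 - sh x ^+ 2)); first by ring.
by rewrite h1 h2 mulr1.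
Qed.

(** The chain rule along the path of angles th - i et, whose velocity is a - i b. *)
Lemma cder_k (th et : R -> R) u a b :
  is_derive u (1 : R) th a -> is_derive u (1 : R) et b ->
  cder u (fun v => k1 (th v) (et v)) (- ((a +i* - b) * k2 (th u) (et u))) /\
  cder u (fun v => k2 (th v) (et v)) ((a +i* - b) * k1 (th u) (et u)).
Proof.
move=> dth det.
have dc := is_derive_comp1 (is_derive_cos (th u)) dth.
have ds := is_derive_comp1 (is_derive_sin (th u)) dth.
have dch := is_derive_comp1 (d_ch (et u)) det.
have dsh := is_derive_comp1 (d_sh (et u)) det.
split; split; rewrite !(cReN, cImN, cReM, cImM) /k1 /k2 /=.
- by apply: eq_derive_val (dM dc dch) _; ring.
- by apply: eq_derive_val (dM ds dsh) _; ring.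
- by apply: eq_derive_val (dM ds dch) _; ring.
- by apply: eq_derive_val (dN (dM dc dsh)) _; ring.
Qed.

Lemma ccont_k (T : topologicalType) (x : T) (th et : T -> R) :
  {for x, continuous th} -> {for x, continuous et} ->
  ccont x (fun v => k1 (th v) (et v)) /\ ccont x (fun v => k2 (th v) (et v)).
Proof.
move=> cth cet.
have cc : continuous_at x (fun v => cos (th v)).
  by apply: (@continuous_comp _ _ _ th cos x cth); exact: continuous_cos.
have cs : continuous_at x (fun v => sin (th v)).
  by apply: (@continuous_comp _ _ _ th sin x cth); exact: continuous_sin.
have cch : continuous_at x (fun v => ch (et v)).
  by apply: (@continuous_comp _ _ _ et ch x cet); exact: derive_cts (d_ch _).
have csh : continuous_at x (fun v => sh (et v)).
  by apply: (@continuous_comp _ _ _ et sh x cet); exact: derive_cts (d_sh _).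
split; split => /=.
- exact: cvgM.
- exact: cvgM.
- exact: cvgM.
- by apply: cvgN; exact: cvgM.
Qed.

End ComplexAngle.

Lemma mxZE (K : pzRingType) m n (c : K) (A : 'M[K]_(m, n)) i j : (c *: A) i j = c * A i j.
Proof. by rewrite mxE. Qed.

Lemma sandwichZ (K : comNzRingType) n (P Q L : 'M[K]_n) (c : K) :
  - (P *m (c *: L) *m Q + Q *m (c *: L) *m P) = - c *: (P *m L *m Q + Q *m L *m P).
Proof. by rewrite -!scalemxAr -!scalemxAl -scalerDr scaleNr. Qed.

(** * Moving the angle of integration into the complex domain *)

Section Deformation.
Variables (R : realType) (n : nat).
Local Notation C := R[i].
Implicit Types (B D : 'M[C]_n) (e : C).

Definition Mx (c1 c2 e : C) B D : 'M[C]_n := c1 *: B + c2 *: D - e%:M.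

Definition Nx (c1 c2 e : C) B D : 'M[C]_n := invmx (Mx c1 c2 e B D).

Lemma mder_Mx u (c1 c2 : R -> C) (d1 d2 : C) e B D :
  cder u c1 d1 -> cder u c2 d2 ->
  mder u (fun v => Mx (c1 v) (c2 v) e B D) (d1 *: B + d2 *: D).
Proof.
move=> h1 h2.
have := mderB (mderD (mderZ h1 (mder_cst u B)) (mderZ h2 (mder_cst u D)))
  (mder_cst u (e%:M : 'M[C]_n)).
by rewrite !scaler0 !addr0 subr0.
Qed.

Lemma mder_N2 u (M : R -> 'M[C]_n) (L : 'M[C]_n) : M u \in unitmx -> mder u M L ->
  mder u (fun v => invmx (M v) *m invmx (M v))
   (- (invmx (M u) *m L *m (invmx (M u) *m invmx (M u))
     + invmx (M u) *m invmx (M u) *m L *m invmx (M u))).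
Proof.
move=> uM dM; have dI := mder_inv uM dM.
have := mderM dI dI.
by rewrite mulNmx mulmxN -opprD !mulmxA.
Qed.

Lemma mcont_N2 (T : topologicalType) (x : T) (M : T -> 'M[C]_n) :
  M x \in unitmx -> mcont x M -> mcont x (fun v => invmx (M v) *m invmx (M v)).
Proof. by move=> uM cM; have [_ cI] := mcont_inv uM cM; exact: mcontM. Qed.

Variables (s s' : R -> R).
Hypothesis ds : forall t, is_derive t (1 : R) s (s' t).
Hypothesis cs' : continuous s'.
Hypothesis s_per : s (2 * pi) = s 0.

Let cs : continuous s.
Proof. by move=> t; exact: derive_cts (ds t). Qed.

(** The matrix at the complex angle t - i sg s(t); [speed] is the derivative of this angle in t. *)
Definition Mg e B D (sg t : R) := Mx (k1 t (sg * s t)) (k2 t (sg * s t)) e B D.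
Definition speed (sg t : R) : C := 1 +i* (- (sg * s' t)).

Lemma cts_pair1 (T U : topologicalType) (z : T * U) : {for z, continuous (fun y : T * U => y.1)}.
Proof. exact: cvg_fst. Qed.

Lemma cts_pair2 (T U : topologicalType) (z : T * U) : {for z, continuous (fun y : T * U => y.2)}.
Proof. exact: cvg_snd. Qed.

Section joint.
Variables (e : C) (B D : 'M[C]_n) (z : R * R).

Let cs2 : continuous_at z (fun y : R * R => s y.2).
Proof. apply: (@continuous_comp _ _ _ (fun y : R * R => y.2) s z (@cts_pair2 _ _ z)); exact: cs. Qed.

Let cs2' : continuous_at z (fun y : R * R => s' y.2).
Proof. apply: (@continuous_comp _ _ _ (fun y : R * R => y.2) s' z (@cts_pair2 _ _ z)); exact: cs'. Qed.

Let cet : continuous_at z (fun y : R * R => y.1 * s y.2).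
Proof. by apply: cvgM; [exact: cts_pair1 | exact: cs2]. Qed.

Lemma ccont_kk :
  ccont z (fun y : R * R => k1 y.2 (y.1 * s y.2)) /\
  ccont z (fun y : R * R => k2 y.2 (y.1 * s y.2)).
Proof. exact: (ccont_k (@cts_pair2 _ _ z) cet). Qed.

Lemma mcont_Mg : mcont z (fun y : R * R => Mg e B D y.1 y.2).
Proof.
have [h1 h2] := ccont_kk.
apply: mcontB; last exact: mcont_cst.
by apply: mcontD; apply: mcontZ => //; exact: mcont_cst.
Qed.

Lemma ccont_speed : ccont z (fun y : R * R => speed y.1 y.2).
Proof.
split; first exact: cst_continuous.
by apply: cvgN; apply: cvgM; [exact: cts_pair1 | exact: cs2'].
Qed.

Lemma ccont_is : ccont z (fun y : R * R => 0 +i* (- s y.2) : C).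
Proof. by split; [exact: cst_continuous | apply: cvgN; exact: cs2]. Qed.

Lemma ccont_is' : ccont z (fun y : R * R => 0 +i* (- s' y.2) : C).
Proof. by split; [exact: cst_continuous | apply: cvgN; exact: cs2']. Qed.

End joint.

Lemma Mg_unit_near e B D (sg : R) :
  (forall t, 0 <= t <= 2 * pi -> Mg e B D sg t \in unitmx) ->
  \forall w \near sg, forall t, 0 <= t <= 2 * pi -> Mg e B D w t \in unitmx.
Proof.
move=> H; apply: segment_near => t /H ut.
by have [] := @mcont_inv _ _ (sg, t) n (fun y : R * R => Mg e B D y.1 y.2) ut (mcont_Mg _ _ _ _).
Qed.

Section deriv.
Variables (e : C) (B D : 'M[C]_n).

Let N2 w t := invmx (Mg e B D w t) *m invmx (Mg e B D w t).
(** [Mp] is the derivative of [Mg] in the complex angle and [- W] that of [N2]. The derivatives of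
    [N2] in w and in t differ only by the velocity of the angle, which is - i s(t) in the first case
    and [speed] in the second. *)
Let Mp w t := - k2 t (w * s t) *: B + k1 t (w * s t) *: D.
Let W w t := invmx (Mg e B D w t) *m Mp w t *m N2 w t + N2 w t *m Mp w t *m invmx (Mg e B D w t).

Lemma mder_N2_sg w t : Mg e B D w t \in unitmx ->
  mder w (fun v => N2 v t) (- (0 +i* (- s t)) *: W w t).
Proof.
move=> ut.
have dl : is_derive w (1 : R) (fun v => v * s t) (s t).
  by apply: eq_derive_val (dM (is_derive_id _ _) (dcst (s t) _ _)) _; rewrite mul1r mulr0 addr0.
have [h1 h2] := cder_k (dcst t _ _) dl.
have := mder_N2 (u := w) (M := fun v => Mg e B D v t) ut (mder_Mx e B D h1 h2).
rewrite (_ : _ *: B + _ *: D = (0 +i* (- s t)) *: Mp w t); last first.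
  by rewrite /Mp scalerDr !scalerA mulrN.
by rewrite sandwichZ.
Qed.

Lemma mder_N2_t w t : Mg e B D w t \in unitmx ->
  mder t (fun v => N2 w v) (- speed w t *: W w t).
Proof.
move=> ut.
have dl : is_derive t (1 : R) (fun v => w * s v) (w * s' t).
  by apply: eq_derive_val (dM (dcst w _ _) (ds t)) _; rewrite mul0r add0r.
have [h1 h2] := cder_k (is_derive_id t (1 : R)) dl.
have := mder_N2 (u := t) (M := fun v => Mg e B D w v) ut (mder_Mx e B D h1 h2).
rewrite (_ : _ *: B + _ *: D = speed w t *: Mp w t); last first.
  by rewrite /Mp scalerDr !scalerA mulrN.
by rewrite sandwichZ.
Qed.

Variables (i j : 'I_n).

(** [P] and [Q] are the coefficients of dt and dw in the pull-back of the form N2 d(angle). The form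
    is closed, and [dP] is the common value of the w-derivative of [P] and the t-derivative of
    [Q]. *)
Let P w t := speed w t * N2 w t i j.
Let dP w t := (0 +i* (- s' t)) * N2 w t i j - speed w t * ((0 +i* (- s t)) * W w t i j).
Let Q w t := (0 +i* (- s t)) * N2 w t i j.

Lemma cder_P w t : Mg e B D w t \in unitmx -> cder w (fun v => P v t) (dP w t).
Proof.
move=> ut.
have dsp : cder w (fun v => speed v t) (0 +i* (- s' t)).
  split; first exact: dcst.
  apply: eq_derive_val (dN (dM (is_derive_id w (1 : R)) (dcst (s' t) _ _))) _.
  by rewrite mul1r mulr0 addr0.
apply: cder_eq (cderM dsp (mder_N2_sg ut i j)) _.
by rewrite /dP mxZE mulNr mulrN.
Qed.

Lemma cder_Q w t : Mg e B D w t \in unitmx -> cder t (fun v => Q w v) (dP w t).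
Proof.
move=> ut.
have dsp : cder t (fun v => 0 +i* (- s v) : C) (0 +i* (- s' t)).
  by split; [exact: dcst | exact: dN (ds t)].
apply: cder_eq (cderM dsp (mder_N2_t ut i j)) _.
by rewrite /dP mxZE mulNr mulrN; congr (_ - _); rewrite mulrCA.
Qed.

Lemma mcont_N2j (z : R * R) : Mg e B D z.1 z.2 \in unitmx ->
  mcont z (fun y : R * R => N2 y.1 y.2).
Proof. by move=> ut; apply: mcont_N2 => //; exact: mcont_Mg. Qed.

Lemma ccont_P (z : R * R) : Mg e B D z.1 z.2 \in unitmx ->
  ccont z (fun y : R * R => P y.1 y.2).
Proof.
by move=> ut; apply: ccontM; [exact: ccont_speed | exact: mcont_N2j].
Qed.

Lemma ccont_dP (z : R * R) : Mg e B D z.1 z.2 \in unitmx ->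
  ccont z (fun y : R * R => dP y.1 y.2).
Proof.
move=> ut; have cN := mcont_N2j ut.
have [_ cI] := @mcont_inv _ _ z n (fun y : R * R => Mg e B D y.1 y.2) ut (mcont_Mg _ _ _ _).
have [h1 h2] := ccont_kk z.
have cMp : mcont z (fun y : R * R => Mp y.1 y.2).
  by apply: mcontD; apply: mcontZ; rewrite ?mcont_cst //; first exact: ccontN; exact: mcont_cst.
have cW : mcont z (fun y : R * R => W y.1 y.2).
  by apply: mcontD; apply: mcontM => //; exact: mcontM.
apply: ccontB; apply: ccontM => //; try exact: ccont_is'; try exact: ccont_speed.
by apply: ccontM; [exact: ccont_is | exact: cW].
Qed.

Lemma ccont_slice (F : R * R -> C) w t : ccont (w, t) F -> ccont t (fun v => F (w, v)).
Proof.
apply: ccont_comp; exact: (cvg_pair (cvg_cst w) cvg_id).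
Qed.

(** Cauchy's theorem for the strip between the two contours: the w-derivative of the integral is the
    integral of a t-derivative, namely that of [Q], and [Q] is 2 pi periodic, so it vanishes.
    Invertibility for all shifts between 0 and [dl] means that no pole is crossed. *)
Lemma deformation (dl : R) : 0 < dl ->
  (forall sg t, 0 <= sg <= dl -> 0 <= t <= 2 * pi -> Mg e B D sg t \in unitmx) ->
  CI 0 (2 * pi) (P 0) = CI 0 (2 * pi) (P dl).
Proof.
move=> dl0 uM.
have pi20 : 0 < 2 * pi :> R by rewrite mulr_gt0 // pi_gt0.
have cP w : 0 <= w <= dl -> cder w (fun v => CI 0 (2 * pi) (P v)) 0.
  move=> wI; have uw := fun t => uM w t wI.
  have nu := Mg_unit_near uw.
  have -> : 0 = CI 0 (2 * pi) (dP w).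
    rewrite (@CI_FTC _ _ _ _ (Q w)) //.
    - rewrite /Q /N2 /Mg s_per /k1 /k2 !mulr_natl.
      by rewrite cos2pi sin2pi cos0 sin0 subrr.
    - by move=> t tI; exact: ccont_slice (ccont_dP (z := (w, t)) (uw t tI)).
    - by move=> t tI; exact: cder_Q (uw t tI).
  apply: CI_cder (ltW pi20) _ _ _ _.
  - apply: filterS nu => v uv t tI.
    by have /= := ccont_slice (ccont_P (z := (v, t)) (uv t tI)).
  - by apply: filterS nu => v uv t tI; exact: cder_P (uv t tI).
  - by move=> t tI; exact: (ccont_dP (z := (w, t)) (uw t tI)).
  - by move=> t tI; exact: ccont_slice (ccont_dP (z := (w, t)) (uw t tI)).
have := @CI_FTC _ 0 dl (fun=> 0) (fun v => CI 0 (2 * pi) (P v)) dl0.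
rewrite CI0 => H; apply/esym/eqP; rewrite -subr_eq0 -H //.
by move=> x _; exact: ccont_cst.
Qed.

End deriv.
End Deformation.

(** * The shift field attached to the diagonal entries *)

Section ShiftField.
Variables (R : realType).
Local Notation C := R[i].
Implicit Types (t mu : R) (c d e : C).

(** [av d t] and [bv d t] are the real and imaginary parts of e^{-it} d; each is, up to sign, the
    derivative of the other. *)
Definition av d t : R := complex.Re d * cos t + complex.Im d * sin t.
Definition bv d t : R := complex.Im d * cos t - complex.Re d * sin t.

Lemma d_av d t : is_derive t (1 : R) (av d) (bv d t).
Proof.
apply: eq_derive_val (dD (dM (dcst (complex.Re d) t _) (is_derive_cos t))
  (dM (dcst (complex.Im d) t _) (is_derive_sin t))) _.
by rewrite /bv; ring.
Qed.

Lemma d_bv d t : is_derive t (1 : R) (bv d) (- av d t).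
Proof.
apply: eq_derive_val (dB (dM (dcst (complex.Im d) t _) (is_derive_cos t))
  (dM (dcst (complex.Re d) t _) (is_derive_sin t))) _.
by rewrite /av; ring.
Qed.

Lemma avbv c d t : av c t * av d t + bv c t * bv d t = complex.Re (c * d^*).
Proof.
rewrite cReM cReJ cImJ /av /bv; have := cos2Dsin2 t => E.
transitivity ((complex.Re c * complex.Re d + complex.Im c * complex.Im d) *
  (cos t ^+ 2 + sin t ^+ 2)); first by ring.
by rewrite E; ring.
Qed.

Lemma bvav c d t : bv c t * av d t - av c t * bv d t = complex.Im (c * d^*).
Proof.
rewrite cImM cReJ cImJ /av /bv; have := cos2Dsin2 t => E.
transitivity ((complex.Im c * complex.Re d - complex.Re c * complex.Im d) *
  (cos t ^+ 2 + sin t ^+ 2)); first by ring.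
by rewrite E; ring.
Qed.

Variables (n : nat) (d : 'rV[C]_n).

(** In diagonal coordinates the matrix at the angle t has entries [av (d 0 j) t], with t-derivative
    [bv (d 0 j) t]. The j-th summand carries the sign of this derivative and peaks, with height of
    order 1/mu, where the entry vanishes. *)
Definition sfield mu t : R := \sum_j bv (d 0 j) t / (av (d 0 j) t ^+ 2 + mu).

Definition sfield' mu t : R := \sum_j
  (- av (d 0 j) t / (av (d 0 j) t ^+ 2 + mu) -
   bv (d 0 j) t * (2 * av (d 0 j) t * bv (d 0 j) t) / (av (d 0 j) t ^+ 2 + mu) ^+ 2).

Lemma den_gt0 mu c t : 0 < mu -> 0 < av c t ^+ 2 + mu.
Proof. by move=> mu0; rewrite ltr_wpDl ?sqr_ge0. Qed.

Lemma dsum (I : Type) (r : seq I) (F : I -> R -> R) (l : I -> R) t :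
  (forall i, is_derive t (1 : R) (F i) (l i)) ->
  is_derive t (1 : R) (fun x => \sum_(i <- r) F i x) (\sum_(i <- r) l i).
Proof.
move=> dF; elim: r => [|i r ih].
  by rewrite big_nil; under eq_fun do rewrite big_nil; exact: dcst.
rewrite big_cons; under eq_fun do rewrite big_cons; exact: dD.
Qed.

Lemma d_sfield mu t : 0 < mu -> is_derive t (1 : R) (sfield mu) (sfield' mu t).
Proof.
move=> mu0; apply: dsum => j.
have g0 := lt0r_neq0 (den_gt0 (d 0 j) t mu0).
have d1 := dD (dX2 (d_av (d 0 j) t)) (dcst mu t _).
apply: eq_derive_val (dM (d_bv (d 0 j) t) (@dV _ _ (fun x => av (d 0 j) x ^+ 2 + mu) t 1 _ g0 d1)) _.
by rewrite addr0; field.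
Qed.

Lemma av_cts c : continuous (av c).
Proof. by move=> t; exact: derive_cts (d_av c t). Qed.
Lemma bv_cts c : continuous (bv c).
Proof. by move=> t; exact: derive_cts (d_bv c t). Qed.

Lemma cts_sum (T : topologicalType) (I : Type) (r : seq I) (F : I -> T -> R) (x : T) :
  (forall i, {for x, continuous (F i)}) ->
  continuous_at x (fun y => \sum_(i <- r) F i y).
Proof.
move=> cF; elim: r => [|i r ih].
  by under eq_fun do rewrite big_nil; exact: cst_continuous.
under eq_fun do rewrite big_cons; apply: cvgD => //; exact: cF.
Qed.

Lemma sfield'_cts mu : 0 < mu -> continuous (sfield' mu).
Proof.
move=> mu0 t; apply: cts_sum => j.
have g0 := lt0r_neq0 (den_gt0 (d 0 j) t mu0).
have ca := @av_cts (d 0 j) t; have cb := @bv_cts (d 0 j) t.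
have cd : continuous_at t (fun x => av (d 0 j) x ^+ 2 + mu).
  by apply: cvgD; [apply: cvgM | exact: cvg_cst].
apply: cvgB.
  by apply: cvgM; [exact: cvgN | exact: cvgV].
apply: cvgM.
  by apply: cvgM => //; apply: cvgM => //; apply: cvgM => //; exact: cvg_cst.
apply: cvgV; first by rewrite expf_neq0.
exact: cvgM.
Qed.

Lemma sfield_per mu : sfield mu (2 * pi) = sfield mu 0.
Proof.
by apply: eq_bigr => j _; rewrite /av /bv !mulr_natl cos2pi sin2pi cos0 sin0.
Qed.

Hypothesis gd : good (diag_mx d).

(* At a zero of [av (d 0 j)] the j-th summand has size 1/mu, the summands vanishing
   there have its sign, and the other ones stay bounded as mu tends to 0. *)
Lemma sfield_sign : exists2 mu, 0 < mu &
  forall t j, av (d 0 j) t = 0 -> 0 < sfield mu t * bv (d 0 j) t.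
Proof.
pose rho k j := complex.Re (d 0 k * (d 0 j)^*).
pose io k j := complex.Im (d 0 k * (d 0 j)^*).
pose S := \sum_k \sum_j `|rho k j| / io k j ^+ 2.
have S0 k j : 0 <= `|rho k j| / io k j ^+ 2 by rewrite divr_ge0 ?sqr_ge0.
have S_ge0 : 0 <= S by apply: sumr_ge0 => k _; apply: sumr_ge0 => j _.
have S1 : 0 < 1 + S by rewrite ltr_wpDr.
exists (1 + S)^-1; first by rewrite invr_gt0.
move=> t j aj0; set mu := (1 + S)^-1.
have mu0 : 0 < mu by rewrite invr_gt0.
have bj2 : bv (d 0 j) t ^+ 2 = rho j j by rewrite /rho -(avbv _ _ t) aj0 mul0r add0r expr2.
have m0 : 0 < rho j j.
  rewrite /rho cReM cReJ cImJ mulrN opprK -!expr2 lt_neqAle eq_sym sumsqr_neq0 ?good_diag_neq0 //=.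
  by rewrite addr_ge0 ?sqr_ge0.
have termE k : bv (d 0 k) t * bv (d 0 j) t = rho k j.
  by rewrite /rho -(avbv _ _ t) aj0 mulr0 add0r.
(* At a zero of the j-th entry the square of the k-th entry is determined by [d] alone, which makes
   the bound below uniform in t. *)
have akE k : av (d 0 k) t ^+ 2 * rho j j = io k j ^+ 2.
  by rewrite -bj2 -exprMn /io -(bvav _ _ t) aj0 mulr0 sub0r sqrrN.
rewrite /sfield mulr_suml (bigD1 j) //=.
have -> : bv (d 0 j) t / (av (d 0 j) t ^+ 2 + mu) * bv (d 0 j) t = rho j j * (1 + S).
  by rewrite mulrAC termE aj0 expr0n /= add0r invrK.
have H k : k != j -> - (rho j j * (`|rho k j| / io k j ^+ 2)) <=
    bv (d 0 k) t / (av (d 0 k) t ^+ 2 + mu) * bv (d 0 j) t.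
  move=> kj; rewrite mulrAC termE.
  have [i0|i0] := eqVneq (io k j) 0.
    rewrite i0 expr0n /= invr0 !mulr0 oppr0 divr_ge0 // ?(ltW (den_gt0 _ _ mu0)) //.
    exact/ltW/good_diag_same_side.
  have a2 : 0 < av (d 0 k) t ^+ 2.
    rewrite lt_neqAle sqr_ge0 andbT eq_sym; apply: contra i0 => /eqP h.
    by rewrite -(sqrf_eq0 (io k j)) -akE h mul0r.
  have -> : rho j j * (`|rho k j| / io k j ^+ 2) = `|rho k j| / av (d 0 k) t ^+ 2.
    have a0 : av (d 0 k) t != 0 by rewrite -sqrf_eq0 lt0r_neq0.
    by rewrite -akE; field; rewrite a0 (lt0r_neq0 m0).
  rewrite lerNl -mulNr; apply: (@le_trans _ _ (`|rho k j| / (av (d 0 k) t ^+ 2 + mu))).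
    by rewrite ler_pM2r ?invr_gt0 ?den_gt0 // -normrN ler_norm.
  by rewrite ler_wpM2l // lef_pV2 ?posrE ?den_gt0 // lerDl ltW.
have H2 : - (rho j j * S) <= \sum_(k | k != j) bv (d 0 k) t / (av (d 0 k) t ^+ 2 + mu) * bv (d 0 j) t.
  apply: le_trans (ler_sum _ H); rewrite sumrN lerN2 -mulr_sumr ler_pM2l //.
  rewrite /S [leRHS](bigID (fun k => k != j)) /= -[leLHS]addr0 lerD //; last first.
    by apply: sumr_ge0 => k _; apply: sumr_ge0.
  apply: ler_sum => k _; rewrite (bigD1 j) //= lerDl; exact: sumr_ge0.
rewrite mulrDr mulr1 -addrA ltr_wpDr //.
by rewrite -lerBlDl sub0r.
Qed.

End ShiftField.

(** * Invertibility at complex angles *)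

Section HermitianPencil.
Variables (R : realType) (n : nat).
Local Notation C := R[i].
Implicit Types (B D H : 'M[C]_n) (v w : 'cV[C]_n).

Definition nsq v : R := complex.Re ((v ^t* *m v) 0 0).

Lemma nsqE v : nsq v = \sum_i (complex.Re (v i 0) ^+ 2 + complex.Im (v i 0) ^+ 2).
Proof.
rewrite /nsq mxE cRe_sum; apply: eq_bigr => i _.
by rewrite !mxE cReM cReJ cImJ mulNr opprK -!expr2.
Qed.

Lemma nsq_ge0 v : 0 <= nsq v.
Proof. by rewrite nsqE sumr_ge0 // => i _; rewrite addr_ge0 ?sqr_ge0. Qed.

Lemma nsq_gt0 v : (0 < nsq v) = (v != 0).
Proof.
rewrite lt_neqAle nsq_ge0 andbT eq_sym; congr (~~ _); apply/eqP/eqP => [|->]; last first.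
  by rewrite nsqE big1 // => i _; rewrite mxE /= expr0n /= addr0.
rewrite nsqE => /eqP; rewrite psumr_eq0 => [/allP h|i _]; last by rewrite addr_ge0 ?sqr_ge0.
apply/matrixP => i j; rewrite ord1 mxE.
have := h i (mem_index_enum i) => /= /eqP h0.
by apply/eqP; apply: contraPT h0 => /sumsqr_neq0 /eqP.
Qed.

Lemma nsq_C v : (v ^t* *m v) 0 0 = (nsq v)%:C.
Proof.
apply: complexP => //=; rewrite mxE cIm_sum big1 // => i _.
by rewrite !mxE cImM cReJ cImJ; ring.
Qed.

Lemma nsqZ (c : R) v : nsq (c%:C *: v) = c ^+ 2 * nsq v.
Proof.
rewrite !nsqE mulr_sumr; apply: eq_bigr => i _.
by rewrite mxZE cReM cImM /=; ring.
Qed.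

Lemma formZ H (c : R) v : form H (c%:C *: v) (c%:C *: v) = (c ^+ 2)%:C * form H v v.
Proof.
rewrite /form adjZ -!scalemxAl -scalemxAr !mxZE mulrA; congr (_ * _).
by rewrite [_^*]conjc_real -rmorphM expr2.
Qed.

Lemma form_adj H v w : (form H v w)^* = form (H ^t*) w v.
Proof.
rewrite /form -[in RHS](adjK v) -!adjM mulmxA.
by rewrite [in RHS]mxE [in RHS]mxE.
Qed.

Lemma herm_form H v : H ^t* = H -> form H v v = (complex.Re (form H v v))%:C.
Proof.
move=> hH; apply: complexP => //=.
have := form_adj H v v; rewrite hH => /(congr1 (@complex.Im R)).
by rewrite cImJ => h; lra.
Qed.

Lemma formDl (H K : 'M[C]_n) v w : form (H + K) v w = form H v w + form K v w.
Proof. by rewrite /form mulmxDr mulmxDl mxE. Qed.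

Lemma formZl c H v w : form (c *: H) v w = c * form H v w.
Proof. by rewrite /form -scalemxAr -scalemxAl mxZE. Qed.

Lemma form1 v : form 1%:M v v = (nsq v)%:C.
Proof. by rewrite /form mulmx1 nsq_C. Qed.

Lemma formNl H v w : form (- H) v w = - form H v w.
Proof. by rewrite -scaleN1r formZl mulN1r. Qed.

Lemma form_scalar c v : form c%:M v v = c * (nsq v)%:C.
Proof. by rewrite -scalemx1 formZl form1. Qed.

Lemma form_comb a b c H K v : form (a *: H + b *: K - c%:M) v v =
  a * form H v v + b * form K v v - c * (nsq v)%:C.
Proof. by rewrite !formDl formNl !formZl form_scalar. Qed.

Lemma im_balance (a m0 b m1 e p : R) :
  a%:C * m0%:C + (0 +i* - b) * m1%:C - (0 +i* e) * p%:C = 0 -> b * m1 = - e * p.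
Proof.
move/(congr1 (@complex.Im R)); rewrite !(cImD, cImN, cImM) /= => h; lra.
Qed.

Lemma ker_balance a b c H K v : (a *: H + b *: K - c%:M) *m v = 0 ->
  a *: (H *m v) = (- b) *: (K *m v) + c *: v.
Proof.
rewrite !mulmxDl mulNmx -!scalemxAl mul_scalar_mx => /eqP.
by rewrite subr_eq0 => /eqP <-; rewrite scaleNr addrCA addNr addr0.
Qed.

Lemma opp_imag (b : R) : - (0 +i* - b) = 0 +i* b.
Proof. by apply: complexP; rewrite ?cReN ?cImN /= ?oppr0 ?opprK. Qed.

Lemma nsq_mulZ H (c : R) v : nsq (H *m (c%:C *: v)) = c ^+ 2 * nsq (H *m v).
Proof. by rewrite -scalemxAr nsqZ. Qed.

Lemma Re_formZ H (c : R) v : complex.Re (form H (c%:C *: v) (c%:C *: v)) =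
  c ^+ 2 * complex.Re (form H v v).
Proof. by rewrite formZ cReM /= mul0r subr0. Qed.

Lemma sphere_scale (s tau : R) H K :
  (forall v, nsq v = 1 -> 0 < s * complex.Re (form K v v) \/
     tau ^+ 2 * nsq (K *m v) < nsq (H *m v)) ->
  forall v, v != 0 -> 0 < s * complex.Re (form K v v) \/
     tau ^+ 2 * nsq (K *m v) < nsq (H *m v).
Proof.
move=> key v v0; have p0 : 0 < nsq v by rewrite nsq_gt0.
pose c := (Num.sqrt (nsq v))^-1.
have c2 : c ^+ 2 = (nsq v)^-1 by rewrite exprVn sqr_sqrtr ?ltW.
have c20 : 0 < c ^+ 2 by rewrite c2 invr_gt0.
have := key (c%:C *: v); rewrite nsqZ {1}c2 mulVf ?lt0r_neq0 // => /(_ erefl).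
rewrite Re_formZ !nsq_mulZ mulrCA pmulr_rgt0 // [tau ^+ 2 * _]mulrCA ltr_pM2l //.
Qed.

Lemma nsq_comb (p q : R) v w : nsq ((0 +i* p) *: v + (0 +i* q) *: w) =
  p ^+ 2 * nsq v + 2 * p * q * complex.Re ((v ^t* *m w) 0 0) + q ^+ 2 * nsq w.
Proof.
rewrite !nsqE !mxE cRe_sum !mulr_sumr -!big_split; apply: eq_bigr => i _ /=.
by rewrite !mxE !(cReD, cImD, cReM, cImM, cReJ, cImJ) /=; ring.
Qed.

(** The first identity is the imaginary part of the equation paired with v. For the second, take
    norms in c H v = i b K v + i eps v and replace the cross term by means of the first. *)
Lemma kernel_split (c b eps : R) H K v : H ^t* = H -> K ^t* = K ->
  (c%:C *: H + (0 +i* - b) *: K - (0 +i* eps)%:M) *m v = 0 ->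
  b * complex.Re (form K v v) = - eps * nsq v /\
  c ^+ 2 * nsq (H *m v) = b ^+ 2 * nsq (K *m v) - eps ^+ 2 * nsq v.
Proof.
move=> h0 h1 E.
have E1 : b * complex.Re (form K v v) = - eps * nsq v.
  have : form (c%:C *: H + (0 +i* (- b)) *: K - (0 +i* eps)%:M) v v = 0.
    by rewrite /form -mulmxA E mulmx0 mxE.
  rewrite form_comb (herm_form v h0) (herm_form v h1); exact: im_balance.
split=> //.
have E2 := ker_balance E; rewrite opp_imag in E2.
have := congr1 nsq E2; rewrite nsqZ nsq_comb => ->.
rewrite adjM h1 -/(form K v v).
have -> : 2 * b * eps * complex.Re (form K v v) = - (2 * eps ^+ 2 * nsq v).
  by rewrite mulrAC -[2 * b * _]mulrA E1; ring.
by ring.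
Qed.

Lemma ker_nunit H : H \notin unitmx -> exists2 v : 'cV[C]_n, v != 0 & H *m v = 0.
Proof.
rewrite -unitmx_tr -row_free_unit -kermx_eq0 => /rowV0Pn [r /sub_kermxP rH r0].
exists r^T; first by rewrite -(inj_eq (@trmx_inj _ _ _)) trmxK trmx0.
by rewrite -[H]trmxK -trmx_mul rH trmx0.
Qed.

(** The Hermitian combination at the real angle t; [H1] is its derivative in t. *)
Definition H0 (t : R) B D := (cos t)%:C *: B + (sin t)%:C *: D.
Definition H1 (t : R) B D := (- sin t)%:C *: B + (cos t)%:C *: D.

Lemma adj_real (c : R) B : B ^t* = B -> (c%:C *: B) ^t* = c%:C *: B.
Proof. by move=> hB; rewrite adjZ hB [_^*]conjc_real. Qed.

Lemma H0_herm t B D : B ^t* = B -> D ^t* = D -> (H0 t B D) ^t* = H0 t B D.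
Proof. by move=> hB hD; rewrite adjD !adj_real. Qed.
Lemma H1_herm t B D : B ^t* = B -> D ^t* = D -> (H1 t B D) ^t* = H1 t B D.
Proof. by move=> hB hD; rewrite adjD !adj_real. Qed.

(** The addition formulas for cos(t - i x) and sin(t - i x): moving the angle off the real line adds
    the multiple - i sh(x) of the derivative [H1]. *)
Lemma Mx_split t x e B D : Mx (k1 t x) (k2 t x) e B D =
  (ch x)%:C *: H0 t B D + (0 +i* (- sh x)) *: H1 t B D - e%:M.
Proof.
rewrite /Mx /H0 /H1; congr (_ - _).
rewrite !scalerDr !scalerA addrACA -!scalerDl; congr (_ *: _ + _ *: _);
  by apply: complexP; rewrite ?(cReD, cImD, cReM, cImM) /=; ring.
Qed.

Lemma kernel_estimate t x (eps : R) B D v : B ^t* = B -> D ^t* = D ->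
  Mx (k1 t x) (k2 t x) (0 +i* eps) B D *m v = 0 ->
  sh x * complex.Re (form (H1 t B D) v v) = - eps * nsq v /\
  ch x ^+ 2 * nsq (H0 t B D *m v) = sh x ^+ 2 * nsq (H1 t B D *m v) - eps ^+ 2 * nsq v.
Proof.
move=> hB hD; rewrite Mx_split.
by apply: kernel_split; [exact: H0_herm | exact: H1_herm].
Qed.

(** A kernel vector contradicts either alternative. The first makes sh(x) <H1 v, v> positive when sg
    > 0, whereas it equals - eps |v|^2. The second gives |H0 v| > tau |H1 v|, whereas ch |H0 v| <=
    |sh| |H1 v| <= tau ch |H1 v|. *)
Lemma Mx_unit t x (s sg tau eps : R) B D : B ^t* = B -> D ^t* = D ->
  x = sg * s -> 0 <= sg -> 0 <= eps -> (0 < sg) || (0 < eps) ->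
  sh x ^+ 2 <= tau ^+ 2 * ch x ^+ 2 ->
  (forall v, nsq v = 1 -> 0 < s * complex.Re (form (H1 t B D) v v) \/
     tau ^+ 2 * nsq (H1 t B D *m v) < nsq (H0 t B D *m v)) ->
  Mx (k1 t x) (k2 t x) (0 +i* eps) B D \in unitmx.
Proof.
move=> hB hD xE sg0 eps0 pos shch key; apply: contraT => /ker_nunit [v v0 Mv].
have [e1 e2] := kernel_estimate hB hD Mv.
have p0 : 0 < nsq v by rewrite nsq_gt0.
have := sphere_scale key v0.
move: (H0 t B D) (H1 t B D) e1 e2 => K0 K1 e1 e2.
have C0 := ch_gt0 x.
have n1 := nsq_ge0 (K1 *m v); have n0 := nsq_ge0 (K0 *m v).
case=> h.
  have [sgp|sgn] := ltP 0 sg.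
    have le0 : sh x * complex.Re (form K1 v v) <= 0.
      by rewrite e1 mulNr oppr_le0 mulr_ge0 // ltW.
    have [s0|s0|s0] := ltrgtP s 0.
    - have : 0 < sh (- x) by apply: sh_gt0; rewrite xE -mulrN mulr_gt0 // oppr_gt0.
      rewrite shN oppr_gt0 => h3; move: h; rewrite nmulr_rgt0 // => h.
      by move: le0; rewrite leNgt nmulr_rgt0 // h.
    - have h3 : 0 < sh x by apply: sh_gt0; rewrite xE mulr_gt0.
      move: h; rewrite pmulr_rgt0 // => h.
      by move: le0; rewrite leNgt pmulr_rgt0 // h.
    - by move: h; rewrite s0 mul0r ltxx.
  (* Without shift the contradiction comes from eps > 0, since the first identity then reads 0 = -
     eps |v|^2. *)
  have sgE : sg = 0 by apply/eqP; rewrite eq_le sgn.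
  move: pos; rewrite sgE ltxx /= => epos.
  move/eqP: e1; rewrite xE sgE mul0r sh0 mul0r eq_sym mulNr oppr_eq0.
  by rewrite mulf_eq0 !gt_eqF.
have h2 : ch x ^+ 2 * nsq (K0 *m v) <= ch x ^+ 2 * (tau ^+ 2 * nsq (K1 *m v)).
  rewrite e2; apply: (@le_trans _ _ (sh x ^+ 2 * nsq (K1 *m v))).
    by rewrite lerBlDr lerDl mulr_ge0 ?sqr_ge0 // ltW.
  by rewrite mulrA [ch x ^+ 2 * _]mulrC ler_wpM2r.
by move: h2; rewrite ler_pM2l ?exprn_gt0 // leNgt h.
Qed.

End HermitianPencil.

(** * Scalar loop integrals with vanishing real part *)

Section ClosedLogarithm.
Variable R : realType.
Local Notation C := R[i].

Lemma cconton_M a b (F G : R -> C) : cconton a b F -> cconton a b G ->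
  cconton a b (fun t => F t * G t).
Proof. by move=> cF cG t tI; apply: ccontM; [exact: cF | exact: cG]. Qed.

Lemma cconton_V a b (F : R -> C) : (forall t, a <= t <= b -> F t != 0) ->
  cconton a b F -> cconton a b (fun t => (F t)^-1).
Proof. by move=> F0 cF t tI; apply: ccontV; [exact: F0 | exact: cF]. Qed.

(** The real part of p'/p is the derivative of log |p|, which is single-valued, so it integrates to
    zero along a loop; only the argument may wind. *)
Lemma Re_closed_log a b (p p' : R -> C) : a < b ->
  (forall t, a <= t <= b -> p t != 0) -> (forall t, a <= t <= b -> cder t p (p' t)) ->
  cconton a b p' -> p a = p b ->
  complex.Re (CI a b (fun t => p' t / p t)) = 0.
Proof.
move=> ab p0 dp cp' pab.
have cp : cconton a b p by move=> t tI; exact: cder_ccont (dp t tI).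
have cq : cconton a b (fun t => p' t / p t) by apply: cconton_M => //; exact: cconton_V.
pose F t := 2^-1 * ln (complex.Re (p t) ^+ 2 + complex.Im (p t) ^+ 2).
transitivity (F b - F a); last by rewrite /F pab subrr.
apply: RI_FTC => //.
- exact: cconton_re.
- move=> t tI; have [d1 d2] := dp t tI; have n0 := sumsqr_neq0 (p0 t tI).
  have g0 : 0 < complex.Re (p t) ^+ 2 + complex.Im (p t) ^+ 2.
    by rewrite lt_neqAle eq_sym n0 addr_ge0 ?sqr_ge0.
  have dl := @is_derive_comp1 _ (@ln R)
    (fun x => complex.Re (p x) ^+ 2 + complex.Im (p x) ^+ 2) t _ _
    (is_derive1_ln g0) (dD (dX2 d1) (dX2 d2)).
  apply: eq_derive_val (dM (dcst 2^-1 t _) dl) _.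
  rewrite cReM cReV cImV; field.
  by rewrite -?expr2 n0.
Qed.

End ClosedLogarithm.

Section ZeroPair.
Variable R : realType.
Local Notation C := R[i].
Variables (s s' : R -> R).
Hypothesis ds : forall t, is_derive t (1 : R) s (s' t).
Hypothesis cs' : continuous s'.
Hypothesis s_per : s (2 * pi) = s 0.
Variable dl : R.

(** [pc d] and [pcp d] extend [av d] and [bv d] to complex angles, the cosine and sine being passed
    as [c1] and [c2]. *)
Definition pc (d c1 c2 : C) : C := c1 * (complex.Re d)%:C + c2 * (complex.Im d)%:C.
Definition pcp (d c1 c2 : C) : C := - c2 * (complex.Re d)%:C + c1 * (complex.Im d)%:C.

Let K1 t := k1 t (dl * s t).
Let K2 t := k2 t (dl * s t).
Let g t : C := speed s' dl t.
Let p d t := pc d (K1 t) (K2 t).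
Let q d t := pcp d (K1 t) (K2 t).

Lemma cder_K t : cder t K1 (- (g t * K2 t)) /\ cder t K2 (g t * K1 t).
Proof.
have dt : is_derive t (1 : R) (fun v => dl * s v) (dl * s' t).
  by apply: eq_derive_val (dM (dcst dl _ _) (ds t)) _; rewrite mul0r add0r.
exact: (cder_k (is_derive_id t (1 : R)) dt).
Qed.

Lemma cder_p d t : cder t (p d) (g t * q d t).
Proof.
have [h1 h2] := cder_K t.
apply: cder_eq (cderD (cderM h1 (cder_cst t (complex.Re d)%:C))
  (cderM h2 (cder_cst t (complex.Im d)%:C))) _.
by rewrite /q /pcp; ring.
Qed.

Lemma cder_q d t : cder t (q d) (- (g t * p d t)).
Proof.
have [h1 h2] := cder_K t.
apply: cder_eq (cderD (cderM (cderN h2) (cder_cst t (complex.Re d)%:C))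
  (cderM h1 (cder_cst t (complex.Im d)%:C))) _.
by rewrite /p /pc; ring.
Qed.

Lemma ccont_g t : ccont t g.
Proof.
split; first exact: cst_continuous.
by apply: cvgN; apply: cvgM; [exact: cvg_cst | exact: cs'].
Qed.

Lemma wronskian d e t : q d t * p e t - p d t * q e t =
  (complex.Im d * complex.Re e - complex.Re d * complex.Im e)%:C.
Proof.
have E : K1 t ^+ 2 + K2 t ^+ 2 = 1 by exact: k_sqr.
rewrite rmorphB !rmorphM /= /p /q /pc /pcp.
set a := (complex.Re d)%:C; set b := (complex.Im d)%:C.
set a' := (complex.Re e)%:C; set b' := (complex.Im e)%:C.
transitivity ((b * a' - a * b') * (K1 t ^+ 2 + K2 t ^+ 2)); first by ring.
by rewrite E mulr1.
Qed.

Lemma pq_sqr d t : p d t ^+ 2 + q d t ^+ 2 =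
  (complex.Re d ^+ 2 + complex.Im d ^+ 2)%:C.
Proof.
have E : K1 t ^+ 2 + K2 t ^+ 2 = 1 by exact: k_sqr.
rewrite rmorphD !rmorphXn /= /p /q /pc /pcp.
set a := (complex.Re d)%:C; set b := (complex.Im d)%:C.
transitivity ((a ^+ 2 + b ^+ 2) * (K1 t ^+ 2 + K2 t ^+ 2)); first by ring.
by rewrite E mulr1.
Qed.

Let pi20 : 0 < 2 * pi :> R.
Proof. by rewrite mulr_gt0 // pi_gt0. Qed.

Let K_per : (K1 (2 * pi) = K1 0) * (K2 (2 * pi) = K2 0).
Proof.
by rewrite /K1 /K2 s_per /k1 /k2 !mulr_natl cos2pi sin2pi cos0 sin0.
Qed.

Lemma Re_log_p d : (forall t, 0 <= t <= 2 * pi -> p d t != 0) ->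
  complex.Re (CI 0 (2 * pi) (fun t => (g t * q d t) / p d t)) = 0.
Proof.
move=> p0; apply: Re_closed_log => //.
- by move=> t _; exact: cder_p.
- apply: cconton_M; first by move=> t _; exact: ccont_g.
  by move=> t _; exact: cder_ccont (cder_q d t).
- by rewrite /p !K_per.
Qed.

(** If d and e are independent over the reals, the constant nonzero Wronskian gives a partial
    fraction decomposition of 1/(p_d p_e) into q_d/p_d and q_e/p_e with real coefficients, and these
    become logarithmic derivatives after multiplication by the speed. If e is a real multiple of d,
    the integrand is a multiple of the exact derivative of q_d/p_d and the integral is 0. *)
Lemma Re_zero_pair d e : d != 0 -> e != 0 ->
  (forall t, 0 <= t <= 2 * pi -> p d t != 0) ->
  (forall t, 0 <= t <= 2 * pi -> p e t != 0) ->
  complex.Re (CI 0 (2 * pi) (fun t => g t * ((p d t)^-1 * (p e t)^-1))) = 0.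
Proof.
move=> d0 e0 pd0 pe0.
pose w := complex.Im d * complex.Re e - complex.Re d * complex.Im e.
have cg : cconton 0 (2 * pi) g by move=> t _; exact: ccont_g.
have cp x : cconton 0 (2 * pi) (p x) by move=> t _; exact: cder_ccont (cder_p x t).
have cq x : cconton 0 (2 * pi) (q x) by move=> t _; exact: cder_ccont (cder_q x t).
have [w0|w0] := eqVneq w 0; last first.
  have wC : w%:C != 0 by apply: contra w0 => /eqP [->].
  have uE : (w^-1)%:C * w%:C = 1 by rewrite -rmorphM mulVf.
  rewrite (@eq_CI _ _ _ _ (fun t => (w^-1)%:C * ((g t * q d t) / p d t)
     + (- (w^-1)%:C) * ((g t * q e t) / p e t))); last first.
    move=> t tI; have := wronskian d e t; rewrite -/w => W.
    have h1 := pd0 t tI; have h2 := pe0 t tI.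
    transitivity ((w^-1)%:C * g t * (q d t * p e t - p d t * q e t) *
      ((p d t)^-1 * (p e t)^-1)); last by field; apply/and3P; split.
    by rewrite W [_ * g t]mulrC -[g t * _ * _]mulrA uE mulr1.
  have c1 x : (forall t, 0 <= t <= 2 * pi -> p x t != 0) ->
      cconton 0 (2 * pi) (fun t => g t * q x t / p x t).
    by move=> p0; apply: cconton_M; [exact: cconton_M | exact: cconton_V].
  rewrite CID; first last.
  - by apply: cconton_M; [move=> t _; exact: ccont_cst | exact: c1].
  - by apply: cconton_M; [move=> t _; exact: ccont_cst | exact: c1].
  rewrite !CIZ; try exact: c1.
  by rewrite cReD !cReM cImN !Re_log_p // /= oppr0 !mulr0 !mul0r !subr0 addr0.
(* From here on the Wronskian is zero; [r] is the real factor with e = r d, obtained by projecting e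
   onto d. *)
have n0 := sumsqr_neq0 d0.
pose r := (complex.Re d * complex.Re e + complex.Im d * complex.Im e) /
  (complex.Re d ^+ 2 + complex.Im d ^+ 2).
have er : complex.Re e = r * complex.Re d.
  have w0' : complex.Im d * complex.Re e = complex.Re d * complex.Im e by apply/eqP; rewrite -subr_eq0; exact/eqP.
  rewrite /r; apply: (mulIf n0); rewrite mulrAC mulfVK //.
  transitivity (complex.Re e * complex.Re d ^+ 2 + complex.Im d * (complex.Im d * complex.Re e)); first by ring.
  by rewrite w0'; ring.
have ei : complex.Im e = r * complex.Im d.
  have w0' : complex.Im d * complex.Re e = complex.Re d * complex.Im e by apply/eqP; rewrite -subr_eq0; exact/eqP.
  rewrite /r; apply: (mulIf n0); rewrite mulrAC mulfVK //.
  transitivity (complex.Re d * (complex.Re d * complex.Im e) + complex.Im e * complex.Im d ^+ 2); first by ring.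
  by rewrite -w0'; ring.
have r0 : r != 0.
  apply/eqP => r0; move/eqP: e0; apply; apply: complexP; rewrite ?er ?ei r0 mul0r //.
have rC : r%:C != 0 by apply: contra r0 => /eqP [->].
have pe t : p e t = r%:C * p d t.
  by rewrite /p /pc er ei !rmorphM /=; ring.
pose c := (complex.Re d ^+ 2 + complex.Im d ^+ 2)%:C.
have c0 : c != 0 by apply: contra n0 => /eqP [->].
suff -> : CI 0 (2 * pi) (fun t => g t * ((p d t)^-1 * (p e t)^-1)) = 0 by [].
(* The derivative of q/p along the contour is - g (p^2 + q^2)/p^2, and p^2 + q^2 is the constant
   [c]. *)
pose G t := - (r%:C * c)^-1 * (q d t * (p d t)^-1).
transitivity (G (2 * pi) - G 0); last by rewrite /G /q /p !K_per subrr.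
apply: (CI_FTC pi20).
  apply: cconton_M => //; apply: cconton_M; apply: cconton_V;
    by [exact: pd0 | exact: pe0 | exact: cp].
move=> t tI; have h1 := pd0 t tI.
apply: cder_eq (cderM (cder_cst t _) (cderM (cder_q d t) (cderV h1 (cder_p d t)))) _.
rewrite mul0r add0r pe.
have -> : - (g t * p d t) * (p d t)^-1 + q d t * (- (g t * q d t) / p d t ^+ 2) =
    - g t * (p d t ^+ 2 + q d t ^+ 2) / p d t ^+ 2 by field.
rewrite pq_sqr -/c; move: (p d t) (g t) (r%:C) (c) h1 rC c0 => x y rr cc h1 rC c0.
by field; rewrite h1 c0 rC.
Qed.

End ZeroPair.

Lemma sandwich_diag_entry (K : comNzRingType) n (P G Q : 'M[K]_n) (x : 'rV[K]_n) i k :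
  (P *m diag_mx x *m G *m diag_mx x *m Q) i k =
  \sum_l \sum_j (P i j * G j l * Q l k) * (x 0 j * x 0 l).
Proof.
rewrite mxE; apply: eq_bigr => l _.
have -> : (P *m diag_mx x *m G *m diag_mx x) i l = (P *m diag_mx x *m G) i l * x 0 l.
  by rewrite mul_mx_diag [LHS]mxE.
rewrite [in LHS]mxE !mulr_suml; apply: eq_bigr => j _.
have -> : (P *m diag_mx x) i j = P i j * x 0 j by rewrite mul_mx_diag [LHS]mxE.
by ring.
Qed.

(** * The pencil in diagonal coordinates *)

Section ZeroLimit.
Variables (R : realType) (n : nat).
Local Notation C := R[i].

(** A matrix determines its two Hermitian parts, and those of a diagonal matrix are diagonal. *)
Lemma diag_parts (P Q : 'M[C]_n) (d : 'rV[C]_n) :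
  P ^t* = P -> Q ^t* = Q -> P + (0 +i* 1) *: Q = diag_mx d ->
  P = diag_mx (map_mx (fun x => (complex.Re x)%:C) d) /\
  Q = diag_mx (map_mx (fun x => (complex.Im x)%:C) d).
Proof.
move=> hP hQ E.
have Pji i j : P j i = (P i j)^* by rewrite -{1}hP !mxE.
have Qji i j : Q j i = (Q i j)^* by rewrite -{1}hQ !mxE.
have e1 i j : P i j + (0 +i* 1) * Q i j = d 0 i *+ (i == j).
  by have := congr1 (fun M : 'M[C]_n => M i j) E; rewrite !mxE.
have key i j : P i j = (complex.Re (d 0 i))%:C *+ (i == j) /\
    Q i j = (complex.Im (d 0 i))%:C *+ (i == j).
  have := e1 j i; rewrite Pji Qji => h2; have h1 := e1 i j.
  have r1 := congr1 (@complex.Re R) h1; have i1 := congr1 (@complex.Im R) h1.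
  have r2 := congr1 (@complex.Re R) h2; have i2 := congr1 (@complex.Im R) h2.
  move: r1 i1 r2 i2; rewrite !(cReD, cImD, cReM, cImM, cReJ, cImJ) /=.
  have [->|ij] := eqVneq i j; rewrite /= ?eqxx ?mulr1n ?mulr0n /=.
    by move=> r1 i1 r2 i2; split; apply: complexP => /=; lra.
  rewrite ?[j == i]eq_sym ?(negbTE ij) ?mulr0n /= => r1 i1 r2 i2.
  by split; apply: complexP => /=; lra.
by split; apply/matrixP => i j; rewrite !mxE; have [] := key i j.
Qed.

Variables (B D V : 'M[C]_n) (d : 'rV[C]_n).
Hypotheses (hB : B ^t* = B) (hD : D ^t* = D) (uV : V \in unitmx).
Hypothesis VE : V ^t* *m (B + (0 +i* 1) *: D) *m V = diag_mx d.
Hypothesis gd : good (diag_mx d).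

Lemma congr_BD :
  V ^t* *m B *m V = diag_mx (map_mx (fun x => (complex.Re x)%:C) d) /\
  V ^t* *m D *m V = diag_mx (map_mx (fun x => (complex.Im x)%:C) d).
Proof.
apply: diag_parts.
- by rewrite !adjM adjK hB mulmxA.
- by rewrite !adjM adjK hD mulmxA.
- by rewrite -VE mulmxDr mulmxDl -scalemxAr -scalemxAl.
Qed.

(** Diagonalising B + i D by congruence diagonalises B and D separately, hence all their complex
    combinations, in particular those at complex angles. *)
Lemma congr_comb c1 c2 : V ^t* *m (c1 *: B + c2 *: D) *m V =
  diag_mx (\row_j pc (d 0 j) c1 c2).
Proof.
have [eB eD] := congr_BD.
rewrite mulmxDr mulmxDl -!scalemxAr -!scalemxAl eB eD.
by apply/matrixP => i j; rewrite !mxE !mulrnAr -mulrnDl.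
Qed.

Lemma Mx0E c1 c2 : Mx c1 c2 0 B D = c1 *: B + c2 *: D.
Proof. by rewrite /Mx raddf0 subr0. Qed.

Lemma inv_congr c1 c2 : Mx c1 c2 0 B D \in unitmx ->
  (forall j, pc (d 0 j) c1 c2 != 0) /\
  Nx c1 c2 0 B D = V *m diag_mx (\row_j (pc (d 0 j) c1 c2)^-1) *m V ^t*.
Proof.
move=> uM; have E := congr_comb c1 c2; rewrite -Mx0E in E.
have uVt : V ^t* \in unitmx by rewrite adj_unit.
have p0 j : pc (d 0 j) c1 c2 != 0.
  have : diag_mx (\row_j pc (d 0 j) c1 c2) \in unitmx by rewrite -E !unitmx_mul uVt uM uV.
  rewrite unitmxE det_diag unitfE => /prodf_neq0 /(_ j isT); by rewrite mxE.
split=> //.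
set Dl := diag_mx _; set Y := _ *m V ^t*.
suff MY : Mx c1 c2 0 B D *m Y = 1%:M by rewrite /Nx -[RHS](mulKmx uM) MY mulmx1.
apply: (can_inj (mulKmx uVt)); rewrite mulmx1.
rewrite /Y !mulmxA E.
have -> : diag_mx (\row_j pc (d 0 j) c1 c2) *m Dl = 1%:M.
  by apply/matrixP => i j; rewrite mul_diag_mx !mxE mulrnAr mulfV.
by rewrite mul1mx.
Qed.

(** A congruence is not a similarity, so squaring the inverse leaves the Gram matrix of [V] in the
    middle and couples pairs of diagonal entries. *)
Lemma square_entry c1 c2 i k : Mx c1 c2 0 B D \in unitmx ->
  (Nx c1 c2 0 B D *m Nx c1 c2 0 B D) i k =
  \sum_l \sum_j (V i j * (V ^t* *m V) j l * (V k l)^*) *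
    ((pc (d 0 j) c1 c2)^-1 * (pc (d 0 l) c1 c2)^-1).
Proof.
move=> /inv_congr [_ ->].
set Dl := diag_mx _.
have -> : V *m Dl *m V ^t* *m (V *m Dl *m V ^t*) =
  V *m Dl *m (V ^t* *m V) *m Dl *m V ^t* by rewrite !mulmxA.
rewrite sandwich_diag_entry; apply: eq_bigr => l _; apply: eq_bigr => j _.
move: (V ^t* *m V) => G.
by rewrite !mxE.
Qed.

End ZeroLimit.

(** * Uniformity over the complex unit sphere *)

Section Sphere.
Variable R : realType.
Local Notation C := R[i].

Definition cvec n (r : 'rV[R]_(n + n)) : 'cV[C]_n :=
  \col_i (r 0 (lshift n i) +i* r 0 (rshift n i)).

Definition rvec n (v : 'cV[C]_n) : 'rV[R]_(n + n) :=
  row_mx (\row_i complex.Re (v i 0)) (\row_i complex.Im (v i 0)).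

Lemma rvecK n : cancel (@rvec n) (@cvec n).
Proof.
move=> v; apply/matrixP => i j; rewrite ord1 mxE row_mxEl row_mxEr !mxE.
by case: (v i 0).
Qed.

Lemma ccont_cvec n (T : topologicalType) (x : T) (f : T -> 'rV[R]_(n + n)) :
  {for x, continuous f} -> mcont x (fun t => cvec (f t)).
Proof.
move=> cf i j; rewrite ord1.
apply: (@eq_ccont _ _ _ (fun t => f t 0 (lshift n i) +i* f t 0 (rshift n i))).
  by move=> t; rewrite mxE.
split.
  by apply: (@continuous_comp _ _ _ f (fun M : 'rV[R]_(n + n) => M 0 (lshift n i))) => //;
    exact: coord_continuous.
by apply: (@continuous_comp _ _ _ f (fun M : 'rV[R]_(n + n) => M 0 (rshift n i))) => //;
    exact: coord_continuous.
Qed.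

Lemma cts_nsq n (T : topologicalType) (x : T) (F : T -> 'cV[C]_n) : mcont x F ->
  continuous_at x (fun t => nsq (F t)).
Proof. by move=> cF; have [] := mcontM (mcont_trC cF) cF 0 0. Qed.

Lemma ccont_form n (T : topologicalType) (x : T) (H : T -> 'M[C]_n) (F : T -> 'cV[C]_n) :
  mcont x H -> mcont x F -> ccont x (fun t => form (H t) (F t) (F t)).
Proof. by move=> cH cF; exact: (mcontM (mcontM (mcont_trC cF) cH) cF 0 0). Qed.

(** The tube lemma for the unit sphere of C^n. Vectors are realified so that the sphere becomes a
    closed subset of the cube [-1, 1]^{2n}, hence compact. *)
Lemma csphere_near n (T : topologicalType) (x0 : T) (P : T -> 'cV[C]_n -> Prop) :
  (forall r : 'rV[R]_(n + n), nsq (cvec r) = 1 ->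
     \forall z \near (x0, r), P z.1 (cvec z.2)) ->
  \forall x \near x0, forall v, nsq v = 1 -> P x v.
Proof.
move=> h.
pose K : set 'rV[R]_(n + n) := [set r | nsq (cvec r) = 1].
have cK : compact K.
  apply: (@subclosed_compact _ _ [set r : 'rV[R]_(n + n) | forall i, `[(-1)%R, 1%R]%classic (r ord0 i)]).
  - rewrite (_ : K = (fun r => nsq (cvec r)) @^-1` [set 1]) //.
    apply: preimage_closed; last exact: closed_eq.
    move=> r _; apply: cts_nsq; apply: ccont_cvec; exact: cvg_id.
  - by apply: (@rV_compact R (n + n) (fun=> `[(-1)%R, 1%R]%classic)) => i; exact: segment_compact.
  - move=> r /= r1 i; rewrite in_itv /= -ler_norml -(@ler_pXn2r _ 2) ?nnegrE // expr1n.
    rewrite real_normK ?num_real // -r1 nsqE.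
    have pos k : 0 <= complex.Re (cvec r k 0) ^+ 2 + complex.Im (cvec r k 0) ^+ 2.
      by rewrite addr_ge0 ?sqr_ge0.
    case: (splitP i) => k ik; rewrite (bigD1 k) //=.
      have -> : i = lshift n k by exact: val_inj.
      apply: (@le_trans _ _ (complex.Re (cvec r k 0) ^+ 2 + complex.Im (cvec r k 0) ^+ 2)).
        by rewrite mxE /= lerDl sqr_ge0.
      by rewrite lerDl sumr_ge0.
    have -> : i = rshift n k by exact: val_inj.
    apply: (@le_trans _ _ (complex.Re (cvec r k 0) ^+ 2 + complex.Im (cvec r k 0) ^+ 2)).
      by rewrite mxE /= lerDr sqr_ge0.
    by rewrite lerDl sumr_ge0.
have /compact_near_coveringP cov := cK.
have H r : K r -> \forall r' \near r & x \near x0, P x (cvec r').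
  move=> Kr.
  have [[U W] [/= Ux Wr] UW] : filter_prod (nbhs x0) (nbhs r) (fun z => P z.1 (cvec z.2)) := h r Kr.
  by exists (W, U) => //= -[y t] [/= Wy Ut]; exact: (UW (t, y)).
apply: filterS (cov T (nbhs x0) (fun x r => P x (cvec r)) _ H) => x Hx v v1.
by rewrite -[v]rvecK; apply: Hx; rewrite /K /= rvecK.
Qed.

End Sphere.

Lemma adjE (R : realType) m n (A : 'M[R[i]]_(m, n)) i j : (A ^t* ) i j = (A j i)^*.
Proof. by rewrite !mxE. Qed.

(** * The deformed integral at eps = 0 *)

Section ZeroLimitIntegral.
Variables (R : realType) (n : nat).
Local Notation C := R[i].
Variables (B D V : 'M[C]_n) (d : 'rV[C]_n).
Hypotheses (hB : B ^t* = B) (hD : D ^t* = D) (uV : V \in unitmx).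
Hypothesis VE : V ^t* *m (B + (0 +i* 1) *: D) *m V = diag_mx d.
Hypothesis gd : good (diag_mx d).
Variables (s s' : R -> R).
Hypothesis ds : forall t, is_derive t (1 : R) s (s' t).
Hypothesis cs' : continuous s'.
Hypothesis s_per : s (2 * pi) = s 0.
Variable dl : R.
Hypothesis uM : forall t, 0 <= t <= 2 * pi -> Mg s 0 B D dl t \in unitmx.

Definition deformed_int e (B D : 'M[C]_n) (i j : 'I_n) : C := CI 0 (2 * pi) (fun t =>
  speed s' dl t * (invmx (Mg s e B D dl t) *m invmx (Mg s e B D dl t)) i j).

(** The entry (a, b) of the integral is the sum of V_aj G_jl conj(V_bl) I_jl, where G is the
    Hermitian Gram matrix of V and the scalar integrals I_jl are symmetric in j, l and purely
    imaginary. Such a matrix is anti-Hermitian. *)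
Lemma zero_limit i k : deformed_int 0 B D i k + (deformed_int 0 B D k i)^* = 0.
Proof.
pose G := V ^t* *m V.
pose p j t := pc (d 0 j) (k1 t (dl * s t)) (k2 t (dl * s t)).
pose I j l := CI 0 (2 * pi) (fun t => speed s' dl t * ((p j t)^-1 * (p l t)^-1)).
have p0 j t : 0 <= t <= 2 * pi -> p j t != 0.
  by move=> /uM u; have [h _] := inv_congr hB hD uV VE u; exact: h.
have d0 j := good_diag_neq0 j gd.
have cI j l : cconton 0 (2 * pi) (fun t => speed s' dl t * ((p j t)^-1 * (p l t)^-1)).
  have cp m : cconton 0 (2 * pi) (p m).
    by move=> t _; exact: cder_ccont (cder_p ds dl (d 0 m) t).
  apply: cconton_M; first by move=> t _; exact: ccont_g.
  by apply: cconton_M; apply: cconton_V => //; move=> t; exact: p0.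
have JE a b : deformed_int 0 B D a b =
    \sum_l \sum_j (V a j * G j l * (V b l)^*) * I j l.
  rewrite /deformed_int.
  rewrite (@eq_CI _ _ _ _ (fun t => \sum_l \sum_j (V a j * G j l * (V b l)^*) *
      (speed s' dl t * ((p j t)^-1 * (p l t)^-1)))); last first.
    move=> t tI; rewrite (square_entry hB hD uV VE _ _ (uM tI)) mulr_sumr.
    apply: eq_bigr => l _; rewrite mulr_sumr; apply: eq_bigr => j _.
    by rewrite mulrCA.
  have cc c j l : cconton 0 (2 * pi) (fun t => c * (speed s' dl t * ((p j t)^-1 * (p l t)^-1))).
    by apply: cconton_M => // t _; exact: ccont_cst.
  rewrite CI_sum; last by move=> l t tI; apply: ccont_sum => j; exact: cc tI.
  apply: eq_bigr => l _; rewrite CI_sum; last by move=> j; exact: cc.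
  by apply: eq_bigr => j _; rewrite CIZ.
have Isym j l : I j l = I l j.
  by apply: eq_CI => t _; rewrite [X in _ * X]mulrC.
have IRe j l : I j l + (I j l)^* = 0.
  have h := Re_zero_pair ds cs' s_per (d0 j) (d0 l) (p0 j) (p0 l).
  by rewrite addcJ [complex.Re _]h mulr0.
have Gh j l : (G l j)^* = G j l.
  by rewrite -adjE /G adjM adjK.
rewrite !JE rmorph_sum exchange_big /= -big_split big1 //= => j _.
rewrite rmorph_sum -big_split big1 //= => l _.
rewrite !rmorphM /= Gh -[((V i j)^*)^*]/(conjc (conjc _)) conjcK.
rewrite (Isym l j) [X in _ + X * _](_ : _ = V i j * G j l * (V k l)^*); last first.
  by ring.
by rewrite -mulrDr IRe mulr0.
Qed.

End ZeroLimitIntegral.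

(** * The plane-wave kernel and its limit *)

Section KernelLimit.
Variables (R : realType) (n : nat).
Local Notation C := R[i].

Definition kernel_half (e : R) (B D : 'M[C]_n) i j : C :=
  CI 0 (2 * pi) (fun t =>
    (Nx (cos t)%:C (sin t)%:C (0 +i* e) B D *m Nx (cos t)%:C (sin t)%:C (0 +i* e) B D) i j).

(** The entry (i, j) of the integral plus its adjoint; this symmetrisation is what cancels in the
    limit e -> 0. *)
Definition kernel e B D i j : C := kernel_half e B D i j + (kernel_half e B D j i)^*.

(** With v = V w, the equation H0 v = 0 confines w to the coordinates where [av] vanishes, and there
    the form of [H1] is the sum of the [bv] weighted by |w_j|^2. By the choice of the shift every
    such term has the sign of [sfield]. *)
Lemma shift_positive (B D V : 'M[C]_n) (d : 'rV[C]_n) mu t (v : 'cV[C]_n) :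
  B ^t* = B -> D ^t* = D -> V \in unitmx ->
  V ^t* *m (B + (0 +i* 1) *: D) *m V = diag_mx d ->
  (forall j, av (d 0 j) t = 0 -> 0 < sfield d mu t * bv (d 0 j) t) ->
  v != 0 -> H0 t B D *m v = 0 -> 0 < sfield d mu t * complex.Re (form (H1 t B D) v v).
Proof.
move=> hB hD uV VE pos v0 Hv.
have [w vE] : exists w, v = V *m w by exists (invmx V *m v); rewrite mulKVmx.
have w0 : w != 0 by apply: contra v0 => /eqP E; rewrite vE E mulmx0.
have aw j : av (d 0 j) t * complex.Re (w j 0) = 0 /\ av (d 0 j) t * complex.Im (w j 0) = 0.
  have : V ^t* *m H0 t B D *m V *m w = 0 by rewrite -!mulmxA -vE Hv !mulmx0.
  rewrite /H0 (congr_comb hB hD VE) => /(congr1 (fun M : 'cV[C]_n => M j 0)).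
  rewrite diag_mulv !mxE /pc -!rmorphM -rmorphD /= => h.
  have hr := congr1 (@complex.Re R) h; have hi := congr1 (@complex.Im R) h.
  move: hr hi; rewrite cReM cImM /= !mul0r subr0 addr0 => hr hi.
  by split; rewrite /av [X in (X + _) * _]mulrC [X in (_ + X) * _]mulrC.
have fE : complex.Re (form (H1 t B D) v v) =
    \sum_j bv (d 0 j) t * (complex.Re (w j 0) ^+ 2 + complex.Im (w j 0) ^+ 2).
  rewrite vE -form_congr /H1 (congr_comb hB hD VE) form_diag cRe_sum.
  apply: eq_bigr => j _; rewrite mxE /pc !(cReM, cImM, cReD, cImD, cReJ, cImJ) /= /bv.
  by ring.
have wj : exists j, w j 0 != 0.
  apply/existsP; apply: contraR w0; rewrite negb_exists => /forallP h.
  by apply/eqP/matrixP => i k; rewrite ord1 mxE; exact/eqP/negPn.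
have [j j0] := wj.
rewrite fE mulr_sumr (bigD1 j) //=.
have term k : 0 <= sfield d mu t * (bv (d 0 k) t * (complex.Re (w k 0) ^+ 2 + complex.Im (w k 0) ^+ 2)).
  have [wk|wk] := eqVneq (w k 0) 0; first by rewrite wk /= expr0n /= addr0 !mulr0.
  rewrite mulrA mulr_ge0 ?addr_ge0 ?sqr_ge0 // ltW // pos //.
  have [h1 h2] := aw k; have := sumsqr_neq0 wk.
  move/eqP: h1; rewrite mulf_eq0 => /orP[/eqP //|/eqP h1].
  move/eqP: h2; rewrite mulf_eq0 => /orP[/eqP //|/eqP h2].
  by rewrite h1 h2 expr0n /= addr0 eqxx.
rewrite ltr_wpDr ?sumr_ge0 // mulrA.
have n0 := sumsqr_neq0 j0.
have p0 : 0 < complex.Re (w j 0) ^+ 2 + complex.Im (w j 0) ^+ 2.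
  by rewrite lt_neqAle eq_sym n0 addr_ge0 ?sqr_ge0.
rewrite mulr_gt0 // pos //; have [h1 h2] := aw j.
move/eqP: h1; rewrite mulf_eq0 => /orP[/eqP //|/eqP h1].
move/eqP: h2; rewrite mulf_eq0 => /orP[/eqP //|/eqP h2].
by move: n0; rewrite h1 h2 expr0n /= addr0 eqxx.
Qed.

End KernelLimit.

Lemma near_pair (T U : topologicalType) (x : T) (y : U) (P : T * U -> Prop) :
  (\forall z \near (x, y), P z) ->
  exists A B, [/\ nbhs x A, nbhs y B & forall a b, A a -> B b -> P (a, b)].
Proof.
move=> H; have [[A B] [/= Ax By] AB] : filter_prod (nbhs x) (nbhs y) P := H.
by exists A, B; split=> // a b Aa Bb; exact: (AB (a, b)).
Qed.

Lemma cts_fstc (Y T U : topologicalType) (y : Y) (f : Y -> T * U) :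
  {for y, continuous f} -> {for y, continuous (fun z => (f z).1)}.
Proof. by move=> cf; apply: (@continuous_comp _ _ _ f fst) => //; exact: cvg_fst. Qed.

Lemma cts_sndc (Y T U : topologicalType) (y : Y) (f : Y -> T * U) :
  {for y, continuous f} -> {for y, continuous (fun z => (f z).2)}.
Proof. by move=> cf; apply: (@continuous_comp _ _ _ f snd) => //; exact: cvg_snd. Qed.

Lemma near_pos (R : realType) (Y : topologicalType) (y : Y) (f : Y -> R) :
  continuous_at y f -> 0 < f y -> \forall z \near y, 0 < f z.
Proof. by move=> cf f0; exact: (cvgr_gt _ cf). Qed.

Section KernelLimit.
Variables (R : realType) (n : nat) (T : topologicalType).
Local Notation C := R[i].
Variables (B D : T -> 'M[C]_n) (x0 : T).
Hypotheses (hB : forall x, (B x) ^t* = B x) (hD : forall x, (D x) ^t* = D x).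
Hypotheses (cB : forall x, mcont x B) (cD : forall x, mcont x D).

Lemma mcont_comp (U W : topologicalType) m k (g : U -> W) (F : W -> 'M[C]_(m, k)) u :
  {for u, continuous g} -> mcont (g u) F -> mcont u (fun y => F (g y)).
Proof. by move=> cg cF i j; exact: (ccont_comp cg (cF i j)). Qed.

Lemma ccont_ireal (U : topologicalType) (u : U) (f : U -> R) :
  {for u, continuous f} -> ccont u (fun y => 0 +i* f y : C).
Proof. by move=> cf; split; [exact: cst_continuous | exact: cf]. Qed.

(* M0 v = 0 forces [s * form M0' v v > 0]; by compactness one of the two alternatives
   survives for x near x0 and small tau. *)
Lemma alternative_near (s : R -> R) : continuous s ->
  (forall t v, v != 0 -> H0 t (B x0) (D x0) *m v = 0 ->
     0 < s t * complex.Re (form (H1 t (B x0) (D x0)) v v)) ->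
  \forall z \near (x0, 0 : R), forall t, 0 <= t <= 2 * pi -> forall v, nsq v = 1 ->
    0 < s t * complex.Re (form (H1 t (B z.1) (D z.1)) v v) \/
    z.2 ^+ 2 * nsq (H1 t (B z.1) (D z.1) *m v) < nsq (H0 t (B z.1) (D z.1) *m v).
Proof.
move=> cs pos.
pose Q (z : T * R) (t : R) v := 0 < s t * complex.Re (form (H1 t (B z.1) (D z.1)) v v) \/
    z.2 ^+ 2 * nsq (H1 t (B z.1) (D z.1) *m v) < nsq (H0 t (B z.1) (D z.1) *m v).
apply: (@segment_near R (T * R)%type (x0, 0) 0 (2 * pi)
  (fun z t => forall v, nsq v = 1 -> Q z t v)) => t tI.
apply: (@csphere_near R n ((T * R) * R)%type ((x0, 0), t)
  (fun y v => Q y.1 y.2 v)) => r r1.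
pose Y := (((T * R) * R) * 'rV[R]_(n + n))%type.
pose y0 : Y := (((x0, 0), t), r).
have c1 : {for y0, continuous (fun y : Y => y.1)} by exact: cvg_fst.
have c11 : {for y0, continuous (fun y : Y => y.1.1)}.
  exact: cts_fstc c1.
have c111 : {for y0, continuous (fun y : Y => y.1.1.1)}.
  exact: cts_fstc c11.
have c112 : {for y0, continuous (fun y : Y => y.1.1.2)}.
  exact: cts_sndc c11.
have c12 : {for y0, continuous (fun y : Y => y.1.2)}.
  exact: cts_sndc c1.
have c2 : {for y0, continuous (fun y : Y => y.2)} by exact: cvg_snd.
have cv := ccont_cvec c2.
have cB' : mcont y0 (fun y : Y => B y.1.1.1) := mcont_comp c111 (cB _).
have cD' : mcont y0 (fun y : Y => D y.1.1.1) := mcont_comp c111 (cD _).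
have cc : continuous_at y0 (fun y : Y => cos y.1.2).
  by apply: (@continuous_comp _ _ _ (fun y : Y => y.1.2) cos) => //; exact: continuous_cos.
have csn : continuous_at y0 (fun y : Y => sin y.1.2).
  by apply: (@continuous_comp _ _ _ (fun y : Y => y.1.2) sin) => //; exact: continuous_sin.
have cst : continuous_at y0 (fun y : Y => s y.1.2).
  by apply: (@continuous_comp _ _ _ (fun y : Y => y.1.2) s) => //; exact: cs.
have cH0 : mcont y0 (fun y : Y => H0 y.1.2 (B y.1.1.1) (D y.1.1.1)).
  by apply: mcontD; apply: mcontZ => //; exact: ccont_real.
have cH1 : mcont y0 (fun y : Y => H1 y.1.2 (B y.1.1.1) (D y.1.1.1)).
  apply: mcontD; apply: mcontZ => //; first by apply: ccont_real; exact: cvgN.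
  exact: ccont_real.
have [Hv|Hv] := eqVneq (H0 t (B x0) (D x0) *m cvec r) 0.
  have v0 : cvec r != 0 by rewrite -nsq_gt0 r1.
  have cF : continuous_at y0 (fun y : Y => s y.1.2 *
      complex.Re (form (H1 y.1.2 (B y.1.1.1) (D y.1.1.1)) (cvec y.2) (cvec y.2))).
    by apply: cvgM => //; have [] := ccont_form cH1 cv.
  have nF := near_pos cF (pos t _ v0 Hv).
  by apply: filterS nF => y hy; left.
have cF : continuous_at y0 (fun y : Y => nsq (H0 y.1.2 (B y.1.1.1) (D y.1.1.1) *m cvec y.2)
   - y.1.1.2 ^+ 2 * nsq (H1 y.1.2 (B y.1.1.1) (D y.1.1.1) *m cvec y.2)).
  apply: cvgB; first exact: cts_nsq (mcontM cH0 cv).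
  apply: cvgM; first by apply: cvgM; exact: c112.
  exact: cts_nsq (mcontM cH1 cv).
have p0 : 0 < nsq (H0 t (B x0) (D x0) *m cvec r)
   - 0 ^+ 2 * nsq (H1 t (B x0) (D x0) *m cvec r).
  by rewrite expr0n /= mul0r subr0 nsq_gt0.
have nF := near_pos cF p0.
by apply: filterS nF => y; rewrite /= subr_gt0 => hy; right.
Qed.

(** The quotient sh/ch is 0 at 0, and the bound is uniform in t by compactness of the period. *)
Lemma small_shift (s : R -> R) (tau : R) : continuous s -> 0 < tau ->
  exists2 dl, 0 < dl & forall sg t, 0 <= sg <= dl -> 0 <= t <= 2 * pi ->
    sh (sg * s t) ^+ 2 <= tau ^+ 2 * ch (sg * s t) ^+ 2.
Proof.
move=> cs tau0.
have : \forall sg \near (0 : R), forall t, 0 <= t <= 2 * pi ->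
    sh (sg * s t) ^+ 2 <= tau ^+ 2 * ch (sg * s t) ^+ 2.
  apply: segment_near => t tI.
  pose z0 : R * R := (0, t).
  have cst : continuous_at z0 (fun z : R * R => s z.2).
    by apply: (@continuous_comp _ _ _ (fun z : R * R => z.2) s); [exact: cvg_snd | exact: cs].
  have ce : continuous_at z0 (fun z : R * R => z.1 * s z.2).
    by apply: cvgM => //; exact: cvg_fst.
  have cch : continuous_at z0 (fun z : R * R => ch (z.1 * s z.2)).
    by apply: (@continuous_comp _ _ _ (fun z : R * R => z.1 * s z.2) (@ch R)) => //; exact: derive_cts (d_ch _).
  have csh : continuous_at z0 (fun z : R * R => sh (z.1 * s z.2)).
    by apply: (@continuous_comp _ _ _ (fun z : R * R => z.1 * s z.2) (@sh R)) => //; exact: derive_cts (d_sh _).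
  have cF : continuous_at z0 (fun z : R * R => tau ^+ 2 * ch (z.1 * s z.2) ^+ 2 - sh (z.1 * s z.2) ^+ 2).
    apply: cvgB; last exact: cvgM.
    by apply: cvgM; [exact: cvg_cst | exact: cvgM].
  have p0 : 0 < tau ^+ 2 * ch (z0.1 * s z0.2) ^+ 2 - sh (z0.1 * s z0.2) ^+ 2.
    by rewrite /= mul0r sh0 ch0 expr1n mulr1 expr0n /= subr0 exprn_gt0.
  by apply: filterS (near_pos cF p0) => z /=; rewrite subr_gt0 => /ltW.
move=> [r /= r0 H]; exists (r / 2); first by rewrite divr_gt0.
move=> sg t /andP[sg0 sgr] tI; apply: H => //=.
rewrite sub0r normrN ger0_norm //; apply: (le_lt_trans sgr).
by rewrite ltr_pdivrMr // ltr_pMr // ltr1n.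
Qed.

(** For e > 0 the contour can be shifted by a fixed amount [dl], uniformly for x near x0. On the
    shifted contour the matrix remains invertible at e = 0, so the integral is jointly continuous in
    (e, x) up to e = 0, where its symmetrisation is zero by [zero_limit]. *)
Lemma kernel_to0 i j : good (B x0 + (0 +i* 1) *: D x0) ->
  forall eta, 0 < eta -> \forall z \near (0 : R, x0), 0 < z.1 ->
    `|complex.Re (kernel z.1 (B z.2) (D z.2) i j)| <= eta /\
    `|complex.Im (kernel z.1 (B z.2) (D z.2) i j)| <= eta.
Proof.
move=> gX eta eta0.
have [V [d [uV VE]]] := good_diag gX.
have gd : good (diag_mx d) by rewrite -VE; exact: good_congr.
have [mu mu0 sgn] := sfield_sign gd.
pose s := sfield d mu; pose s' := sfield' d mu.
have ds t : is_derive t (1 : R) s (s' t) by exact: d_sfield.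
have cs' : continuous s' by exact: sfield'_cts.
have s_per : s (2 * pi) = s 0 by exact: sfield_per.
have cs : continuous s by move=> t; exact: derive_cts (ds t).
have pos t v : v != 0 -> H0 t (B x0) (D x0) *m v = 0 ->
     0 < s t * complex.Re (form (H1 t (B x0) (D x0)) v v).
  by apply: (shift_positive (hB x0) (hD x0) uV VE) => k; exact: sgn.
have [U [W [Ux W0 UW]]] := near_pair (alternative_near cs pos).
have [r r0 rW] := W0; rewrite /= in r0.
have tau0 : 0 < r / 2 by rewrite divr_gt0.
have Wtau : W (r / 2).
  by apply: rW; rewrite /= sub0r normrN ger0_norm ?ltW // ltr_pdivrMr // ltr_pMr // ltr1n.
have [dl dl0 Hdl] := small_shift cs tau0.
(* Invertibility can fail only when both the shift and e are zero: for e > 0 the shift may run over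
   all of [0, dl], and for the full shift e may be 0. *)
have unit x e sg t : U x -> 0 <= e -> 0 <= sg <= dl -> (0 < sg) || (0 < e) ->
    0 <= t <= 2 * pi -> Mg s (0 +i* e) (B x) (D x) sg t \in unitmx.
  move=> Ux' e0 sgI p tI; have /andP[sg0 _] := sgI.
  apply: (@Mx_unit R n t (sg * s t) (s t) sg (r / 2)) => //; first exact: Hdl.
  by move=> v v1; exact: (UW x (r / 2) Ux' Wtau t tI v v1).
pose J e x a b := deformed_int s s' dl (0 +i* e) (B x) (D x) a b.
have halfE e x a b : 0 < e -> U x -> kernel_half e (B x) (D x) a b = J e x a b.
  move=> e0 Ux'.
  rewrite /J /deformed_int -(deformation ds cs' s_per _ _ dl0); last first.
    by move=> sg t sgI tI; apply: unit => //; rewrite ?e0 ?orbT // ltW.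
  apply: eq_CI => t _; rewrite /Mg /Nx mul0r.
  have -> : speed s' 0 t = 1 by rewrite /speed mul0r oppr0.
  rewrite mul1r /k1 /k2 ch0 sh0 !mulr1 !mulr0 oppr0 //.
pose y0 : R * T := (0, x0).
(* Replacing e by its absolute value gives a function on a full neighbourhood of 0 to which
   two-sided continuity applies. *)
have cJ a b : ccont y0 (fun y : R * T => J `|y.1| y.2 a b).
  have nU : \forall y \near y0, U y.2.
    by exists (setT, U) => /=; [split => //; exact: filterT | move=> y []].
  have dlI : 0 <= dl <= dl by rewrite lexx ltW.
  have cM y (t : R) : mcont (y, t) (fun z : (R * T) * R =>
      Mg s (0 +i* `|z.1.1|) (B z.1.2) (D z.1.2) dl z.2).
    have h1 : {for (y, t), continuous (fun z : (R * T) * R => z.1)} by exact: cvg_fst.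
    have h11 : {for (y, t), continuous (fun z : (R * T) * R => z.1.1)}.
      exact: cts_fstc h1.
    have h12 : {for (y, t), continuous (fun z : (R * T) * R => z.1.2)}.
      exact: cts_sndc h1.
    have h2 : {for (y, t), continuous (fun z : (R * T) * R => z.2)} by exact: cvg_snd.
    have hs : continuous_at (y, t) (fun z : (R * T) * R => dl * s z.2).
      apply: cvgM; first exact: cvg_cst.
      by apply: (@continuous_comp _ _ _ (fun z : (R * T) * R => z.2) s) => //; exact: cs.
    have [k1c k2c] := ccont_k h2 hs.
    apply: mcontB.
      by apply: mcontD; apply: mcontZ => //; apply: mcont_comp.
    by apply: mcont_scalar; apply: ccont_ireal; exact: cvg_norm.
  have cI y t : U y.2 -> 0 <= t <= 2 * pi -> ccont (y, t) (fun z : (R * T) * R =>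
     speed s' dl z.2 * (invmx (Mg s (0 +i* `|z.1.1|) (B z.1.2) (D z.1.2) dl z.2) *m
      invmx (Mg s (0 +i* `|z.1.1|) (B z.1.2) (D z.1.2) dl z.2)) a b).
    move=> Uy tI; apply: ccontM.
      by apply: (@ccont_comp _ _ _ (y, t) (fun z => z.2) (speed s' dl)); [exact: cvg_snd | exact: ccont_g].
    apply: (mcont_N2 _ (cM y t)).
    by apply: unit => //; rewrite dl0.
  apply: CI_ccont.
  - by rewrite ltW // mulr_gt0 // pi_gt0.
  - by move=> t tI; apply: cI => //; exact: nbhs_singleton.
  - apply: filterS nU => y Uy t tI.
    have := cI y t Uy tI.
    apply: (@ccont_comp _ _ _ t (fun v => (y, v))); exact: (cvg_pair (cvg_cst y) cvg_id).
pose K (y : R * T) := J `|y.1| y.2 i j + (J `|y.1| y.2 j i)^*.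
have K0 : K y0 = 0.
  rewrite /K /= normr0; apply: (zero_limit (hB x0) (hD x0) uV VE gd ds cs' s_per) => t tI.
  by apply: (@unit x0 0 dl t) => //; rewrite ?dl0 ?lexx ?ltW //; exact: nbhs_singleton.
have [K1 K2] : ccont y0 K by apply: ccontD => //; exact: ccontJ.
have n1 : \forall y \near y0, `|complex.Re (K y)| <= eta.
  have /cvgrPdist_le/(_ _ eta0) := K1; rewrite K0 /=.
  by apply: filterS => y; rewrite sub0r normrN.
have n2 : \forall y \near y0, `|complex.Im (K y)| <= eta.
  have /cvgrPdist_le/(_ _ eta0) := K2; rewrite K0 /=.
  by apply: filterS => y; rewrite sub0r normrN.
have nU : \forall y \near y0, U y.2.
  by exists (setT, U) => /=; [split => //; exact: filterT | move=> y []].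
apply: filterS3 nU n1 n2 => z Uz h1 h2 z0.
have E : kernel z.1 (B z.2) (D z.2) i j = K z.
  have e0 : `|z.1| = z.1 by apply: ger0_norm; exact: ltW.
  rewrite /K e0.
  exact: (f_equal2 (fun a b : C => a + b^*)
    (halfE z.1 z.2 i j z0 Uz) (halfE z.1 z.2 j i z0 Uz)).
by rewrite E; split.
Qed.

End KernelLimit.

(** * Openness of goodness *)

Section GoodOpen.
Variables (R : realType) (n : nat).
Local Notation C := R[i].

(** The sum of |<X v, v>|^2 and of the squared defect in the pencil relation with coefficients w: X
    is good exactly when this is positive for all unit vectors v and w. *)
Definition good_gauge (X : 'M[C]_n) (v : 'cV[C]_n) (w : 'cV[C]_2) : R :=
  complex.Re (form X v v) ^+ 2 + complex.Im (form X v v) ^+ 2 +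
  nsq (w 0 0 *: (X *m v) - w 1 0 *: (X ^t* *m v)).

Lemma good_gauge_gt0 (X : 'M[C]_n) v w : good X -> nsq v = 1 -> nsq w = 1 ->
  0 < good_gauge X v w.
Proof.
move=> gX v1 w1; have v0 : v != 0 by rewrite -nsq_gt0 v1.
have w0 : (w 0 0, w 1 0) != (0, 0).
  apply/eqP => -[a b]; have : w != 0 by rewrite -nsq_gt0 w1.
  case/negP; apply/eqP/matrixP => i j; rewrite ord1 mxE.
  by case: i => -[|[|//]] hi; [rewrite -a | rewrite -b]; congr (w _ 0); apply: val_inj.
have [E|E] := eqVneq (w 0 0 *: (X *m v)) (w 1 0 *: (X ^t* *m v)).
  have f0 := gX v _ _ v0 w0 E.
  rewrite ltr_wpDr ?nsq_ge0 // lt_neqAle eq_sym sumsqr_neq0 //=.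
  by rewrite addr_ge0 ?sqr_ge0.
by rewrite ltr_wpDl ?nsq_gt0 ?subr_eq0 // addr_ge0 ?sqr_ge0.
Qed.

Lemma nsq_normalize m (v : 'cV[C]_m) : v != 0 -> exists2 c : R, 0 < c & nsq (c%:C *: v) = 1.
Proof.
move=> v0; have p0 : 0 < nsq v by rewrite nsq_gt0.
exists (Num.sqrt (nsq v))^-1; first by rewrite invr_gt0 sqrtr_gt0.
by rewrite nsqZ exprVn sqr_sqrtr ?ltW // mulVf ?lt0r_neq0.
Qed.

Lemma gauge_good (X : 'M[C]_n) :
  (forall v, nsq v = 1 -> forall w, nsq w = 1 -> 0 < good_gauge X v w) -> good X.
Proof.
move=> H v mu nu v0 mn0 E; apply/eqP => f0.
have [c c0 c1] := nsq_normalize v0.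
pose w : 'cV[C]_2 := \col_i (if i == 0 then mu else nu).
have w0 : w != 0.
  apply: contra mn0 => /eqP /matrixP w0; have := w0 0 0; have := w0 1 0.
  by rewrite !mxE /= => -> ->.
have [b b0 b1] := nsq_normalize w0.
have := H _ c1 _ b1; rewrite /good_gauge formZ f0 mulr0 /= expr0n /= addr0 add0r.
have -> : (b%:C *: w) 0 0 *: (X *m (c%:C *: v)) - (b%:C *: w) 1 0 *: (X ^t* *m (c%:C *: v)) = 0.
  rewrite !mxZE /w !mxE /= -!scalemxAr ![_ *: (c%:C *: _)]scale_comm -scalerBr -!scalerA E subrr.
  by rewrite scaler0.
have -> : nsq (0 : 'cV[C]_n) = 0 by rewrite nsqE big1 // => i _; rewrite mxE /= expr0n /= addr0.
by rewrite ltxx.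
Qed.

(** The gauge is continuous in X, v and w, and positivity on a product of two compact spheres
    survives small changes of X. *)
Lemma good_near (T : topologicalType) (x0 : T) (X : T -> 'M[C]_n) :
  mcont x0 X -> good (X x0) -> \forall x \near x0, good (X x).
Proof.
move=> cX gX.
have : \forall x \near x0, forall v, nsq v = 1 -> forall w, nsq w = 1 -> 0 < good_gauge (X x) v w.
  apply: (@csphere_near R n T x0 (fun x v => forall w, nsq w = 1 -> 0 < good_gauge (X x) v w)) => r r1.
  apply: (@csphere_near R 2 (T * 'rV[R]_(n + n))%type (x0, r)
    (fun y w => 0 < good_gauge (X y.1) (cvec y.2) w)) => q q1.
  pose y0 : (T * 'rV[R]_(n + n)) * 'rV[R]_(2 + 2) := (x0, r, q).
  have h1 : {for y0, continuous (fun y : (T * 'rV[R]_(n + n)) * 'rV[R]_(2 + 2) => y.1)}.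
    exact: cvg_fst.
  have h11 := cts_fstc h1; have h12 := cts_sndc h1.
  have h2 : {for y0, continuous (fun y : (T * 'rV[R]_(n + n)) * 'rV[R]_(2 + 2) => y.2)}.
    exact: cvg_snd.
  have cX' := mcont_comp h11 cX.
  have cv := ccont_cvec h12; have cw := ccont_cvec h2.
  apply: near_pos; last exact: good_gauge_gt0.
  have [f1 f2] := ccont_form cX' cv.
  apply: cvgD; first by apply: cvgD; apply: cvgM.
  apply: cts_nsq; apply: mcontB; apply: mcontZ; try exact: cw; apply: mcontM => //.
  exact: mcont_trC.
by apply: filterS => x; exact: gauge_good.
Qed.

Lemma good_definite (c : C) (X : 'M[C]_n) :
  (forall v : 'cV[C]_n, v != 0 -> complex.Re (c * form X v v) != 0) -> good X.
Proof.
move=> H v mu nu v0 _ _; apply: contra (H v v0) => /eqP ->.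
by rewrite mulr0.
Qed.

End GoodOpen.

(** * Goodness when the kernels fill the space *)

Section KernelSum.
Variables (R : realType) (n k : nat).
Local Notation C := R[i].
Variables (B D : 'M[C]_n) (th : 'I_k -> R).
Hypotheses (hB : B ^t* = B) (hD : D ^t* = D).
Hypothesis th_inj : injective th.
Hypothesis th_range : forall i, 0 <= th i < pi.
Let X := B + (0 +i* 1) *: D.
Hypothesis noniso : forall i (v : 'cV[C]_n), v != 0 -> H0 (th i) B D *m v = 0 ->
  form X v v != 0.

Lemma sin_diff_neq0 i j : i != j -> sin (th i - th j) != 0.
Proof.
move=> ij; have tij : th i != th j by apply: contra ij => /eqP /th_inj ->.
have /andP[i0 ip] := th_range i; have /andP[j0 jp] := th_range j.
have [h|h|h] := ltrgtP (th i) (th j); last by rewrite h eqxx in tij.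
  rewrite -oppr_eq0 -sinN lt0r_neq0 // sin_gt0_pi //; lra.
by rewrite lt0r_neq0 // sin_gt0_pi //; lra.
Qed.

Lemma solve2 (c1 s1 c2 s2 : R) (g h : C) : c1 * s2 - s1 * c2 != 0 ->
  c1%:C * g + s1%:C * h = 0 -> c2%:C * g + s2%:C * h = 0 -> g = 0 /\ h = 0.
Proof.
case: g h => [g1 g2] [h1 h2] dn0 /eqP E1 /eqP E2.
move: E1 E2; rewrite !eq_complex /= !mul0r !subr0 !addr0.
move=> /andP[/eqP a1 /eqP a2] /andP[/eqP b1 /eqP b2].
have key (a b : R) : c1 * a + s1 * b = 0 -> c2 * a + s2 * b = 0 -> a = 0 /\ b = 0.
  move=> e1 e2; split; apply: (mulfI dn0); rewrite mulr0.
    by transitivity (s2 * (c1 * a + s1 * b) - s1 * (c2 * a + s2 * b)); [ring | rewrite e1 e2; ring].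
  by transitivity (c1 * (c2 * a + s2 * b) - c2 * (c1 * a + s1 * b)); [ring | rewrite e1 e2; ring].
by have [-> ->] := key _ _ a1 b1; have [-> ->] := key _ _ a2 b2.
Qed.

Lemma real_comb0 (a b c e : R) : a%:C * b%:C + c%:C * e%:C = 0 -> a * b + c * e = 0.
Proof. by move/(congr1 (@complex.Re R)); rewrite cReD !cReM /= !mul0r !subr0. Qed.

(** Both a + ib and c + ie have the same ratio to their conjugates, and that ratio determines the
    real line through the origin on which a complex number lies. *)
Lemma cross0 (mu nu : C) (a b c e : R) : (mu, nu) != (0, 0) ->
  mu * (a +i* b) = nu * (a -i* b) -> mu * (c +i* e) = nu * (c -i* e) -> a * e - b * c = 0.
Proof.
move=> mn0 r1 r2.
set p := a +i* b in r1 *; set p' := a -i* b in r1 *.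
set q := c +i* e in r2 *; set q' := c -i* e in r2 *.
have z0 : mu * (q * p' - p * q') = 0.
  transitivity (mu * q * p' - mu * p * q'); first by ring.
  by rewrite r1 r2; ring.
have z1 : nu * (q * p' - p * q') = 0.
  transitivity (nu * p' * q - nu * q' * p); first by ring.
  by rewrite -r1 -r2; ring.
have : q * p' - p * q' = 0.
  apply/eqP; apply: contraT => f0; move: mn0; rewrite xpair_eqE.
  move/eqP: z0; rewrite mulf_eq0 (negbTE f0) orbF => ->.
  by move/eqP: z1; rewrite mulf_eq0 (negbTE f0) orbF => ->.
by move/(congr1 (@complex.Im R)); rewrite cImD cImN !cImM /= => h; lra.
Qed.

Lemma form_H0 t (u v : 'cV[C]_n) : form (H0 t B D) u v =
  (cos t)%:C * form B u v + (sin t)%:C * form D u v.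
Proof. by rewrite /H0 formDl !formZl. Qed.

Lemma form0r (H : 'M[C]_n) u v : H *m v = 0 -> form H u v = 0.
Proof. by move=> Hv; rewrite /form -mulmxA Hv mulmx0 mxE. Qed.

Lemma form0l (H : 'M[C]_n) u v : H ^t* = H -> H *m u = 0 -> form H u v = 0.
Proof. by move=> hH Hu; rewrite -[form _ _ _]conjCK form_adj hH form0r // conjC0. Qed.

(** Since u and v are killed at different angles, the numbers <B v, u> and <D v, u> solve two
    homogeneous linear equations with determinant - sin(th_i - th_j), which is nonzero as both
    angles lie in [0, pi). *)
Lemma ker_orth i j u v : i != j -> H0 (th i) B D *m u = 0 -> H0 (th j) B D *m v = 0 ->
  form B u v = 0 /\ form D u v = 0.
Proof.
move=> ij Hu Hv.
have e1 : form (H0 (th i) B D) u v = 0 by apply: form0l => //; exact: H0_herm.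
have e2 : form (H0 (th j) B D) u v = 0 by exact: form0r.
rewrite !form_H0 in e1 e2; apply: solve2 e1 e2.
have -> : cos (th i) * sin (th j) - sin (th i) * cos (th j) = - sin (th i - th j).
  by rewrite sinB; ring.
by rewrite oppr_eq0 sin_diff_neq0.
Qed.

Let U i := kermx (H0 (th i) B D)^T.

Lemma ker_row i (r : 'rV[C]_n) : (r <= U i)%MS -> H0 (th i) B D *m r^T = 0.
Proof.
by move=> /sub_kermxP h; rewrite -[H0 _ _ _]trmxK -trmx_mul h trmx0.
Qed.

Lemma formDr (H : 'M[C]_n) u v w : form H u (v + w) = form H u v + form H u w.
Proof. by rewrite /form mulmxDr mxE. Qed.

Lemma form_sumr (H : 'M[C]_n) u (I : finType) (P : pred I) (F : I -> 'cV[C]_n) :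
  form H u (\sum_(i | P i) F i) = \sum_(i | P i) form H u (F i).
Proof.
apply: (big_morph (form H u)); first exact: formDr.
by rewrite /form mulmx0 mxE.
Qed.

Lemma form_sum_single (H : 'M[C]_n) u (F : 'I_k -> 'cV[C]_n) i :
  (forall j, i != j -> form H u (F j) = 0) -> form H u (\sum_j F j) = form H u (F i).
Proof.
move=> h; rewrite form_sumr (bigD1 i) //= big1 ?addr0 // => j ji.
by apply: h; rewrite eq_sym.
Qed.

Lemma sum_single (F : 'I_k -> 'cV[C]_n) i :
  (forall j, i != j -> F j = 0) -> \sum_j F j = F i.
Proof.
move=> h; rewrite (bigD1 i) //= big1 ?addr0 // => j ji.
by apply: h; rewrite eq_sym.
Qed.

(** A vector of one kernel that is a sum of vectors from the others is orthogonal to itself for X,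
    hence zero because the kernels contain no nonzero isotropic vector. *)
Lemma ker_direct : mxdirect (\sum_i U i)%MS.
Proof.
apply/mxdirect_sumsP => i _; apply/eqP/rowV0P => r.
rewrite sub_capmx => /andP[rU rS]; apply/eqP; apply: contraT => r0.
have v0 : r^T != 0 by rewrite -(inj_eq (@trmx_inj _ _ _)) trmxK trmx0.
have Hr := ker_row rU.
have : form X r^T r^T = 0.
  have /sub_sumsmxP [w wE] := rS.
  have E : r^T = \sum_(j | true && (j != i)) (w j *m U j)^T by rewrite {1}wE linear_sum.
  rewrite {2}E form_sumr big1 // => j ji.
  have Hw : H0 (th j) B D *m (w j *m U j)^T = 0 by apply: ker_row; rewrite submxMl.
  have ij : i != j by rewrite eq_sym.
  have [h1 h2] := ker_orth ij Hr Hw.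
  by rewrite /X formDl formZl h1 h2 mulr0 addr0.
by move/eqP; rewrite (negbTE (noniso v0 Hr)).
Qed.

Hypothesis dim_ge : (n <= \sum_i (n - \rank (H0 (th i) B D)))%N.

Lemma kernels_full (v : 'cV[C]_n) : exists w : 'I_k -> 'cV[C]_n,
  (forall i, H0 (th i) B D *m w i = 0) /\ v = \sum_i w i.
Proof.
have rk : \rank (\sum_i U i)%MS = (\sum_i \rank (U i))%N by apply/eqP; move/mxdirectP: ker_direct => /= ->.
have full : row_full (\sum_i U i)%MS.
  rewrite /row_full eqn_leq rank_leq_col /= rk.
  apply: (leq_trans dim_ge); apply: leq_sum => i _.
  by rewrite /U mxrank_ker mxrank_tr.
have /sub_sumsmxP [w wE] := submx_full v^T full.
exists (fun i => (w i *m U i)^T); split.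
  by move=> i; apply: ker_row; rewrite submxMl.
by rewrite -[LHS]trmxK wE linear_sum.
Qed.

Lemma adj_X : X ^t* = B + (0 +i* (-1)) *: D.
Proof.
rewrite /X adjD hB adjZ hD; congr (_ + _ *: _).
Qed.

(** Pairing the pencil relation with the component w_i gives mu (g_i + i h_i) = nu (g_i - i h_i),
    where (g_i, h_i) is a real multiple of (sin th_i, - cos th_i). A pair (mu, nu) fixes one real
    line, hence one angle: an eigenvector of the pencil has a single nonzero component and is not
    isotropic. *)
Lemma kernel_sum_good : good X.
Proof.
move=> v mu nu v0 mn0 E.
have [w [Hw vE]] := kernels_full v.
pose g i := complex.Re (form B (w i) (w i)); pose h i := complex.Re (form D (w i) (w i)).
have gE i : form B (w i) v = (g i)%:C.
  rewrite vE (form_sum_single (i := i)); first exact: herm_form.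
  by move=> j ij; have [h0 _] := ker_orth ij (Hw i) (Hw j).
have hE i : form D (w i) v = (h i)%:C.
  rewrite vE (form_sum_single (i := i)); first exact: herm_form.
  by move=> j ij; have [_ h0] := ker_orth ij (Hw i) (Hw j).
have rel i : mu * (g i +i* h i) = nu * (g i -i* h i).
  have F1 : form X (w i) v = g i +i* h i.
    by rewrite /X formDl formZl gE hE; apply: complexP; rewrite ?(cReD, cImD) ?(cReM, cImM) /=; ring.
  have F2 : form (X ^t*) (w i) v = g i -i* h i.
    by rewrite adj_X formDl formZl gE hE; apply: complexP; rewrite ?(cReD, cImD) ?(cReM, cImM) /=; ring.
  rewrite -F1 -F2 /form -!mulmxA -!mxZE (scalemxAr mu) (scalemxAr nu) E //.
have cs i : cos (th i) * g i + sin (th i) * h i = 0.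
  have e0 : form (H0 (th i) B D) (w i) v = 0 by exact: form0l (H0_herm (th i) hB hD) (Hw i).
  by rewrite form_H0 gE hE in e0; exact: real_comb0.
have gh i : w i != 0 -> g i +i* h i != 0.
  move=> wi; have := noniso wi (Hw i); rewrite /X formDl formZl (herm_form _ hB) (herm_form _ hD).
  by apply: contra => /eqP [g0 h0]; rewrite -/(g i) -/(h i) g0 h0 mulr0 addr0.
(* Two nonzero components would give parallel vectors (g, h), contradicting the nonvanishing sine of
   the difference of the angles. *)
have uniq i j : w i != 0 -> w j != 0 -> i = j.
  move=> wi wj; apply/eqP; apply: contraT => ij.
  have dij := sin_diff_neq0 ij.
  have gi := gh i wi; have gj := gh j wj.
  have dt : g i * h j - h i * g j = 0 := cross0 mn0 (rel i) (rel j).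
  have ci := cs i; have cj := cs j.
  (* (g, h) is a real multiple of (sin th, - cos th). *)
  have par a (p q t : R) : cos t * p + sin t * q = 0 -> a = cos t * q - sin t * p -> p = - sin t * a /\ q = cos t * a.
    move=> e1 e2; have e3 := cos2Dsin2 t; split; rewrite e2.
      transitivity (p * (cos t ^+ 2 + sin t ^+ 2) - cos t * (cos t * p + sin t * q)); last by ring.
      by rewrite e1 e3; ring.
    transitivity (q * (cos t ^+ 2 + sin t ^+ 2) - sin t * (cos t * p + sin t * q)); last by ring.
    by rewrite e1 e3; ring.
  have [p1 q1] := par _ _ _ _ ci erefl; have [p2 q2] := par _ _ _ _ cj erefl.
  set a := _ - _ in p1 q1; set b := _ - _ in p2 q2.
  have a0 : a != 0 by apply: contra gi => /eqP a0; rewrite p1 q1 a0 !mulr0.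
  have b0 : b != 0 by apply: contra gj => /eqP b0; rewrite p2 q2 b0 !mulr0.
  move/eqP: dt; rewrite p1 q1 p2 q2.
  have -> : - sin (th i) * a * (cos (th j) * b) - cos (th i) * a * (- sin (th j) * b) =
    - (a * b * sin (th i - th j)) by rewrite sinB; ring.
  by rewrite oppr_eq0 !mulf_eq0 (negbTE a0) (negbTE b0) (negbTE dij).
have [i wi] : exists i, w i != 0.
  apply/existsP; apply: contraR v0; rewrite negb_exists => /forallP H.
  rewrite vE; apply/eqP; apply: big1 => i _; apply/eqP/negPn; exact: H.
have vw : v = w i.
  rewrite vE; apply: sum_single => j ij; apply/eqP/negPn/negP => wj.
  by move/eqP: ij; apply; exact: uniq.
by rewrite vw; exact: noniso wi (Hw i).
Qed.

End KernelSum.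

(** * Continuity of real-analytic functions *)

Section RealAnalytic.
Variable R : realType.

(** Near x every term of the power series after the constant one contains a factor y - x, and the
    remaining series is bounded; this yields a Lipschitz bound at x. *)
Lemma real_analytic_continuous (f : R -> R) : real_analytic f -> continuous f.
Proof.
move=> af x; have [a [r [r0 H]]] := af x.
(* Convergence at distance r/2 gives absolute convergence at distance r/4. *)
pose K := r / 2; have K0 : 0 < K by rewrite divr_gt0.
have Kr : K < r by rewrite ltr_pdivrMr // ltr_pMr // ltr1n.
pose K2 := K / 2; have K20 : 0 < K2 by rewrite divr_gt0.
have K2K : K2 < K by rewrite ltr_pdivrMr // ltr_pMr // ltr1n.
have cK : cvgn (pseries a K).
  apply/cvg_ex; exists (f (x + K)).
  have := H (x + K); rewrite addrC addKr => h; apply: h.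
  by rewrite ger0_norm // ltW.
have cN : cvgn (pseries (fun i => `|a i|) K2).
  by apply: is_cvg_pseries_inside_norm cK _; rewrite !ger0_norm // ltW.
pose S := limn (pseries (fun i => `|a i|) K2).
have pS N : pseries (fun i => `|a i|) K2 N <= S.
  apply: nondecreasing_cvgn_le => //; apply: nondecreasing_series => i _ _.
  by rewrite mulr_ge0 // exprn_ge0 // ltW.
have S0 : 0 <= S by have := pS 0%N; rewrite /pseries /series /= big_geq.
have fx : f x = a 0%N.
  have := H x; rewrite subrr normr0 => /(_ r0) hx.
  have h1 : series (fun k => a k * 0 ^+ k) @ \oo --> a 0%N.
    rewrite -(cvg_shiftn 1) /=; apply: cvg_near_cst; near=> n.
    rewrite /series /= addn1 big_nat_recl //= expr0 mulr1 big1_seq ?addr0 // => i _.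
    by rewrite exprS mul0r mulr0.
  by apply: (cvg_unique _ hx h1).
have bnd y : `|y - x| < K2 -> `|f y - f x| <= `|y - x| / K2 * S.
  move=> yx; have yr : `|y - x| < r by rewrite (lt_trans yx) // (lt_trans K2K).
  have h1 : (series (fun k => a k * (y - x) ^+ k) N - a 0%N) @[N --> \oo] --> f y - f x.
    by rewrite fx; apply: cvgB; [exact: H | exact: cvg_cst].
  have h2 : `|series (fun k => a k * (y - x) ^+ k) N - a 0%N| @[N --> \oo] --> `|f y - f x|.
    exact: cvg_norm h1.
  apply: (@cvgr_to_le _ _ _ _ _ _ _ h2); exists 1%N => // N /= N1.
  have -> : series (fun k => a k * (y - x) ^+ k) N - a 0%N =
      \sum_(1 <= k < N) a k * (y - x) ^+ k.
    by rewrite /series /= big_ltn // expr0 mulr1 addrC addKr.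
  apply: (@le_trans _ _ (`|y - x| / K2 * \sum_(1 <= k < N) `|a k| * K2 ^+ k)).
    apply: (le_trans (ler_norm_sum _ _ _)); rewrite mulr_sumr big_nat [leRHS]big_nat.
    apply: ler_sum => -[//|k] _; rewrite normrM normrX exprS [K2 ^+ k.+1]exprS.
    have -> : `|y - x| / K2 * (`|a k.+1| * (K2 * K2 ^+ k)) = `|a k.+1| * (`|y - x| * K2 ^+ k).
      by field; rewrite lt0r_neq0.
    by rewrite ler_wpM2l // ler_wpM2l // lerXn2r ?nnegrE // ltW.
  apply: ler_wpM2l; first by rewrite divr_ge0 // ltW.
  refine (le_trans _ (pS N)).
  by rewrite /pseries /series /= [leRHS]big_ltn // lerDr mulr_ge0 // exprn_ge0 // ltW.
apply/cvgrPdist_le => /= e e0.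
pose S1 := S + 1; have S10 : 0 < S1 by rewrite ltr_wpDl.
near=> y.
have h1 : `|y - x| < K2 by rewrite distrC; near: y; exists K2.
have h2 : `|y - x| < e * K2 / S1.
  by rewrite distrC; near: y; exists (e * K2 / S1) => //=; rewrite divr_gt0 // mulr_gt0.
rewrite distrC; apply: (le_trans (bnd y h1)).
apply: (@le_trans _ _ (`|y - x| / K2 * S1)).
  by apply: ler_wpM2l; [rewrite divr_ge0 // ltW | rewrite lerDl].
rewrite mulrAC ler_pdivrMr //; move: h2; rewrite ltr_pdivlMr //.
exact: ltW.
Unshelve. all: by end_near. Qed.

End RealAnalytic.

(** * Algebraic and geometric multiplicity of Hermitian matrices *)

Section SpectralMultiplicity.
Variables (R : realType) (n : nat).
Local Notation C := R[i].

Lemma rank_diag_le (d : 'rV[C]_n) : (\rank (diag_mx d) <= #|[pred i | d 0%R i != 0%R]|)%N.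
Proof.
have -> : diag_mx d = \sum_i d 0 i *: delta_mx i i.
  apply/matrixP => i j; rewrite mxE summxE (bigD1 i) //= !mxE eqxx /= big1 ?addr0 => [|k ki].
    by rewrite eq_sym; case: eqP => _; rewrite ?mulr1 ?mulr0.
  by rewrite !mxE eq_sym (negbTE ki) mulr0.
have h : forall r : seq 'I_n, (\rank (\sum_(i <- r) d 0%R i *: (delta_mx i i : 'M[C]_n))%R <= \sum_(i <- r) (d 0%R i != 0%R))%N.
  elim=> [|i r ih]; first by rewrite !big_nil mxrank0.
  rewrite !big_cons; apply: leq_trans (mxrank_add _ _) _; apply: leq_add => //.
  have [->|di] := eqVneq (d 0 i) 0; first by rewrite scale0r mxrank0.
  by rewrite mxrank_scale_nz // mxrank_delta.
apply: leq_trans (h _) _.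
by rewrite -sum1_card [leqRHS]big_mkcond; apply: leq_sum => i _; rewrite inE; case: (d 0 i != 0).
Qed.

Lemma horner_char_poly (A : 'M[C]_n) x : (char_poly A).[x] = \det (x%:M - A).
Proof.
rewrite /char_poly -horner_evalE -det_map_mx; congr (\det _).
apply/matrixP => i j; rewrite !mxE /= horner_evalE hornerD hornerN hornerC.
by rewrite hornerMn hornerX.
Qed.

Lemma hermitian_diag (H : 'M[C]_n) : H ^t* = H ->
  exists (P : 'M[C]_n) (d : 'rV[C]_n), P \in unitmx /\ H = invmx P *m diag_mx d *m P.
Proof.
move=> hH; have : H \is normalmx by apply/normalmxP; rewrite hH.
move=> /orthomx_spectralP E; exists (spectralmx H), (spectral_diag H).
by split; [exact: spectral_unit | exact: E].
Qed.

Lemma shift_diag (H P : 'M[C]_n) (d : 'rV[C]_n) c : P \in unitmx ->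
  H = invmx P *m diag_mx d *m P ->
  c%:M - H = invmx P *m diag_mx (\row_i (c - d 0 i)) *m P.
Proof.
move=> uP ->.
have -> : diag_mx (\row_i (c - d 0 i)) = c%:M - diag_mx d.
  by apply/matrixP => i j; rewrite !mxE mulrnBl.
by rewrite mulmxBr mulmxBl mul_mx_scalar -scalemxAl mulVmx // scalemx1.
Qed.

Lemma poly_ext (p q : {poly C}) : (forall x, p.[x] = q.[x]) -> p = q.
Proof.
move=> pq; apply/eqP; rewrite -subr_eq0; apply/eqP.
pose rs := [seq (i%:R : C) | i <- iota 0 (size (p - q))].
apply: (@roots_geq_poly_eq0 _ _ rs); last by rewrite size_map size_iota.
  by apply/allP => x _; rewrite /root hornerD hornerN pq subrr.
rewrite map_inj_uniq ?iota_uniq // => a b /eqP; rewrite eqr_nat; exact: eqP.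
Qed.

Lemma det_shift (H P : 'M[C]_n) (d : 'rV[C]_n) c : P \in unitmx ->
  H = invmx P *m diag_mx d *m P -> \det (c%:M - H) = \prod_i (c - d 0 i).
Proof.
move=> uP E; rewrite (shift_diag c uP E) !det_mulmx mulrAC -det_mulmx mulVmx // det1 mul1r.
by rewrite det_diag; apply: eq_bigr => i _; rewrite mxE.
Qed.

Lemma char_poly_diag (H P : 'M[C]_n) (d : 'rV[C]_n) : P \in unitmx ->
  H = invmx P *m diag_mx d *m P ->
  char_poly H = \prod_i ('X - (d 0 i)%:P).
Proof.
move=> uP E; apply: poly_ext => x; rewrite horner_char_poly (det_shift x uP E).
by rewrite horner_prod; apply: eq_bigr => i _; rewrite hornerXsubC.
Qed.

Lemma mup_prodX (I : finType) (F : I -> C) (m : I -> nat) c :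
  mup c (\prod_i ('X - (F i)%:P) ^+ m i) = (\sum_(i | F i == c) m i)%N.
Proof.
have nz (r : seq I) : \prod_(i <- r) ('X - (F i)%:P) ^+ m i != 0.
  by rewrite prodf_seq_neq0; apply/allP => i _; rewrite expf_neq0 // polyXsubC_eq0.
elim: (index_enum I) => [|i r ih].
  by rewrite !big_nil mupNroot // root1.
rewrite !big_cons mupM ?nz ?expf_neq0 ?polyXsubC_eq0 // ih mup_XsubCX.
by case: eqP.
Qed.

Lemma mup_prod1 (d : 'rV[C]_n) c :
  mup c (\prod_i ('X - (d 0 i)%:P)) = #|[pred i | d 0 i == c]|.
Proof.
have := mup_prodX (fun i => d 0 i) (fun=> 1%N) c.
by rewrite sum1_card => <-; congr mup; apply: eq_bigr => i _; rewrite expr1.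
Qed.

(** By the spectral theorem both numbers are computed on a diagonal matrix, where the multiplicity
    of c counts the diagonal entries equal to c. *)
Lemma kernel_dim_ge (H : 'M[C]_n) c : H ^t* = H ->
  (mup c (char_poly H) <= n - \rank (c%:M - H)%R)%N.
Proof.
move=> /hermitian_diag [P [d [uP E]]].
rewrite (char_poly_diag uP E) mup_prod1 (shift_diag c uP E).
rewrite mxrankMfree ?row_free_unit // eqmxMfull ?row_full_unit ?unitmx_inv //.
have := rank_diag_le (\row_i (c - d 0 i)).
have := cardC [pred i | d 0 i == c]; rewrite card_ord => nE h.
rewrite leq_subRL ?rank_leq_col // -[leqRHS]nE addnC leq_add2l.
apply: leq_trans h _; apply: subset_leq_card. apply/fintype.subsetP => i.
by rewrite !inE mxE subr_eq0 eq_sym.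
Qed.

End SpectralMultiplicity.

(** * The pencil of A at a noncritical point *)

Section Lacuna.
Variables (R : realType) (n : nat) (A : 'M[R[i]]_n).
Local Notation C := R[i].

Lemma A1_herm : (A1 A) ^t* = A1 A.
Proof.
rewrite /A1 adjZ adjD adjK addrC; congr (_ *: _).
by apply/CrealP; rewrite rpredV realn.
Qed.

Lemma twoi_neq0 : (2 * (0 +i* 1) : C) != 0.
Proof. by rewrite mulf_neq0 ?pnatr_eq0 // eq_complex /= oner_eq0 andbF. Qed.

Lemma A2_herm : (A2 A) ^t* = A2 A.
Proof.
rewrite /A2 adjZ adjD adjN adjK -opprB scalerN -scaleNr; congr (_ *: _).
rewrite fmorphV -invrN rmorphM /=; congr (_^-1).
rewrite -mulrN; congr (_ * _); first by apply/CrealP; rewrite realn.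
by apply: complexP; rewrite ?cReN ?cImN ?cReJ ?cImJ /= ?oppr0 ?opprK.
Qed.

Lemma A1A2E : A = A1 A + (0 +i* 1) *: A2 A.
Proof.
rewrite /A1 /A2 scalerA invfM mulrCA mulfV ?mulr1; last first.
  by rewrite eq_complex /= oner_eq0 andbF.
rewrite -scalerDr.
have -> : A + A ^t* + (A - A ^t*) = 2%:R *: A.
  by rewrite addrACA subrr addr0 scaler_nat mulr2n.
by rewrite scalerA mulVf ?scale1r // pnatr_eq0.
Qed.

Lemma HmxE t : Hmx A t = H0 t (A1 A) (A2 A).
Proof.
have two : (2 : C) != 0 by rewrite pnatr_eq0.
have i0 : (0 +i* 1 : C) != 0 by rewrite eq_complex /= oner_eq0 andbF.
rewrite /Hmx /H0 /A1 /A2 !scalerDr !scalerN !scalerA addrACA -scalerBl -scalerDl.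
have key (x : C) : x * (2 * (0 +i* 1))^-1 = 2^-1 * (x * (0 +i* (-1))).
  rewrite invfM mulrCA; congr (_ * (_ * _)); apply: (mulIf i0); rewrite mulVf //.
  by apply: complexP; rewrite ?cReM ?cImM /=; ring.
congr (_ *: _ + _ *: _); rewrite key [(cos t)%:C * _]mulrC.
  by rewrite -mulrDr; congr (_ * _); apply: complexP; rewrite ?cReD ?cImD ?cReM ?cImM /expi /= ?cosN ?sinN; ring.
by rewrite -mulrBr; congr (_ * _); apply: complexP; rewrite ?cReD ?cImD ?cReN ?cImN ?cReM ?cImM /expi /=; ring.
Qed.

Lemma Hmx_herm t : (Hmx A t) ^t* = Hmx A t.
Proof. by rewrite HmxE; apply: H0_herm; [exact: A1_herm | exact: A2_herm]. Qed.

(** [Bz z] and [Dz z] are the Hermitian parts of z - A; see [Xz]. *)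
Definition Bz (z : C) : 'M[C]_n := (complex.Re z)%:C%:M - A1 A.
Definition Dz (z : C) : 'M[C]_n := (complex.Im z)%:C%:M - A2 A.

Lemma scalar_herm (c : R) : (c%:C%:M : 'M[C]_n) ^t* = c%:C%:M.
Proof. by rewrite adj_scalar [_^*]conjc_real. Qed.

Lemma Bz_herm z : (Bz z) ^t* = Bz z.
Proof. by rewrite /Bz adjD adjN A1_herm scalar_herm. Qed.
Lemma Dz_herm z : (Dz z) ^t* = Dz z.
Proof. by rewrite /Dz adjD adjN A2_herm scalar_herm. Qed.

Lemma Xz z : Bz z + (0 +i* 1) *: Dz z = z%:M - A.
Proof.
rewrite /Bz /Dz [in RHS]A1A2E scalerBr addrACA -opprD; congr (_ - _).
rewrite scale_scalar_mx -raddfD /=; congr (_%:M).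
by apply: complexP; rewrite ?cReD ?cImD ?cReM ?cImM /=; ring.
Qed.

Lemma Re_zexp (z : C) (t : R) : complex.Re (z * expi (- t)) = complex.Re z * cos t + complex.Im z * sin t.
Proof. by rewrite cReM /expi /= cosN sinN; ring. Qed.

(** Links tangent lines to kernels: [H0] at the angle t is singular exactly when Re(z e^{-it}) is an
    eigenvalue of H(t). *)
Lemma H0z (z : C) (t : R) : H0 t (Bz z) (Dz z) = (complex.Re (z * expi (- t)))%:C%:M - Hmx A t.
Proof.
rewrite HmxE /H0 /Bz /Dz !scalerBr addrACA -opprD; congr (_ - _).
rewrite Re_zexp !scale_scalar_mx -raddfD /=; congr (_%:M).
by apply: complexP; rewrite ?cReD ?cImD ?cReM ?cImM /=; ring.
Qed.

Lemma form_addl (H : 'M[C]_n) u v w : form H (u + v) w = form H u w + form H v w.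
Proof. by rewrite /form adjD !mulmxDl mxE. Qed.

Lemma form_scalel (H : 'M[C]_n) c u w : form H (c *: u) w = c^* * form H u w.
Proof. by rewrite /form adjZ -!scalemxAl mxZE. Qed.

Lemma form_scaler (H : 'M[C]_n) c u w : form H u (c *: w) = c * form H u w.
Proof. by rewrite /form -scalemxAr mxZE. Qed.

Lemma numerical_mapE (x y : 'cV[C]_n) (s : R) :
  numerical_map A (x + s%:C *: y) =
  form A x x + s%:C * (form A x y + form A y x) + (s ^+ 2)%:C * form A y y.
Proof.
rewrite -[LHS]/(form A _ _) form_addl !formDr !form_scalel !form_scaler.
rewrite [(s%:C)^*]conjc_real expr2 rmorphM /=.
move: (form A x x) (form A x y) (form A y x) (form A y y) (s%:C) => a b c d e; ring.
Qed.

Lemma derive_quad (a b c : R) :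
  derive1 (fun s : R => a + s * b + s ^+ 2 * c) 0 = b.
Proof.
rewrite derive1E.
have D := dD (dD (dcst a (0 : R) (1 : R)) (dM (is_derive_id (0 : R) (1 : R)) (dcst b _ _)))
  (dM (dX2 (is_derive_id (0 : R) (1 : R))) (dcst c _ _)).
have [_ ->] := D; ring.
Qed.

Lemma numerical_diffE (x y : 'cV[C]_n) :
  numerical_diff A x y = form A x y + form A y x.
Proof.
apply: complexP; rewrite /numerical_diff /=.
  rewrite (_ : (fun s : R => _) = (fun s : R => complex.Re (form A x x) +
     s * complex.Re (form A x y + form A y x) + s ^+ 2 * complex.Re (form A y y))).
    by rewrite derive_quad.
  apply/funext => s; rewrite numerical_mapE.
  move: (form A x x) (form A x y) (form A y x) (form A y y) => a b c d.
  by rewrite !cReD !cReM /= cReD; ring.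
rewrite (_ : (fun s : R => _) = (fun s : R => complex.Im (form A x x) +
     s * complex.Im (form A x y + form A y x) + s ^+ 2 * complex.Im (form A y y))).
  by rewrite derive_quad.
apply/funext => s; rewrite numerical_mapE.
move: (form A x x) (form A x y) (form A y x) (form A y y) => a b c d.
by rewrite !cImD !cImM /= cImD; ring.
Qed.

(** The left side of the hypothesis is a value of the differential of the numerical map. If it
    equals e^{it}, its component along e^{it} is 1, and that component is twice the real part in the
    conclusion. *)
Lemma expi_comb (p q : C) (t : R) : p + (0 +i* 1) * q + (p^* + (0 +i* 1) * q^*) = expi t ->
  complex.Re ((cos t)%:C * p + (sin t)%:C * q) != 0.
Proof.
case: p q => [p p'] [q q'] E.
have yr : p *+ 2 = cos t by have := congr1 (@complex.Re R) E; rewrite /expi /= => <-; ring.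
have yi : q *+ 2 = sin t by have := congr1 (@complex.Im R) E; rewrite /expi /= => <-; ring.
apply/negP => /eqP; rewrite /= => Re0.
have := cos2Dsin2 t.
have -> : cos t ^+ 2 + sin t ^+ 2 = 2 * (cos t * p - 0 * p' + (sin t * q - 0 * q')).
  by rewrite -yr -yi; ring.
by rewrite Re0 mulr0 => /eqP; rewrite eq_sym oner_eq0.
Qed.

(** An isotropic kernel vector, normalised to x, is mapped to z by the numerical map and is an
    eigenvector of H(t). For y tangent to the sphere at x, the component of the differential along
    e^{it} is 2 Re <H(t) y, x>, a multiple of Re <y, x> = 0. The differential is then not onto and z
    is critical. *)
Lemma noncritical_form z t (v : 'cV[C]_n) : ~ Sigma_A A z -> v != 0 ->
  H0 t (Bz z) (Dz z) *m v = 0 -> form (Bz z + (0 +i* 1) *: Dz z) v v != 0.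
Proof.
move=> nS v0 Hv; apply/eqP => f0; apply: nS.
have [c c0 x1] := nsq_normalize v0; set x := c%:C *: v in x1.
have Hx : H0 t (Bz z) (Dz z) *m x = 0 by rewrite /x -scalemxAr Hv scaler0.
have fx : form (z%:M - A) x x = 0 by rewrite -Xz formZ f0 mulr0.
have xx : (x ^t* *m x) 0 0 = 1 by rewrite nsq_C x1.
exists x; last first.
  move: fx; rewrite formDl formNl form_scalar x1 mulr1 => /eqP.
  by rewrite subr_eq0 => /eqP.
split=> //; apply/eqP => E.
(* The value e^{it} is the one that the differential cannot take. *)
have [y Ty yE] : (numerical_diff A x @` @sphere_tangent R n x) (expi t) by rewrite E.
have h1 := A1_herm; have h2 := A2_herm.
have e1 u w : form A u w = form (A1 A) u w + (0 +i* 1) * form (A2 A) u w.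
  by rewrite {1}A1A2E formDl formZl.
have Ty' : complex.Re ((x ^t* *m y) 0 0) = 0 := Ty.
rewrite numerical_diffE !e1 in yE.
have s1 : form (A1 A) y x = (form (A1 A) x y)^* by rewrite form_adj h1.
have s2 : form (A2 A) y x = (form (A2 A) x y)^* by rewrite form_adj h2.
rewrite s1 s2 in yE.
have fH : form (Hmx A t) x y = (complex.Re (z * expi (- t)))%:C * (x ^t* *m y) 0 0.
  have Hx' : Hmx A t *m x = (complex.Re (z * expi (- t)))%:C *: x.
    by apply/esym/eqP; rewrite -subr_eq0 -mul_scalar_mx -mulmxBl -H0z Hx.
  by rewrite /form -{1}(Hmx_herm t) -adjM Hx' adjZ [(_%:C)^*]conjc_real -scalemxAl mxZE.
have Re0 : complex.Re (form (Hmx A t) x y) = 0.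
  rewrite fH; move: (complex.Re (z * _)) => lam.
  by rewrite cReM Ty' mulr0 mul0r subr0.
have fE : form (Hmx A t) x y = (cos t)%:C * form (A1 A) x y + (sin t)%:C * form (A2 A) x y.
  by rewrite HmxE form_H0.
by move/eqP: (expi_comb yE); apply; rewrite -fE.
Qed.

End Lacuna.

(** If f(t) were nonzero, f would be nonzero on an interval around t, and that interval would be
    contained in S. *)
Lemma locally_finite_zero (R : realType) (S : set R) (f : R -> R) : continuous f ->
  (forall a b : R, finite_set (S `&` [set` `[a, b]])) ->
  (forall t, ~ S t -> f t = 0) -> forall t, f t = 0.
Proof.
move=> cf fS f0 t; apply/eqP; apply: contraT => ft.
have : \forall s \near t, f s != 0.
  exact: (cf t (fun y => y != 0) (open_nbhs_nbhs (conj (@open_neq _ 0) ft))).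
move=> [r /= r0 H].
have K s : `|t - s| < r -> S s.
  by move=> /H /negP fs; apply: contrapT => /f0 E; apply: fs; rewrite E.
have fin := fS t (t + r / 2); exfalso; apply: infinite_nat.
(* Infinitely many distinct points of S in one compact interval. *)
pose g (k : nat) := t + r / 2 / k.+1%:R.
have r2 : 0 < r / 2 by rewrite divr_gt0.
have gb k : t <= g k <= t + r / 2.
  rewrite /g lerDl lerD2l; apply/andP; split; first by rewrite divr_ge0 // ltW.
  by rewrite ler_pdivrMr ?ltr0n // ler_pMr // ler1n.
have -> : [set: nat] = g @^-1` (S `&` [set` `[t, t + r / 2]]).
  apply/seteqP; split=> // k _; split; last by rewrite /= in_itv /= gb.
  apply: K; have /andP[a b] := gb k.
  by rewrite distrC ger0_norm ?subr_ge0 //; move: a b; lra.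
apply: finite_preimage fin => i j _ _ /addrI /(mulfI (lt0r_neq0 r2)) /invr_inj /eqP.
by rewrite eqr_nat => /eqP [].
Qed.

(** * Counting tangent lines with multiplicity *)

Section Branches.
Variables (R : realType) (n : nat) (A : 'M[R[i]]_n).
Variables (m : nat) (lambda : 'I_m -> R -> R) (mult : 'I_m -> nat).
Hypothesis Hlambda : eigenvalue_branches A lambda mult.
Local Notation C := R[i].

Let branch_poly t : {poly C} := \prod_j ('X - (lambda j t)%:C%:P) ^+ mult j.

(** When the branches are distinct at t, each eigenvalue of the diagonalised matrix belongs to
    exactly one branch; grouping the linear factors by branch gives the exponents [mult j]. *)
Lemma char_poly_generic t : injective (fun j => lambda j t) ->
  (forall j, mup (lambda j t)%:C (char_poly (Hmx A t)) = mult j) ->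
  char_poly (Hmx A t) = branch_poly t.
Proof.
move=> linj lmup; have [_ _ eig _] := Hlambda.
have [P [d [uP E]]] := hermitian_diag (Hmx_herm A t).
have cp := char_poly_diag uP E.
have dl i : exists j, d 0 i == (lambda j t)%:C.
  have : eigenvalue (Hmx A t) (d 0 i).
    rewrite eigenvalue_root_char cp /root horner_prod (bigD1 i) //=.
    by rewrite hornerXsubC subrr mul0r.
  by move=> /eig [j ->]; exists j.
pose p i := xchoose (dl i).
have pE i : d 0 i = (lambda (p i) t)%:C by exact/eqP/(xchooseP (dl i)).
have pP i j : (p i == j) = (d 0 i == (lambda j t)%:C).
  by rewrite pE; apply/eqP/eqP => [-> //|[] /linj].
rewrite cp (partition_big p xpredT) //=; apply: eq_bigr => j _.
rewrite (eq_bigr (fun=> 'X - (lambda j t)%:C%:P)); last by move=> i /eqP <-; rewrite pE.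
rewrite prodr_const; congr (_ ^+ _).
rewrite -(lmup j) cp mup_prod1; apply: eq_card => i.
exact: pP.
Qed.

(** At every point x both polynomials are continuous in t and agree off the locally finite
    exceptional set, hence everywhere, including at crossings. *)
Lemma char_poly_branches t : char_poly (Hmx A t) = branch_poly t.
Proof.
have [_ lan _ [S [fS HS]]] := Hlambda.
apply: poly_ext => x; apply/eqP; rewrite -subr_eq0; apply/eqP.
pose F t := (char_poly (Hmx A t)).[x] - (branch_poly t).[x].
have cF : forall u, ccont u F.
  move=> u; apply: ccontB.
    apply: (@eq_ccont _ _ _ (fun t => \det (x%:M - H0 t (A1 A) (A2 A)))).
      by move=> s; rewrite horner_char_poly HmxE.
    apply: ccont_det => i j; apply: mcontB; first exact: mcont_cst.
    apply: mcontD; (apply: mcontZ; last exact: mcont_cst); apply: ccont_real.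
      exact: continuous_cos.
    exact: continuous_sin.
  apply: (@eq_ccont _ _ _ (fun t => \prod_j \prod_(k < mult j) (x - (lambda j t)%:C))).
    move=> s; rewrite horner_prod; apply: eq_bigr => j _.
    by rewrite horner_exp hornerXsubC prodr_const card_ord.
  apply: ccont_prod => j; apply: ccont_prod => k; apply: ccontB; first exact: ccont_cst.
  by apply: ccont_real; exact: real_analytic_continuous.
have F0 s : ~ S s -> F s = 0.
  by move=> /HS [h1 h2]; rewrite /F char_poly_generic // subrr.
rewrite -[LHS]/(F t); apply: complexP.
  apply: (@locally_finite_zero _ S (fun t => complex.Re (F t))) => //; first by move=> u; case: (cF u).
  by move=> s /F0 ->.
apply: (@locally_finite_zero _ S (fun t => complex.Im (F t))) => //; first by move=> u; case: (cF u).
by move=> s /F0 ->.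
Qed.

(** Branches that meet at c add their multiplicities in the characteristic polynomial, and for a
    Hermitian matrix the kernel is at least that large. *)
Lemma branch_rank t (c : R) :
  (\sum_(j | lambda j t == c) mult j <= n - \rank (c%:C%:M - Hmx A t)%R)%N.
Proof.
apply: leq_trans (kernel_dim_ge c%:C (Hmx_herm A t)).
rewrite char_poly_branches mup_prodX leq_eqVlt; apply/orP; left; apply/eqP.
by apply: eq_bigl => j; apply/eqP/eqP => [-> //|[]].
Qed.

(** The sum defining N(z) runs over branches, then angles; reversed, each angle contributes at most
    the dimension of its kernel. So N(z) = n makes the kernels at the distinct angles fill C^n, as
    [kernel_sum_good] demands. *)
Lemma lacuna_good z : Pi_A A lambda mult z -> good (z%:M - A).
Proof.
move=> [nS cnt]; rewrite -Xz.
pose lev t := complex.Re (z * expi (- t)).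
pose T j := [set t : R | 0 <= t < pi /\ lambda j t = lev t].
(* An infinite [T j] has an empty [fset_set], so membership implies [T j t] in either case. *)
have TP j t : t \in fset_set (T j) -> T j t.
  case: (pselect (finite_set (T j))) => fT; first by rewrite in_fset_set // => /set_mem.
  by rewrite /fset_set; case: pselect.
(* Several branches may pass through z at the same angle; the list keeps each angle once so that
   [th] is injective. *)
pose ths := undup (flatten [seq enum_fset (fset_set (T j)) | j <- enum 'I_m]).
have thsP t : reflect (exists j, t \in fset_set (T j)) (t \in ths).
  rewrite mem_undup; apply: (iffP flatten_mapP) => [[j _ h]|[j h]]; first by exists j.
  by exists j => //; rewrite mem_enum.
pose th (i : 'I_(size ths)) := nth 0 ths i.
have th_mem i : th i \in ths by exact: mem_nth.
apply: (@kernel_sum_good R n (size ths) (Bz A z) (Dz A z) th).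
- exact: Bz_herm.
- exact: Dz_herm.
- by move=> i j /eqP; rewrite nth_uniq ?undup_uniq // => /eqP /val_inj.
- by move=> i; have /thsP [j /TP []] := th_mem i.
- by move=> i v v0 Hv; exact: noncritical_form nS v0 Hv.
rewrite -{1}cnt /tangent_count.
apply: (@leq_trans (\sum_(j < m) \sum_(i < size ths | th i \in fset_set (T j)) mult j)).
  apply: leq_sum => j _; rewrite sum_nat_const mulnC leq_mul2r; apply/orP; right.
  rewrite -sum1_card -(big_mkord (fun i => nth 0 ths i \in fset_set (T j)) (fun=> 1%N)).
  rewrite -(big_nth 0 (fun x => x \in fset_set (T j)) (fun=> 1%N)) sum1_count -size_filter.
  apply: uniq_leq_size; first exact: fset_uniq.
  by move=> x h; rewrite mem_filter h; apply/thsP; exists j.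
rewrite (exchange_big_dep xpredT) //=; apply: leq_sum => i _.
rewrite H0z; apply: leq_trans (branch_rank _ _).
rewrite [leqRHS]big_mkcond [leqLHS]big_mkcond /=; apply: leq_sum => j _.
by case: ifP => // /TP [_ ->]; rewrite eqxx.
Qed.

End Branches.

Lemma cts_pairing (T U W : topologicalType) (f : T -> U) (g : T -> W) x :
  {for x, continuous f} -> {for x, continuous g} ->
  {for x, continuous (fun y => (f y, g y))}.
Proof. exact: cvg_pair. Qed.

(** * Directional derivatives as derivatives along lines *)

Section DirectionalDerivative.
Variables (R : realType) (V : normedModType R).
Implicit Types (f : V -> R) (v p : V).

Lemma line_quotient f v p (w : R) :
  (fun h : R => h^-1 *: (f ((h *: (1 : R) + w) *: v + p) - f (w *: v + p))) =
  (fun h : R => h^-1 *: (f (h *: v + (w *: v + p)) - f (w *: v + p))).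
Proof. by apply/funext => h; rewrite [h *: 1]mulr1 scalerDl addrA. Qed.

Lemma is_derive_line f v p (w df : R) : is_derive (w *: v + p) v f df ->
  is_derive w (1 : R) (fun h => f (h *: v + p)) df.
Proof.
move=> [D E]; split; first by move: D; rewrite /derivable -line_quotient.
by rewrite -E /derive -line_quotient.
Qed.

Lemma line_is_derive f v p (df : R) :
  is_derive (0 : R) (1 : R) (fun h => f (h *: v + p)) df -> is_derive p v f df.
Proof.
have L := line_quotient f v p 0; rewrite scale0r add0r in L.
move=> [D E]; split; first by move: D; rewrite /derivable /= scale0r add0r L.
by rewrite -E /derive /= scale0r add0r L.
Qed.

Lemma is_derive_shift f v p q (df : R) : is_derive (p + q) v f df ->
  is_derive p v (fun x => f (x + q)) df.
Proof.
move=> D; apply: line_is_derive.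
under eq_fun do rewrite -addrA.
by apply: is_derive_line; rewrite scale0r add0r.
Qed.

End DirectionalDerivative.

(** * Smooth families of functions and their integrals over a parameter *)

Section SmoothFamily.
Variable R : realType.
Local Notation V := (spacetime R).

(** Each iterated partial derivative is continuous jointly in the parameter and the point, so that
    integrating over the parameter gives a smooth function with derivatives taken under the
    integral. *)
Definition smooth_fam (Z : topologicalType) (F : Z -> V -> R) :=
  forall s, continuous (fun zp : Z * V => pds s (F zp.1) zp.2) /\
    forall z p k, derivable (pds s (F z)) p (axis R k).

Lemma smooth_fam_reparam (Z Z' : topologicalType) (phi : Z' -> Z) (F : Z -> V -> R) :
  continuous phi -> smooth_fam F -> smooth_fam (fun z => F (phi z)).
Proof.
move=> cphi sF s; have [cF dF] := sF s; split; last by move=> z; exact: dF.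
move=> zp; apply: (@continuous_comp _ _ _ (fun zp : Z' * V => (phi zp.1, zp.2))
  (fun zp : Z * V => pds s (F zp.1) zp.2)); last exact: cF.
apply: cts_pairing; last exact: cvg_snd.
by apply: (@continuous_comp _ _ _ fst phi); [exact: cvg_fst | exact: cphi].
Qed.

Lemma smooth_fam_slice (Z : topologicalType) (F : Z -> V -> R) z : smooth_fam F ->
  smooth_on setT (F z).
Proof.
move=> sF s p _; have [cF dF] := sF s; split=> //.
apply: (@continuous_comp _ _ _ (fun p => (z, p)) (fun zp : Z * V => pds s (F zp.1) zp.2) p).
  by apply: cts_pairing; [exact: cvg_cst | exact: cvg_id].
exact: cF.
Qed.

Lemma smooth_cts s (f : V -> R) : smooth_on setT f -> continuous (pds s f).
Proof. by move=> sf p; have [] := sf s p I. Qed.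

Lemma smooth_derive s (f : V -> R) p k : smooth_on setT f ->
  is_derive p (axis R k) (pds s f) (pds (k :: s) f p).
Proof. by move=> sf; have [_ /(_ k) d] := sf s p I; exact: derivableP. Qed.

Lemma pds_translate_scale (f : V -> R) (q : V) (c : R) s : smooth_on setT f ->
  pds s (fun p => f (p + q) * c) = (fun p => pds s f (p + q) * c).
Proof.
move=> sf; elim: s => [//|k s ih].
rewrite /= -/(pds s _) ih; apply/funext => p; rewrite /pd.
have D := dM (is_derive_shift (smooth_derive s (p + q) k sf)) (dcst c p (axis R k)).
by have [_ ->] := D; rewrite mulr0 addr0.
Qed.

(** All derivatives in p fall on the translate of [f], so continuity of [k] suffices. *)
Lemma smooth_fam_conv (f k : V -> R) : smooth_on setT f -> continuous k ->
  smooth_fam (fun q p => f (p + q) * k q).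
Proof.
move=> sf ck s; split=> [zp|z p j]; last first.
  rewrite pds_translate_scale //.
  by have [] := dM (is_derive_shift (smooth_derive s (p + z) j sf)) (dcst (k z) p (axis R j)).
rewrite (_ : (fun zp => _) = (fun zp : V * V => pds s f (zp.2 + zp.1) * k zp.1)); last first.
  by apply/funext => y; rewrite pds_translate_scale.
apply: cvgM; last by apply: (@continuous_comp _ _ _ fst k); [exact: cvg_fst | exact: ck].
apply: (@continuous_comp _ _ _ (fun zp : V * V => zp.2 + zp.1) (pds s f)).
  by apply: cvgD; [exact: cvg_snd | exact: cvg_fst].
exact: smooth_cts.
Qed.

Section FamilyIntegral.
Variables (Z : topologicalType) (F : Z * R -> V -> R) (a b : R).
Hypotheses (ab : a <= b) (sF : smooth_fam F).

Lemma fam_cts z p s : continuous (fun r => pds s (F (z, r)) p).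
Proof.
move=> r; apply: (@continuous_comp _ _ _ (fun r => ((z, r), p))
  (fun zp : (Z * R) * V => pds s (F zp.1) zp.2)); last by have [cF _] := sF s; exact: cF.
apply: cts_pairing; last exact: cvg_cst.
by apply: cts_pairing; [exact: cvg_cst | exact: cvg_id].
Qed.

Lemma fam_RI_derive z p k s :
  is_derive p (axis R k) (fun p => RI a b (fun r => pds s (F (z, r)) p))
    (RI a b (fun r => pds (k :: s) (F (z, r)) p)).
Proof.
apply: line_is_derive.
have E : RI a b (fun r => pds (k :: s) (F (z, r)) p) =
  RI a b (fun r => pds (k :: s) (F (z, r)) (0 *: axis R k + p)) by rewrite scale0r add0r.
rewrite E.
apply: (@RI_derive _ (fun w r => pds s (F (z, r)) (w *: axis R k + p))
  (fun w r => pds (k :: s) (F (z, r)) (w *: axis R k + p))).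
- exact: ab.
- by apply: filterE => w x _; exact: fam_cts.
- apply: filterE => w x _; apply: is_derive_line.
  by have [_ d] := sF s; exact: derivableP (d _ _ _).
- move=> x _; apply: (@continuous_comp _ _ _ (fun w : R * R => ((z, w.2), w.1 *: axis R k + p))
    (fun zp : (Z * R) * V => pds (k :: s) (F zp.1) zp.2)); last by have [cF _] := sF (k :: s); exact: cF.
  apply: cts_pairing; first by apply: cts_pairing; [exact: cvg_cst | exact: cvg_snd].
  by apply: cvgD; [apply: cvgZr_tmp; exact: cvg_fst | exact: cvg_cst].
- by move=> x _; exact: fam_cts.
Qed.

Lemma pds_fam_RI z s : pds s (fun p => RI a b (fun r => F (z, r) p)) =
  (fun p => RI a b (fun r => pds s (F (z, r)) p)).
Proof.
elim: s => [//|k s ih]; rewrite /= -/(pds s _) ih; apply/funext => p.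
by have [_ E] := fam_RI_derive z p k s; exact: E.
Qed.

Lemma smooth_fam_RI : smooth_fam (fun z p => RI a b (fun r => F (z, r) p)).
Proof.
move=> s; split; last first.
  by move=> z p k; rewrite pds_fam_RI; have [] := fam_RI_derive z p k s.
rewrite (_ : (fun zp => _) = (fun zp : Z * V => RI a b (fun r => pds s (F (zp.1, r)) zp.2))); last first.
  by apply/funext => zp; rewrite pds_fam_RI.
apply: (@RI_continuous _ _ (fun (zp : Z * V) r => pds s (F (zp.1, r)) zp.2)) => // y.
apply: (@continuous_comp _ _ _ (fun w : (Z * V) * R => ((w.1.1, w.2), w.1.2))
    (fun zp : (Z * R) * V => pds s (F zp.1) zp.2)); last by have [cF _] := sF s; exact: cF.
have h1 : {for y, continuous (fun z : (Z * V) * R => z.1)} by exact: cvg_fst.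
have h2 : {for y, continuous (fun z : (Z * V) * R => z.2)} by exact: cvg_snd.
exact: (cts_pairing (cts_pairing (cts_fstc h1) h2) (cts_sndc h1)).
Qed.

End FamilyIntegral.

Definition I2 (a b c d : R) (g : R * R -> R) : R :=
  RI a b (fun x => RI c d (fun y => g (x, y))).

Lemma smooth_fam_I2 (F : R * R -> V -> R) a b c d : a <= b -> c <= d -> smooth_fam F ->
  smooth_on setT (fun p => I2 a b c d (F ^~ p)) /\
  forall s, pds s (fun p => I2 a b c d (F ^~ p)) =
    (fun p => I2 a b c d (fun y => pds s (F y) p)).
Proof.
move=> ab cd sF.
(* The first component of the parameter is a dummy: it turns both integrations into instances of the
   one-parameter lemma and is set to 0 at the end. *)
pose F1 (z : (R * R) * R) := F (z.1.2, z.2).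
have sF1 : smooth_fam F1.
  refine (smooth_fam_reparam (phi := fun z : (R * R) * R => (z.1.2, z.2)) _ sF) => z.
  have h1 : {for z, continuous (fun z : (R * R) * R => z.1)} by exact: cvg_fst.
  have h2 : {for z, continuous (fun z : (R * R) * R => z.2)} by exact: cvg_snd.
  exact: (cts_pairing (cts_sndc h1) h2).
have s2 := smooth_fam_RI cd sF1; have s3 := smooth_fam_RI ab s2.
split; first exact: (smooth_fam_slice 0 s3).
move=> s; rewrite -[LHS]/(pds s (fun p => RI a b (fun r =>
   (fun z p => RI c d (fun r => F1 (z, r) p)) (0, r) p))).
rewrite (pds_fam_RI ab s2); apply/funext => p.
by apply: eq_RI => x _; rewrite (pds_fam_RI cd sF1).
Qed.

Definition I3 (T B : R) (g : V -> R) : R :=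
  RI 0 T (fun t => I2 (- B) B (- B) B (fun y => g (t, y))).

Lemma smooth_fam_I3 (F : V -> V -> R) T B : 0 <= T -> 0 <= B -> smooth_fam F ->
  smooth_on setT (fun p => I3 T B (F ^~ p)) /\
  forall s, pds s (fun p => I3 T B (F ^~ p)) =
    (fun p => I3 T B (fun y => pds s (F y) p)).
Proof.
move=> T0 B0 sF; have BB : - B <= B by lra.
pose F1 (z : ((R * R) * R) * R) := F (z.1.1.2, (z.1.2, z.2)).
have sF1 : smooth_fam F1.
  refine (smooth_fam_reparam (phi := fun z : ((R * R) * R) * R => (z.1.1.2, (z.1.2, z.2))) _ sF) => z.
  have h1 : {for z, continuous (fun z : ((R * R) * R) * R => z.1)} by exact: cvg_fst.
  have h2 : {for z, continuous (fun z : ((R * R) * R) * R => z.2)} by exact: cvg_snd.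
  exact: (cts_pairing (cts_sndc (cts_fstc h1)) (cts_pairing (cts_sndc h1) h2)).
have s2 := smooth_fam_RI BB sF1; have s3 := smooth_fam_RI BB s2.
have s4 := smooth_fam_RI T0 s3.
split; first exact: (smooth_fam_slice 0 s4).
move=> s; rewrite -[LHS]/(pds s (fun p => RI 0 T (fun r =>
   (fun z p => RI (- B) B (fun r => (fun z p => RI (- B) B (fun r => F1 (z, r) p)) (z, r) p)) (0, r) p))).
rewrite (pds_fam_RI T0 s3); apply/funext => p.
apply: eq_RI => x _; rewrite (pds_fam_RI BB s2).
by apply: eq_RI => y _; rewrite (pds_fam_RI BB sF1).
Qed.

End SmoothFamily.

(** * Iterated integrals over boxes and the divergence theorem *)

Section IteratedIntegrals.
Variable R : realType.
Local Notation V := (spacetime R).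
Implicit Types (a b c d T B r M : R).

Lemma axis_line0 (t : R) (y : R * R) : t *: axis R 0 + (0, y) = (t, y).
Proof.
by case: y => y1 y2; congr (_, (_, _)); rewrite /= ?scaler0 ?add0r ?addr0 // [_ *: _]mulr1.
Qed.

Lemma axis_line1 (t x y : R) : x *: axis R 1 + (t, (0, y)) = (t, (x, y)).
Proof.
by congr (_, (_, _)); rewrite /= ?scaler0 ?add0r ?addr0 // [_ *: _]mulr1.
Qed.

Lemma axis_line2 (t x y : R) : y *: axis R 2%R + (t, (x, 0)) = (t, (x, y)).
Proof.
by congr (_, (_, _)); rewrite /= ?scaler0 ?add0r ?addr0 // [_ *: _]mulr1.
Qed.

Section Slices.
Variables (W : topologicalType) (g : W * R -> R).
Hypothesis cg : continuous g.

Lemma cts_slice w : continuous (fun x => g (w, x)).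
Proof.
move=> x; apply: (@continuous_comp _ _ _ (fun x => (w, x)) g); last exact: cg.
by apply: cts_pairing; [exact: cvg_cst | exact: cvg_id].
Qed.

Lemma cts_RI a b : a <= b -> continuous (fun w => RI a b (fun x => g (w, x))).
Proof.
move=> ab; apply: (RI_continuous (h := fun w x => g (w, x))) => //.
by rewrite (_ : (fun z => _) = g) //; apply/funext => -[].
Qed.

End Slices.

Lemma conton_slice (W : topologicalType) (g : W * R -> R) w a b : continuous g ->
  conton a b (fun x => g (w, x)).
Proof. by move=> cg x _; exact: cts_slice. Qed.

Lemma cts_I2_inner (g : R * R -> R) a b c d : c <= d -> continuous g ->
  conton a b (fun x => RI c d (fun y => g (x, y))).
Proof. by move=> cd cg x _; exact: (cts_RI cg cd). Qed.

Lemma eq_I2 a b c d (f g : R * R -> R) :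
  (forall x y, a <= x <= b -> c <= y <= d -> f (x, y) = g (x, y)) ->
  I2 a b c d f = I2 a b c d g.
Proof. by move=> fg; apply: eq_RI => x xI; apply: eq_RI => y; exact: fg. Qed.

Lemma I2D a b c d (f g : R * R -> R) : c <= d -> continuous f -> continuous g ->
  I2 a b c d (fun z => f z + g z) = I2 a b c d f + I2 a b c d g.
Proof.
move=> cd cf cg; rewrite /I2 -RID; try exact: cts_I2_inner.
by apply: eq_RI => x _; rewrite RID //; exact: conton_slice.
Qed.

Lemma I2Z a b c d r (f : R * R -> R) : c <= d -> continuous f ->
  I2 a b c d (fun z => r * f z) = r * I2 a b c d f.
Proof.
move=> cd cf; rewrite /I2 -RIZ; last exact: cts_I2_inner.
by apply: eq_RI => x _; rewrite RIZ //; exact: conton_slice.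
Qed.

Lemma I2_bound a b c d (f : R * R -> R) M : a <= b -> c <= d -> continuous f ->
  (forall x y, a <= x <= b -> c <= y <= d -> `|f (x, y)| <= M) ->
  `|I2 a b c d f| <= M * (d - c) * (b - a).
Proof.
move=> ab cd cf fM; apply: RI_bound => //; first exact: cts_I2_inner.
move=> x xI; apply: RI_bound => //; first exact: conton_slice.
by move=> y; exact: fM.
Qed.

Lemma le_I2 a b c d (f g : R * R -> R) : c <= d -> continuous f -> continuous g ->
  (forall x y, a <= x <= b -> c <= y <= d -> f (x, y) <= g (x, y)) ->
  I2 a b c d f <= I2 a b c d g.
Proof.
move=> cd cf cg fg; apply: le_RI; try exact: cts_I2_inner.
by move=> x xI; apply: le_RI; try exact: conton_slice; move=> y; exact: fg.
Qed.

Definition assoc3 (z : (R * R) * R) : V := (z.1.1, (z.1.2, z.2)).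

Lemma cts_assoc3 (f : V -> R) : continuous f -> continuous (f \o assoc3).
Proof.
move=> cf z; apply: continuous_comp; last exact: cf.
have h1 : {for z, continuous (fun z : (R * R) * R => z.1)} by exact: cvg_fst.
have h2 : {for z, continuous (fun z : (R * R) * R => z.2)} by exact: cvg_snd.
exact: (cts_pairing (cts_fstc h1) (cts_pairing (cts_sndc h1) h2)).
Qed.

Lemma cts_time (f : V -> R) t : continuous f -> continuous (fun y => f (t, y)).
Proof.
move=> cf y; apply: (@continuous_comp _ _ _ (fun y => (t, y)) f); last exact: cf.
by apply: cts_pairing; [exact: cvg_cst | exact: cvg_id].
Qed.

Lemma cts_I3_inner (f : V -> R) a b B : 0 <= B -> continuous f ->
  conton a b (fun t => I2 (- B) B (- B) B (fun y => f (t, y))).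
Proof.
move=> B0 cf t _; have BB : - B <= B by lra.
have c1 := cts_RI (cts_assoc3 cf) BB.
exact: (cts_RI (g := fun z => RI (- B) B (fun y => (f \o assoc3) (z, y))) c1 BB).
Qed.

Lemma eq_I3 T B (f g : V -> R) :
  (forall t x y, 0 <= t <= T -> - B <= x <= B -> - B <= y <= B -> f (t, (x, y)) = g (t, (x, y))) ->
  I3 T B f = I3 T B g.
Proof. by move=> fg; apply: eq_RI => t tI; apply: eq_I2 => x y; exact: fg. Qed.

Lemma I3D T B (f g : V -> R) : 0 <= B -> continuous f -> continuous g ->
  I3 T B (fun z => f z + g z) = I3 T B f + I3 T B g.
Proof.
move=> B0 cf cg; have BB : - B <= B by lra.
rewrite /I3 -RID; try exact: cts_I3_inner.
by apply: eq_RI => x _; apply: I2D => //; exact: cts_time.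
Qed.

Lemma I3Z T B r (f : V -> R) : 0 <= B -> continuous f ->
  I3 T B (fun z => r * f z) = r * I3 T B f.
Proof.
move=> B0 cf; have BB : - B <= B by lra.
rewrite /I3 -RIZ; last exact: cts_I3_inner.
by apply: eq_RI => x _; apply: I2Z => //; exact: cts_time.
Qed.

Lemma I3_bound T B (f : V -> R) M : 0 <= T -> 0 <= B -> continuous f ->
  (forall t x y, 0 <= t <= T -> - B <= x <= B -> - B <= y <= B -> `|f (t, (x, y))| <= M) ->
  `|I3 T B f| <= M * (B - - B) * (B - - B) * (T - 0).
Proof.
move=> T0 B0 cf fM; have BB : - B <= B by lra.
apply: RI_bound => //; first exact: cts_I3_inner.
by move=> t tI; apply: I2_bound => // [|x y]; [exact: cts_time | exact: fM].
Qed.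

Lemma RI_derive_total (h h' : R * R -> R) a b : a <= b -> continuous h -> continuous h' ->
  (forall w x, is_derive w (1 : R) (fun w => h (w, x)) (h' (w, x))) ->
  forall u, is_derive u (1 : R) (fun w => RI a b (fun x => h (w, x))) (RI a b (fun x => h' (u, x))).
Proof.
move=> ab ch ch' dh u.
apply: (@RI_derive _ (fun w x => h (w, x)) (fun w x => h' (w, x)) u a b ab).
- by apply: filterE => w; exact: conton_slice.
- by apply: filterE => w x _; exact: dh.
- by move=> x _; rewrite (_ : (fun z => _) = h'); [exact: ch' | apply/funext => -[]].
- exact: conton_slice.
Qed.

Section Divergence.
Variables (G : V -> R) (G' : 'I_3 -> V -> R) (T B : R).
Hypotheses (T0 : 0 < T) (B0 : 0 < B) (cG : continuous G) (cG' : forall k, continuous (G' k)).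
Hypothesis dG : forall k q, is_derive q (axis R k) G (G' k q).

Let BB : - B <= B. Proof. by move: B0; lra. Qed.
Let BB' : - B < B. Proof. by move: B0; lra. Qed.

(** As t is the outermost variable, the fundamental theorem of calculus in t is applied after
    differentiating under the two spatial integrals. *)
Lemma I3_pd0 : I3 T B (G' 0) =
  I2 (- B) B (- B) B (fun y => G (T, y)) - I2 (- B) B (- B) B (fun y => G (0, y)).
Proof.
apply: (RI_FTC (F := fun t => I2 (- B) B (- B) B (fun y => G (t, y)))) => //.
  by apply: cts_I3_inner => //; exact: ltW.
move=> t _.
apply: (@RI_derive_total (fun w => RI (- B) B (fun y => G (w.1, (w.2, y))))
  (fun w => RI (- B) B (fun y => G' 0 (w.1, (w.2, y))))) => //.
- exact: (cts_RI (cts_assoc3 cG) BB).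
- exact: (cts_RI (cts_assoc3 (@cG' 0)) BB).
move=> w x.
apply: (@RI_derive_total (fun z => G (z.1, (x, z.2))) (fun z => G' 0 (z.1, (x, z.2)))) => //.
- move=> z; apply: (@continuous_comp _ _ _ (fun z : R * R => (z.1, (x, z.2))) G); last exact: cG.
  apply: cts_pairing; first exact: cvg_fst.
  by apply: cts_pairing; [exact: cvg_cst | exact: cvg_snd].
- move=> z; apply: (@continuous_comp _ _ _ (fun z : R * R => (z.1, (x, z.2))) (G' 0)); last exact: cG'.
  apply: cts_pairing; first exact: cvg_fst.
  by apply: cts_pairing; [exact: cvg_cst | exact: cvg_snd].
move=> u y; rewrite (_ : (fun w => _) = (fun w => G (w *: axis R 0 + (0, (x, y))))).
  by apply: is_derive_line; rewrite axis_line0.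
by apply/funext => v; rewrite axis_line0.
Qed.

Lemma cts_face1 (g : V -> R) x : continuous g -> continuous (fun z : R * R => g (z.1, (x, z.2))).
Proof.
move=> cg z; apply: (@continuous_comp _ _ _ (fun z : R * R => (z.1, (x, z.2))) g); last exact: cg.
apply: cts_pairing; first exact: cvg_fst.
by apply: cts_pairing; [exact: cvg_cst | exact: cvg_snd].
Qed.

Lemma cts_face2 (g : V -> R) x : continuous g -> continuous (fun z : R * R => g (z.1, (z.2, x))).
Proof.
move=> cg z; apply: (@continuous_comp _ _ _ (fun z : R * R => (z.1, (z.2, x))) g); last exact: cg.
apply: cts_pairing; first exact: cvg_fst.
by apply: cts_pairing; [exact: cvg_snd | exact: cvg_cst].
Qed.

Lemma I3_pd1 : I3 T B (G' 1) =
  I2 0 T (- B) B (fun z => G (z.1, (B, z.2)) - G (z.1, (- B, z.2))).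
Proof.
apply: eq_RI => t _.
have c1 : conton (- B) B (fun y => G (t, (B, y))) := conton_slice (w := t) (cts_face1 (x := B) cG).
have c2 : conton (- B) B (fun y => G (t, (- B, y))) := conton_slice (w := t) (cts_face1 (x := - B) cG).
apply: etrans (esym (RIB c1 c2)).
apply: (RI_FTC (F := fun x => RI (- B) B (fun y => G (t, (x, y))))) => //.
  move=> x _; exact: (cts_RI (cts_time (t := t) (@cG' 1)) BB).
move=> x _.
apply: (@RI_derive_total (fun z => G (t, z)) (fun z => G' 1 (t, z))) => //; try exact: cts_time.
move=> u y; rewrite (_ : (fun w => _) = (fun w => G (w *: axis R 1 + (t, (0, y))))).
  by apply: is_derive_line; rewrite axis_line1.
by apply/funext => v; rewrite axis_line1.
Qed.

Lemma I3_pd2 : I3 T B (G' 2%R) =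
  I2 0 T (- B) B (fun z => G (z.1, (z.2, B)) - G (z.1, (z.2, - B))).
Proof.
apply: eq_RI => t _; apply: eq_RI => x _.
apply: (RI_FTC (F := fun y => G (t, (x, y)))) => //.
  exact: (conton_slice (w := x) (cts_time (t := t) (@cG' 2%R))).
move=> y _; rewrite (_ : (fun w => _) = (fun w => G (w *: axis R 2%R + (t, (x, 0))))).
  by apply: is_derive_line; rewrite axis_line2.
by apply/funext => v; rewrite axis_line2.
Qed.

End Divergence.

End IteratedIntegrals.

Lemma oppr_double3 (U : zmodType) (a b c : U) : a + b + c = 0 ->
  - (a + a) - (b + b) - (c + c) = 0.
Proof.
move=> E; have D : a + a + (b + b) + (c + c) = 0.
  by rewrite (addrACA a a) (addrACA (a + b)) E addr0.
by rewrite -!opprD D oppr0.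
Qed.

(** * Plane-wave solutions of the adjoint system *)

Section PlaneWaveKernel.
Variables (R : realType) (n : nat) (P Q : 'M[R[i]]_n).
Hypotheses (hP : P ^t* = P) (hQ : Q ^t* = Q).
Local Notation C := R[i].
Local Notation V := (spacetime R).

(** At q = (t, x), [Bq q] and [Dq q] are the Hermitian matrices x1 - t P and x2 - t Q, linear in
    q. *)
Definition Bq (q : V) : 'M[C]_n := q.2.1%:C%:M - q.1%:C *: P.
Definition Dq (q : V) : 'M[C]_n := q.2.2%:C%:M - q.1%:C *: Q.

Lemma affine_herm (a b : R) (H : 'M[C]_n) : H ^t* = H ->
  (a%:C%:M - b%:C *: H) ^t* = a%:C%:M - b%:C *: H.
Proof. by move=> hH; rewrite adjD adjN adj_real // adj_scalar [_^*]conjc_real. Qed.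

Lemma Bq_herm q : (Bq q) ^t* = Bq q. Proof. exact: affine_herm. Qed.
Lemma Dq_herm q : (Dq q) ^t* = Dq q. Proof. exact: affine_herm. Qed.

Lemma affine_lin (w a b c d : R) (H : 'M[C]_n) :
  (w * a + c)%:C%:M - (w * b + d)%:C *: H =
  w%:C *: (a%:C%:M - b%:C *: H) + (c%:C%:M - d%:C *: H).
Proof.
rewrite !rmorphD !rmorphM /= scalerBr scalerA scale_scalar_mx scalerDl opprD.
by rewrite addrACA [in RHS]scalar_mxM.
Qed.

Lemma Bq_lin w (a q : V) : Bq (w *: a + q) = w%:C *: Bq a + Bq q.
Proof. exact: affine_lin. Qed.
Lemma Dq_lin w (a q : V) : Dq (w *: a + q) = w%:C *: Dq a + Dq q.
Proof. exact: affine_lin. Qed.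

Definition Mq e t q : 'M[C]_n := Mx (cos t)%:C (sin t)%:C e (Bq q) (Dq q).
(** The constant derivative of [Mq] along the k-th axis; [Wq] is the resulting derivative of
    [N2q]. *)
Definition Lq k t : 'M[C]_n := H0 t (Bq (axis R k)) (Dq (axis R k)).
Definition N2q e t q : 'M[C]_n := invmx (Mq e t q) *m invmx (Mq e t q).
Definition Wq e k t q : 'M[C]_n := - (invmx (Mq e t q) *m Lq k t *m N2q e t q
  + N2q e t q *m Lq k t *m invmx (Mq e t q)).

(** A Hermitian matrix has real spectrum and the subtracted scalar [e] is not real. *)
Lemma Mq_unit e t q : complex.Im e != 0 -> Mq e t q \in unitmx.
Proof.
move=> e0; apply: contraT => /ker_nunit [v v0 Mv].
have E : form (Mq e t q) v v = 0 by exact: form0r.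
have hH : (H0 t (Bq q) (Dq q)) ^t* = H0 t (Bq q) (Dq q).
  by apply: H0_herm; [exact: Bq_herm | exact: Dq_herm].
have : form (H0 t (Bq q) (Dq q)) v v = e * (nsq v)%:C.
  by apply/eqP; rewrite -subr_eq0 -form_scalar -formNl -formDl; apply/eqP; exact: E.
rewrite herm_form // => /(congr1 (@complex.Im R)); rewrite cImM /= mulr0 add0r.
by move/esym/eqP; rewrite mulf_eq0 (negbTE e0) /= gt_eqF // nsq_gt0.
Qed.

Lemma Mq_line e k t w q : Mq e t (w *: axis R k + q) = w%:C *: Lq k t + Mq e t q.
Proof.
rewrite /Mq /Mx /Lq /H0 Bq_lin Dq_lin.
move: (Bq q) (Dq q) (Bq _) (Dq _) => b d b' d'.
by rewrite !scalerDr !scalerA [w%:C * _]mulrC [w%:C * _]mulrC addrACA -!addrA.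
Qed.

Lemma axis0E : axis R 0 = (1, (0, 0)). Proof. by []. Qed.
Lemma axis1E : axis R 1 = (0, (1, 0)). Proof. by []. Qed.
Lemma axis2E : axis R 2%R = (0, (0, 1)). Proof. by []. Qed.

Lemma scale1Mx (c : C) : c *: (1%:M : 'M[C]_n) = c%:M.
Proof. by rewrite scalemx1. Qed.

Lemma Lq0 t : Lq 0 t = - H0 t P Q.
Proof.
by rewrite /Lq /Bq /Dq axis0E /H0 /= !scale1r !raddf0 !sub0r !scalerN opprD.
Qed.

Lemma Lq1 t : Lq 1 t = (cos t)%:C%:M.
Proof.
by rewrite /Lq /Bq /Dq axis1E /H0 /= !scale0r !subr0 raddf0 scaler0 addr0 scalemx1.
Qed.

Lemma Lq2 t : Lq 2%R t = (sin t)%:C%:M.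
Proof.
by rewrite /Lq /Bq /Dq axis2E /H0 /= !scale0r !subr0 raddf0 scaler0 add0r scalemx1.
Qed.

Lemma Mq_comm0 e t q : Mq e t q =
  ((cos t)%:C * q.2.1%:C + (sin t)%:C * q.2.2%:C - e)%:M + q.1%:C *: Lq 0 t.
Proof.
rewrite Lq0 /Mq /Mx /Bq /Dq /H0.
move: (_%:C) (_%:C) (_%:C) (_%:C) (_%:C) => c x t' s y.
apply/matrixP => i j; rewrite !mxE; move: (P i j) (Q i j) => a b.
by case: (i == j); rewrite ?mulr1n ?mulr0n; ring.
Qed.

(** At a fixed angle every matrix involved is a polynomial in the single Hermitian matrix cos t P +
    sin t Q. *)
Lemma Lq_comm e k t q : Lq k t *m Mq e t q = Mq e t q *m Lq k t.
Proof.
have k3 : [\/ k = 0, k = 1 | k = 2%R].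
  by case: k => [[|[|[|//]]] ?]; [constructor 1|constructor 2|constructor 3]; exact/val_inj.
case: k3 => ->; [|by rewrite Lq1 scalar_mxC | by rewrite Lq2 scalar_mxC].
rewrite Mq_comm0; move: (Lq 0 t) (q.1%:C) (_ - e) => L c z.
by rewrite mulmxDl mulmxDr scalar_mxC -scalemxAl -scalemxAr.
Qed.

Lemma inv_comm (M L : 'M[C]_n) : M \in unitmx -> L *m M = M *m L ->
  L *m invmx M = invmx M *m L.
Proof.
move=> uM E; rewrite -[LHS](mulKmx uM); congr (_ *m _).
by rewrite mulmxA -E mulmxK.
Qed.

Lemma WqE e k t q : complex.Im e != 0 ->
  Wq e k t q = - (invmx (Mq e t q) *m N2q e t q *m Lq k t + invmx (Mq e t q) *m N2q e t q *m Lq k t).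
Proof.
move=> e0; have uM := Mq_unit t q e0.
have := inv_comm uM (Lq_comm e k t q).
rewrite /Wq /N2q; move: (invmx _) (Lq k t) => N L E.
have -> : N *m L *m (N *m N) = N *m (N *m N) *m L.
  by rewrite mulmxA -(mulmxA N L N) E mulmxA -(mulmxA _ L N) E !mulmxA.
have -> : N *m N *m L *m N = N *m (N *m N) *m L by rewrite -(mulmxA _ L N) E !mulmxA.
by [].
Qed.

(** By commutation the derivative of N^2 along the axis k is - 2 N^3 L_k, and L_0 + L_1 P + L_2 Q =
    0 because L_0 = - (cos t P + sin t Q) while L_1 and L_2 are the scalars cos t and sin t. *)
Lemma Wq_system e t q : complex.Im e != 0 ->
  Wq e 0 t q + Wq e 1 t q *m P + Wq e 2%R t q *m Q = 0.
Proof.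
move=> e0; rewrite !WqE //; move: (invmx _ *m _) => N.
have NL : N *m Lq 0 t + N *m Lq 1 t *m P + N *m Lq 2%R t *m Q = 0.
  rewrite Lq0 Lq1 Lq2 -[X in _ + X + _]mulmxA -[X in _ + _ + X]mulmxA !mul_scalar_mx -mulmxDr -mulmxDr -addrA.
  by rewrite /H0 addNr mulmx0.
have sys (a b c : 'M[C]_n) : a + b *m P + c *m Q = 0 ->
    - (a + a) + - (b + b) *m P + - (c + c) *m Q = 0.
  move=> abc; rewrite (mulNmx (b + b)) (mulmxDl b b) (mulNmx (c + c)) (mulmxDl c c).
  exact: oppr_double3.
exact: sys NL.
Qed.

Lemma mder_Mq e k t q : mder 0 (fun w => Mq e t (w *: axis R k + q)) (Lq k t).
Proof.
have H := mderD (mderZ (cder_real (is_derive_id (0 : R) (1 : R))) (mder_cst 0 (Lq k t))) (mder_cst 0 (Mq e t q)).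
have -> : (fun w => Mq e t (w *: axis R k + q)) = (fun w => w%:C *: Lq k t + Mq e t q).
  by apply/funext => w; rewrite Mq_line.
by move: H; rewrite scaler0 !addr0 scale1r.
Qed.

Lemma mder_N2q e k t q : complex.Im e != 0 ->
  mder 0 (fun w => N2q e t (w *: axis R k + q)) (Wq e k t q).
Proof.
move=> e0; have E : Mq e t q = Mq e t (0 *: axis R k + q) by rewrite scale0r add0r.
have uM : Mq e t (0 *: axis R k + q) \in unitmx by exact: Mq_unit.
by have := mder_N2 uM (mder_Mq e k t q); rewrite -E.
Qed.

Lemma mcont_affine (T : topologicalType) (x : T) (f g : T -> R) (H : 'M[C]_n) :
  {for x, continuous f} -> {for x, continuous g} ->
  mcont x (fun y => (f y)%:C%:M - (g y)%:C *: H).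
Proof.
move=> cf cg; apply: mcontB; first by apply: mcont_scalar; exact: ccont_real.
by apply: mcontZ; [exact: ccont_real | exact: mcont_cst].
Qed.

Lemma mcont_Bq (T : topologicalType) (x : T) (f : T -> V) : {for x, continuous f} ->
  mcont x (fun y => Bq (f y)).
Proof. by move=> cf; apply: mcont_affine; [exact: cts_fstc (cts_sndc cf) | exact: cts_fstc cf]. Qed.

Lemma mcont_Dq (T : topologicalType) (x : T) (f : T -> V) : {for x, continuous f} ->
  mcont x (fun y => Dq (f y)).
Proof. by move=> cf; apply: mcont_affine; [exact: cts_sndc (cts_sndc cf) | exact: cts_fstc cf]. Qed.

Lemma mcont_trig (T : topologicalType) (x : T) (f : T -> R) (B D : T -> 'M[C]_n) :
  {for x, continuous f} -> mcont x B -> mcont x D ->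
  mcont x (fun y => (cos (f y))%:C *: B y + (sin (f y))%:C *: D y).
Proof.
move=> cf cB cD; apply: mcontD; apply: mcontZ => //; apply: ccont_real.
  by apply: (@continuous_comp _ _ _ f (@cos R)) => //; exact: continuous_cos.
by apply: (@continuous_comp _ _ _ f (@sin R)) => //; exact: continuous_sin.
Qed.

Lemma mcont_Mq (T : topologicalType) (x : T) e (f : T -> R) (g : T -> V) :
  {for x, continuous f} -> {for x, continuous g} -> mcont x (fun y => Mq e (f y) (g y)).
Proof.
move=> cf cg; apply: mcontB; last exact: mcont_cst.
by apply: mcont_trig => //; [exact: mcont_Bq | exact: mcont_Dq].
Qed.

Lemma mcont_N2q (T : topologicalType) (x : T) e (f : T -> R) (g : T -> V) : complex.Im e != 0 ->
  {for x, continuous f} -> {for x, continuous g} -> mcont x (fun y => N2q e (f y) (g y)).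
Proof.
move=> e0 cf cg.
exact: (mcont_N2 (M := fun y => Mq e (f y) (g y)) (Mq_unit (f x) (g x) e0) (mcont_Mq e cf cg)).
Qed.

Lemma mcont_Wq (T : topologicalType) (x : T) e k (f : T -> R) (g : T -> V) : complex.Im e != 0 ->
  {for x, continuous f} -> {for x, continuous g} -> mcont x (fun y => Wq e k (f y) (g y)).
Proof.
move=> e0 cf cg.
have [_ cI] := mcont_inv (F := fun y => Mq e (f y) (g y)) (Mq_unit (f x) (g x) e0) (mcont_Mq e cf cg).
have cN := mcont_N2q e0 cf cg.
have cL : mcont x (fun y => Lq k (f y)) by apply: mcont_trig => //; exact: mcont_cst.
exact: (mcontN (mcontD (mcontM (mcontM cI cL) cN) (mcontM (mcontM cN cL) cI))).
Qed.

Definition kern e i j (q : V) : C := CI 0 (2 * pi) (fun t => N2q e t q i j).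
Definition kern' e k i j (q : V) : C := CI 0 (2 * pi) (fun t => Wq e k t q i j).

Section KernelCalculus.
Variable e : C.
Hypothesis e0 : complex.Im e != 0.

Let pi2 : 0 <= 2 * pi :> R. Proof. by rewrite mulr_ge0 // pi_ge0. Qed.

Lemma cconton_N2q i j q : cconton 0 (2 * pi) (fun t => N2q e t q i j).
Proof. by move=> t _; apply: (mcont_N2q e0 (f := id)); [exact: cvg_id | exact: cvg_cst]. Qed.

Lemma cconton_Wq k i j q : cconton 0 (2 * pi) (fun t => Wq e k t q i j).
Proof. by move=> t _; apply: (mcont_Wq k e0 (f := id)); [exact: cvg_id | exact: cvg_cst]. Qed.

Lemma kern_cts i j q : ccont q (kern e i j).
Proof.
apply: (CI_ccont (h := fun q t => N2q e t q i j)) => //.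
  by move=> t _; apply: (mcont_N2q e0); [exact: cvg_snd | exact: cvg_fst].
by apply: filterE => p; exact: cconton_N2q.
Qed.

Lemma kern'_cts k i j q : ccont q (kern' e k i j).
Proof.
apply: (CI_ccont (h := fun q t => Wq e k t q i j)) => //.
  by move=> t _; apply: (mcont_Wq k e0); [exact: cvg_snd | exact: cvg_fst].
by apply: filterE => p; exact: cconton_Wq.
Qed.

Lemma kern_cder k i j q : cder 0 (fun w => kern e i j (w *: axis R k + q)) (kern' e k i j q).
Proof.
have -> : kern' e k i j q = kern' e k i j (0 *: axis R k + q) by rewrite scale0r add0r.
have cl w : {for w, continuous (fun v : R => v *: axis R k + q)}.
  by apply: cvgD; [apply: cvgZr_tmp; exact: cvg_id | exact: cvg_cst].
apply: (CI_cder (h := fun w t => N2q e t (w *: axis R k + q) i j)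
  (h' := fun w t => Wq e k t (w *: axis R k + q) i j)) => //.
- by apply: filterE => w; exact: cconton_N2q.
- apply: filterE => w t _.
  have := mder_N2q k t (w *: axis R k + q) e0 i j.
  move=> [d1 d2]; split.
    have := @is_derive_line R _ (fun p => complex.Re (N2q e t p i j)) (axis R k) q w.
    apply; apply: line_is_derive; exact: d1.
  have := @is_derive_line R _ (fun p => complex.Im (N2q e t p i j)) (axis R k) q w.
  by apply; apply: line_is_derive; exact: d2.
- move=> t _; apply: (mcont_Wq k e0); first exact: cvg_snd.
  by apply: (@continuous_comp _ _ _ fst (fun v : R => v *: axis R k + q)); [exact: cvg_fst | exact: cl].
- exact: cconton_Wq.
Qed.

Lemma kern_system i k q : kern' e 0 i k q +
  \sum_l (kern' e 1 i l q * P l k + kern' e 2%R i l q * Q l k) = 0.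
Proof.
have c1 l : cconton 0 (2 * pi) (fun t => Wq e 1 t q i l * P l k).
  by move=> t tI; apply: ccontM; [exact: cconton_Wq | exact: ccont_cst].
have c2 l : cconton 0 (2 * pi) (fun t => Wq e 2%R t q i l * Q l k).
  by move=> t tI; apply: ccontM; [exact: cconton_Wq | exact: ccont_cst].
have c12 l : cconton 0 (2 * pi) (fun t => Wq e 1 t q i l * P l k + Wq e 2%R t q i l * Q l k).
  by move=> t tI; apply: ccontD; [exact: c1 | exact: c2].
have -> : \sum_l (kern' e 1 i l q * P l k + kern' e 2%R i l q * Q l k) =
  CI 0 (2 * pi) (fun t => \sum_l (Wq e 1 t q i l * P l k + Wq e 2%R t q i l * Q l k)).
  rewrite (CI_sum _ _ c12); apply: eq_bigr => l _.
  rewrite (CID (c1 l) (c2 l)); congr (_ + _).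
    exact: esym (CIZr _ (cconton_Wq 1 i l q)).
  exact: esym (CIZr _ (cconton_Wq 2%R i l q)).
have cs : cconton 0 (2 * pi) (fun t => \sum_l (Wq e 1 t q i l * P l k + Wq e 2%R t q i l * Q l k)).
  by move=> t tI; apply: ccont_sum => l; exact: c12.
apply: etrans (esym (CID (cconton_Wq 0 i k q) cs)) _.
rewrite -[RHS](CI0 0 (2 * pi)); apply: eq_CI => t _.
have sys (a b c : 'M[C]_n) : a + b *m P + c *m Q = 0 ->
    a i k + \sum_l (b i l * P l k + c i l * Q l k) = 0.
  by move=> /matrixP /(_ i k); rewrite !mxE big_split /= addrA.
exact: sys (Wq_system t q e0).
Qed.

End KernelCalculus.

(** Taking the adjoint of the integral replaces the pole i e by - i e, so the symmetrised kernel is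
    a sum of two functions to which the calculus above applies. *)
Lemma kernelE (e : R) i j q : e != 0 ->
  kernel e (Bq q) (Dq q) i j = kern (0 +i* e) i j q + kern (0 +i* - e) i j q.
Proof.
move=> e0; have e0' : complex.Im (0 +i* e : C) != 0 by [].
rewrite /kernel; congr (_ + _); rewrite /kernel_half -CIJ; last exact: cconton_N2q.
apply: eq_CI => t _; rewrite -adjE adjM /Nx adj_inv.
suff -> : (Mx (cos t)%:C (sin t)%:C (0 +i* e) (Bq q) (Dq q)) ^t* = Mq (0 +i* - e) t q by [].
rewrite /Mx adjD adjN adj_scalar adjD (adj_real _ (Bq_herm q)) (adj_real _ (Dq_herm q)).
by rewrite /Mq /Mx; congr (_ - _%:M); apply: complexP => //=; rewrite oppr0.
Qed.

End PlaneWaveKernel.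

(** * A scalar integral over the circle *)

Section CircleIntegral.
Variables (R : realType) (a b eta : R).
Hypothesis eta0 : eta != 0.
Local Notation C := R[i].

Let e : C := 0 +i* eta.
Let s t : R := cos t * a + sin t * b.
Let s' t : R := - sin t * a + cos t * b.
Let m (u t : R) : C := (u * s t)%:C - e.

Lemma circle_ds t : is_derive t (1 : R) s (s' t).
Proof.
apply: eq_derive_val (dD (dM (is_derive_cos t) (dcst a _ _)) (dM (is_derive_sin t) (dcst b _ _))) _.
by rewrite !mulr0 !addr0.
Qed.

Lemma circle_ds' t : is_derive t (1 : R) s' (- s t).
Proof.
apply: eq_derive_val (dD (dM (dN (is_derive_sin t)) (dcst a _ _)) (dM (is_derive_cos t) (dcst b _ _))) _.
by rewrite !mulr0 !addr0 /s; ring.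
Qed.

Lemma circle_m_neq0 u t : m u t != 0.
Proof. by rewrite /m eq_complex /= sub0r oppr_eq0 (negbTE eta0) andbF. Qed.

Let N u t : C := (m u t)^-1.

Lemma circle_ccont_m (T : topologicalType) (x : T) (f g : T -> R) :
  {for x, continuous f} -> {for x, continuous g} -> ccont x (fun y => m (f y) (g y)).
Proof.
move=> cf cg; apply: ccontB; last exact: ccont_cst.
apply: ccont_real; apply: cvgM => //.
by apply: (@continuous_comp _ _ _ g s) => //; exact: derive_cts (circle_ds _).
Qed.

Lemma circle_ccont_N (T : topologicalType) (x : T) (f g : T -> R) :
  {for x, continuous f} -> {for x, continuous g} -> ccont x (fun y => N (f y) (g y)).
Proof.
move=> cf cg; apply: (@ccontV _ _ _ (fun y => m (f y) (g y))); first exact: circle_m_neq0.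
exact: circle_ccont_m.
Qed.

Lemma circle_ccont_dN2 (T : topologicalType) (x : T) (f g : T -> R) :
  {for x, continuous f} -> {for x, continuous g} ->
  ccont x (fun y => - (2 * s (g y))%:C * (N (f y) (g y) * (N (f y) (g y) * N (f y) (g y)))).
Proof.
move=> cf cg; have cN := circle_ccont_N cf cg.
apply: ccontM; last by apply: ccontM => //; exact: ccontM.
apply: ccontN; apply: ccont_real; apply: cvgM; first exact: cvg_cst.
by apply: (@continuous_comp _ _ _ g s) => //; exact: derive_cts (circle_ds _).
Qed.

Let k u : C := CI 0 (2 * pi) (fun t => N u t * N u t).
Let k' u : C := CI 0 (2 * pi) (fun t => - (2 * s t)%:C * (N u t * (N u t * N u t))).

Let pi2 : 0 < 2 * pi :> R. Proof. by rewrite mulr_gt0 // pi_gt0. Qed.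

Lemma circle_cc_N2 u : cconton 0 (2 * pi) (fun t => N u t * N u t).
Proof.
move=> t _; have cN : ccont t (fun y => N u y).
  by apply: (circle_ccont_N (f := fun=> u) (g := id)); [exact: cvg_cst | exact: cvg_id].
exact: (ccontM cN cN).
Qed.

Lemma circle_cc_dN2 u : cconton 0 (2 * pi) (fun t => - (2 * s t)%:C * (N u t * (N u t * N u t))).
Proof.
by move=> t _; apply: (circle_ccont_dN2 (f := fun=> u) (g := id)); [exact: cvg_cst | exact: cvg_id].
Qed.

Lemma circle_dk u : cder u k (k' u).
Proof.
apply: (CI_cder (h := fun u t => N u t * N u t)
  (h' := fun u t => - (2 * s t)%:C * (N u t * (N u t * N u t)))).
- exact: ltW.
- by apply: filterE => w; exact: circle_cc_N2.
- apply: filterE => w t _.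
  have dm : cder w (fun u => m u t) (s t)%:C.
    apply: cder_eq (cderB (cder_real (dM (is_derive_id w (1 : R)) (dcst (s t) _ _))) (cder_cst w e)) _.
    by rewrite subr0 mul1r mulr0 addr0.
  have dN := cderV (F := m ^~ t) (circle_m_neq0 w t) dm.
  have dN2 := cderM dN dN; apply: cder_eq dN2 _; rewrite /N.
  have := circle_m_neq0 w t; move: (m w t) => z z0.
  by rewrite rmorphM /= rmorph_nat; move: ((s t)%:C) => x; field.
- move=> t _; by apply: (circle_ccont_dN2 (f := fst) (g := snd)); [exact: cvg_fst | exact: cvg_snd].
- exact: circle_cc_dN2.
Qed.

(** The auxiliary factor u scales the linear form s. The left side is the integral of the
    t-derivative of the periodic function [G] and so vanishes. *)
Lemma circle_ode u : ((u ^+ 2 * (a ^+ 2 + b ^+ 2) + eta ^+ 2)%:C) * k' u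
  + (3 * u * (a ^+ 2 + b ^+ 2))%:C * k u = 0.
Proof.
pose G t : C := (s' t)%:C * (e * (N u t * N u t) - N u t).
have dG t : cder t G ((u ^+ 2 * (a ^+ 2 + b ^+ 2) + eta ^+ 2)%:C *
    (- (2 * s t)%:C * (N u t * (N u t * N u t))) + (3 * u * (a ^+ 2 + b ^+ 2))%:C * (N u t * N u t)).
  have dm : cder t (fun t => m u t) (u * s' t)%:C.
    apply: cder_eq (cderB (cder_real (dM (dcst u _ _) (circle_ds t))) (cder_cst t e)) _.
    by rewrite subr0 mul0r add0r.
  have dN := cderV (circle_m_neq0 u t) dm.
  apply: cder_eq (cderM (cder_real (circle_ds' t)) (cderB (cderM (cder_cst t e) (cderM dN dN)) dN)) _.
  rewrite /N; have z0 := circle_m_neq0 u t.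
  have mE : (u * s t)%:C = m u t + e by rewrite /m subrK.
  have e2 : e * e = - (eta ^+ 2)%:C.
    by apply: complexP; rewrite ?cReM ?cImM ?cReN ?cImN /=; ring.
  have ss : s t ^+ 2 + s' t ^+ 2 = a ^+ 2 + b ^+ 2.
    rewrite /s /s'; have := cos2Dsin2 t => cs.
    transitivity ((a ^+ 2 + b ^+ 2) * (cos t ^+ 2 + sin t ^+ 2)); first by ring.
    by rewrite cs mulr1.
  rewrite -ss; move: mE e2 z0; move: (m u t) (s t) (s' t) => z x y.
  rewrite !(rmorph_nat, rmorphXn, rmorphM, rmorphD, rmorphN) /=.
  move: (u%:C) (x%:C) (y%:C) (eta%:C) e => U X Y H E mE e2 z0.
  have zE : z = U * X - E by rewrite mE addrK.
  have H2 : H ^+ 2 = - (E * E) by rewrite e2 opprK.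
  rewrite H2; move: z0; rewrite zE => z0; field.
  exact: z0.
have cc1 : cconton 0 (2 * pi) (fun t => (u ^+ 2 * (a ^+ 2 + b ^+ 2) + eta ^+ 2)%:C *
    (- (2 * s t)%:C * (N u t * (N u t * N u t)))).
  by move=> t tI; apply: ccontM; [exact: ccont_cst | exact: circle_cc_dN2].
have cc2 : cconton 0 (2 * pi) (fun t => (3 * u * (a ^+ 2 + b ^+ 2))%:C * (N u t * N u t)).
  by move=> t tI; apply: ccontM; [exact: ccont_cst | exact: circle_cc_N2].
rewrite -(CIZ _ (circle_cc_dN2 u)) -(CIZ _ (circle_cc_N2 u)) -(CID cc1 cc2).
transitivity (G (2 * pi) - G 0); last first.
  by rewrite /G /N /m /s /s' sin0 cos0 mulr_natl sin2pi cos2pi subrr.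
refine (CI_FTC pi2 _ (fun t _ => dG t)).
by move=> t tI; apply: ccontD; [exact: cc1 | exact: cc2].
Qed.

Let rho (u : R) := Num.sqrt (u ^+ 2 * (a ^+ 2 + b ^+ 2) + eta ^+ 2).

Lemma circle_rho2_gt0 u : 0 < u ^+ 2 * (a ^+ 2 + b ^+ 2) + eta ^+ 2.
Proof.
by rewrite ltr_wpDl ?exprn_even_gt0 // mulr_ge0 ?sqr_ge0 // addr_ge0 ?sqr_ge0.
Qed.

Lemma circle_drho u : is_derive u (1 : R) rho (u * (a ^+ 2 + b ^+ 2) / rho u).
Proof.
have p := circle_rho2_gt0 u.
have d2 := dD (dM (dX2 (is_derive_id u (1 : R))) (dcst (a ^+ 2 + b ^+ 2) u (1 : R))) (dcst (eta ^+ 2) u (1 : R)).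
have D := is_derive_comp1 (f := Num.sqrt)
  (g := fun u => u ^+ 2 * (a ^+ 2 + b ^+ 2) + eta ^+ 2) (is_derive1_sqrt p) d2.
apply: eq_derive_val D _.
have r0 : rho u != 0 by rewrite gt_eqF // sqrtr_gt0.
by rewrite -/(rho u); field.
Qed.

(** By the differential equation k(u) times (u^2 (a^2 + b^2) + eta^2)^{3/2} is constant in u; its
    value at u = 0, where the integrand is constant, gives the one at u = 1. *)
Lemma circle_integral :
  CI 0 (2 * pi) (fun t => ((s t)%:C - e)^-1 * ((s t)%:C - e)^-1) =
  (- (2 * pi * `|eta| / Num.sqrt (a ^+ 2 + b ^+ 2 + eta ^+ 2) ^+ 3))%:C.
Proof.
have dH u : cder u (fun u => k u * (rho u ^+ 3)%:C) 0.
  have d3 : is_derive u (1 : R) (fun u => rho u ^+ 3) (3 * rho u * (u * (a ^+ 2 + b ^+ 2))).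
    have dr := circle_drho u.
    have r0 : rho u != 0 by rewrite gt_eqF // sqrtr_gt0 circle_rho2_gt0.
    under eq_fun do rewrite exprS.
    apply: eq_derive_val (dM dr (dX2 dr)) _.
    by field.
  apply: cder_eq (cderM (circle_dk u) (cder_real d3)) _.
  have := circle_ode u.
  have r2 : u ^+ 2 * (a ^+ 2 + b ^+ 2) + eta ^+ 2 = rho u ^+ 2.
    by rewrite sqr_sqrtr // ltW // circle_rho2_gt0.
  rewrite r2 !(rmorph_nat, rmorphXn, rmorphM) /=.
  move: (k u) (k' u) (rho u)%:C (u%:C) ((a ^+ 2 + b ^+ 2)%:C) => K K' r U S E.
  by rewrite -[RHS](mulr0 r) -E; ring.
have c0 : cconton (0 : R) 1 (fun=> 0 : C) by move=> x _; exact: ccont_cst.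
have := CI_FTC ltr01 c0 (fun x _ => dH x); rewrite CI0 => /esym/eqP.
rewrite subr_eq0 => /eqP.
have rho1 : rho 1 = Num.sqrt (a ^+ 2 + b ^+ 2 + eta ^+ 2) by rewrite /rho expr1n mul1r.
have rho0 : rho 0 = `|eta| by rewrite /rho expr0n /= mul0r add0r sqrtr_sqr.
have k0 : k 0 = (- (2 * pi / eta ^+ 2))%:C.
  rewrite /k (eq_CI (G := fun=> (- (eta ^+ 2)^-1)%:C)); last first.
    move=> t _; rewrite /N /m mul0r sub0r -invfM mulrNN -/e.
    have -> : e * e = (- eta ^+ 2)%:C.
      by apply: complexP; rewrite ?cReM ?cImM /=; ring.
    by rewrite -fmorphV invrN.
  rewrite /CI RI0 RI_cst ?ltW //; apply: complexP => //=; ring.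
have k1 : k 1 = CI 0 (2 * pi) (fun t => ((s t)%:C - e)^-1 * ((s t)%:C - e)^-1).
  by apply: eq_CI => t _; rewrite /N /m mul1r.
rewrite k0 rho0 rho1 k1 => E.
have r0 : Num.sqrt (a ^+ 2 + b ^+ 2 + eta ^+ 2) != 0.
  by rewrite gt_eqF // sqrtr_gt0; have := circle_rho2_gt0 1; rewrite expr1n mul1r.
have r3 : ((Num.sqrt (a ^+ 2 + b ^+ 2 + eta ^+ 2) ^+ 3)%:C : C) != 0.
  by rewrite eq_complex /= eqxx andbT expf_neq0.
apply: (mulIf r3); rewrite E -!rmorphM /=; congr (_%:C).
move: (Num.sqrt _) r0 => r r0.
have -> : eta ^+ 2 = `|eta| ^+ 2 by rewrite real_normK // num_real.
have : `|eta| != 0 by rewrite normr_eq0.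
move: (`|eta|) => h h0; field.
by rewrite r0.
Qed.

End CircleIntegral.

(** * The kernel at time zero *)

Section InitialKernel.
Variables (R : realType) (n : nat) (P Q : 'M[R[i]]_n).
Hypotheses (hP : P ^t* = P) (hQ : Q ^t* = Q).
Local Notation C := R[i].

(** The Poisson kernel of the half-space of R^3 at height eps, multiplied by 8 pi^2. *)
Definition poisson (eps : R) (y : R * R) : R :=
  4 * pi * eps / Num.sqrt (y.1 ^+ 2 + y.2 ^+ 2 + eps ^+ 2) ^+ 3.

Lemma kern_initial (eta : R) i j (y : R * R) : eta != 0 ->
  kern P Q (0 +i* eta) i j (0, y) =
  ((i == j)%:R * - (2 * pi * `|eta| / Num.sqrt (y.1 ^+ 2 + y.2 ^+ 2 + eta ^+ 2) ^+ 3))%:C.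
Proof.
move=> eta0; case: y => a b.
pose x t : C := (cos t * a + sin t * b)%:C - 0 +i* eta.
have E t : N2q P Q (0 +i* eta) t (0, (a, b)) i j = ((x t)^-1 * (x t)^-1) *+ (i == j).
  rewrite /N2q; have -> : Mq P Q (0 +i* eta) t (0, (a, b)) = (x t)%:M.
    by rewrite Mq_comm0 /= scale0r addr0 /x; congr (_%:M); rewrite rmorphD !rmorphM.
  by rewrite invmx_scalar -scalar_mxM mxE.
transitivity (CI 0 (2 * pi) (fun t => ((x t)^-1 * (x t)^-1) *+ (i == j))).
  by apply: eq_CI => t _; exact: E.
have [_|_] := eqVneq i j; last by rewrite mul0r CI0.
by rewrite mul1r -circle_integral.
Qed.

Lemma kernel_initial (eps : R) i j (y : R * R) : 0 < eps ->
  kernel eps (Bq P (0, y)) (Dq Q (0, y)) i j = ((i == j)%:R * - poisson eps y)%:C.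
Proof.
move=> e0; have en : eps != 0 by rewrite gt_eqF.
rewrite (kernelE hP hQ) // !kern_initial ?oppr_eq0 // normrN sqrrN gtr0_norm //.
by rewrite -rmorphD /=; congr (_%:C); rewrite /poisson; ring.
Qed.

End InitialKernel.

(** * Concentration of the Poisson kernel *)

Section RealEstimates.
Variable R : realType.
Local Notation V := (spacetime R).

Lemma lipschitz_of_derive (h h' : R -> R) (L a b : R) :
  (forall x, is_derive x (1 : R) h (h' x)) -> (forall x, `|h' x| <= L) ->
  `|h b - h a| <= L * `|b - a|.
Proof.
move=> dh hL; wlog ab : a b / a <= b => [H|].
  have [ab|/ltW ba] := leP a b; first exact: H.
  by rewrite distrC [X in _ * X]distrC; exact: H.
have ch : {within `[a, b], continuous h}.
  by apply: contonE => x _; exact: derive_cts (dh x).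
have [c _ ->] := MVT_segment ab (fun x _ => dh x) ch.
by rewrite normrM ler_wpM2r.
Qed.

Lemma RI_subset (a b c d : R) (f : R -> R) : a <= c -> c <= d -> d <= b -> continuous f ->
  (forall x, 0 <= f x) -> RI c d f <= RI a b f.
Proof.
move=> ac cd db cf f0.
have sub : `[c, d] `<=` `[a, b].
  by move=> x /=; rewrite !in_itv /= => /andP[cx xd]; rewrite (le_trans ac cx) (le_trans xd db).
have i1 := RI_integrable (continuous_conton (a := a) (b := b) cf).
have i2 := RI_integrable (continuous_conton (a := c) (b := d) cf).
rewrite /RI /Rintegral fine_le ?integrable_fin_num //.
apply: ge0_subset_integral => //.
- by have /integrableP [] := i1.
- by move=> x _; rewrite lee_fin.
Qed.

Section Poisson.
Variables (eps B : R).
Hypotheses (eps0 : 0 < eps) (B0 : 0 < B).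

Let rho (y : R * R) := Num.sqrt (y.1 ^+ 2 + y.2 ^+ 2 + eps ^+ 2).

Lemma rho2_gt0 (y : R * R) : 0 < y.1 ^+ 2 + y.2 ^+ 2 + eps ^+ 2.
Proof. by rewrite ltr_wpDl ?exprn_gt0 // addr_ge0 // sqr_ge0. Qed.

Lemma rho_gt0 y : 0 < rho y.
Proof. by rewrite sqrtr_gt0 rho2_gt0. Qed.

Lemma rho_sqr y : rho y ^+ 2 = y.1 ^+ 2 + y.2 ^+ 2 + eps ^+ 2.
Proof. by rewrite sqr_sqrtr // ltW // rho2_gt0. Qed.

Lemma poisson_gt0 y : 0 < poisson eps y.
Proof.
by rewrite /poisson divr_gt0 ?exprn_gt0 ?rho_gt0 // mulr_gt0 // mulr_gt0 // pi_gt0.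
Qed.

Lemma poisson_cts : continuous (poisson eps).
Proof.
move=> y; apply: cvgM; first exact: cvg_cst.
have c1 : {for y, continuous (fun y : R * R => y.1)} by exact: cvg_fst.
have c2 : {for y, continuous (fun y : R * R => y.2)} by exact: cvg_snd.
have c : {for y, continuous rho}.
  apply: (@continuous_comp _ _ _ (fun y : R * R => y.1 * y.1 + y.2 * y.2 + eps ^+ 2) Num.sqrt).
    exact: (cvgD (cvgD (cvgM c1 c1) (cvgM c2 c2)) (cvg_cst _)).
  exact: sqrt_continuous.
have c3 : {for y, continuous (fun y => rho y * (rho y * rho y))} := cvgM c (cvgM c c).
have E : (fun y => rho y ^+ 3) = (fun y => rho y * (rho y * rho y)).
  by apply/funext => z; rewrite !exprS expr0 mulr1.
apply: (@cvgV _ _ _ _ (fun y => rho y ^+ 3)); first by rewrite gt_eqF // exprn_gt0 // rho_gt0.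
have c4 : {for y, continuous (fun y => rho y ^+ 3)} by rewrite E; exact: c3.
exact: c4.
Qed.

Lemma norm1_le_rho (y : R * R) : `|y.1| + `|y.2| <= 2 * rho y.
Proof.
have h (x : R) : x ^+ 2 <= rho y ^+ 2 -> `|x| <= rho y.
  by rewrite -real_normK ?num_real // ler_pXn2r ?nnegrE // ltW // rho_gt0.
have h1 : `|y.1| <= rho y.
  by apply: h; rewrite rho_sqr; have := sqr_ge0 y.2; have := sqr_ge0 eps; lra.
have h2 : `|y.2| <= rho y.
  by apply: h; rewrite rho_sqr; have := sqr_ge0 y.1; have := sqr_ge0 eps; lra.
lra.
Qed.

(** Of the four factors |y1| + |y2|, three are absorbed by the cube of rho in the denominator and
    one is at most 2B; the factor eps is left over. *)
Lemma poisson_moment (y : R * R) : `|y.1| <= B -> `|y.2| <= B ->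
  (`|y.1| + `|y.2|) ^+ 4 * poisson eps y <= 64 * pi * B * eps.
Proof.
move=> y1 y2; set u := _ + _.
have u0 : 0 <= u by rewrite addr_ge0.
have uB : u <= 2 * B by rewrite /u; lra.
have r0 := rho_gt0 y.
have u3 : u ^+ 3 <= (2 * rho y) ^+ 3.
  by rewrite ler_pXn2r ?nnegrE //; [exact: norm1_le_rho | rewrite mulr_ge0 // ltW].
have p0 : 0 <= 4 * pi * eps by rewrite mulr_ge0 ?mulr_ge0 ?pi_ge0 // ltW.
rewrite /poisson -/(rho y) mulrA ler_pdivrMr ?exprn_gt0 //.
have -> : 64 * pi * B * eps * rho y ^+ 3 = (2 * B) * ((2 * rho y) ^+ 3) * (4 * pi * eps).
  by ring.
rewrite ler_wpM2r // exprS ler_pM // exprn_ge0 //.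
Qed.

Definition poisson_mass := I2 (- B) B (- B) B (poisson eps).

(** On the square of half-width eps one has rho <= 2 eps, so the kernel is at least pi/(2 eps^2) on
    an area 4 eps^2. All that matters is a lower bound independent of eps. *)
Lemma poisson_mass_ge : eps <= B -> 2 * pi <= poisson_mass.
Proof.
move=> eB; have BB : - B <= B by move: B0; lra.
have ee : - eps <= eps by move: eps0; lra.
have Be : - B <= - eps by move: eB; lra.
have cp := poisson_cts.
have pge y : 0 <= poisson eps y by exact: ltW (poisson_gt0 y).
have cslice x : continuous (fun y => poisson eps (x, y)) := cts_slice (w := x) cp.
have cin : continuous (fun x => RI (- B) B (fun y => poisson eps (x, y))) := cts_RI cp BB.
have RIge0 x a b : a <= b -> 0 <= RI a b (fun y => poisson eps (x, y)).
  move=> ab; rewrite -(RI0 a b); apply: le_RI => //.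
  - by move=> y _; exact: cvg_cst.
  - by apply: continuous_conton.
apply: (@le_trans _ _ (I2 (- eps) eps (- eps) eps (fun=> pi / (2 * eps ^+ 2)))).
  rewrite /I2 !RI_cst //.
  have -> // : pi / (2 * eps ^+ 2) * (eps - - eps) * (eps - - eps) = 2 * pi.
  by field; rewrite gt_eqF.
apply: (@le_trans _ _ (I2 (- eps) eps (- eps) eps (poisson eps))).
  apply: le_I2 => //; first exact: cst_continuous.
  move=> x y xe ye; rewrite /poisson /=.
  set r := Num.sqrt _; have r0 : 0 < r := rho_gt0 (x, y).
  have r2 : r ^+ 2 <= (2 * eps) ^+ 2.
    rewrite (rho_sqr (x, y)) /=.
    have s (z : R) : - eps <= z <= eps -> z ^+ 2 <= eps ^+ 2.
      by move=> ze; rewrite -real_normK ?num_real // ler_pXn2r ?nnegrE ?ler_norml // ltW.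
    have := s _ xe; have := s _ ye; rewrite exprMn; have := sqr_ge0 eps.
    move: (x ^+ 2) (y ^+ 2) (eps ^+ 2) => a b c; lra.
  have e2 : 0 <= 2 * eps by rewrite mulr_ge0 // ltW.
  have re : r <= 2 * eps by move: r2; rewrite ler_pXn2r ?nnegrE // ltW.
  have r3 : r ^+ 3 <= (2 * eps) ^+ 3 by rewrite ler_pXn2r ?nnegrE // ltW.
  rewrite ler_pdivlMr ?exprn_gt0 //.
  have -> : 4 * pi * eps = pi / (2 * eps ^+ 2) * (2 * eps) ^+ 3 by field; rewrite gt_eqF.
  by rewrite ler_wpM2l // divr_ge0 ?pi_ge0 // mulr_ge0 // sqr_ge0.
rewrite /poisson_mass /I2.
apply: (@le_trans _ _ (RI (- eps) eps (fun x => RI (- B) B (fun y => poisson eps (x, y))))).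
  apply: le_RI.
  - exact: cts_I2_inner.
  - exact: cts_I2_inner.
  - by move=> x _; apply: RI_subset.
by apply: RI_subset => // x; exact: RIge0.
Qed.

(** The Lipschitz bound reduces the defect to the first moment of the kernel, which is split at
    distance [dl]: the near part is at most [dl] times the mass, the far part is controlled by the
    fourth moment. *)
Lemma poisson_average (g : R * R -> R) (L dl : R) : continuous g -> 0 <= L -> 0 < dl ->
  (forall y, `|g y - g (0, 0)| <= L * (`|y.1| + `|y.2|)) ->
  `|I2 (- B) B (- B) B (fun y => g y * poisson eps y) - g (0, 0) * poisson_mass| <=
  L * dl * poisson_mass + L * (64 * pi * B * eps / dl ^+ 3) * (2 * B) ^+ 2.
Proof.
move=> cg L0 dl0 gL; have BB : - B <= B by move: B0; lra.
have cp := poisson_cts.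
have cgp : continuous (fun y => g y * poisson eps y).
  by move=> y; apply: cvgM; [exact: cg | exact: cp].
have cd : continuous (fun y => (g y - g (0, 0)) * poisson eps y).
  by move=> y; apply: cvgM; [apply: cvgB; [exact: cg | exact: cvg_cst] | exact: cp].
pose M := L * (64 * pi * B * eps / dl ^+ 3).
pose G y := L * dl * poisson eps y + M.
have cLp : continuous (fun y => L * dl * poisson eps y).
  by move=> y; apply: cvgM; [exact: cvg_cst | exact: cp].
have cG : continuous G by move=> y; apply: cvgD; [exact: cLp | exact: cvg_cst].
have IG : I2 (- B) B (- B) B G = L * dl * poisson_mass + M * (2 * B) ^+ 2.
  have cM : continuous (fun _ : R * R => M) by exact: cst_continuous.
  transitivity (I2 (- B) B (- B) B (fun y => L * dl * poisson eps y) + I2 (- B) B (- B) B (fun=> M)).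
    exact: (I2D (- B) B BB cLp cM).
  rewrite (I2Z (- B) B (L * dl) BB cp) -/poisson_mass; congr (_ + _).
  by rewrite /I2 !RI_cst //; ring.
have -> : I2 (- B) B (- B) B (fun y => g y * poisson eps y) - g (0, 0) * poisson_mass =
    I2 (- B) B (- B) B (fun y => (g y - g (0, 0)) * poisson eps y).
  rewrite (@eq_I2 _ _ _ _ _ (fun y => (g y - g (0, 0)) * poisson eps y)
    (fun y => g y * poisson eps y + - g (0, 0) * poisson eps y)); last by move=> x y _ _; ring.
  rewrite (@I2D _ _ _ _ _ (fun y => g y * poisson eps y) (fun y => - g (0, 0) * poisson eps y)) //; last first.
    by move=> y; apply: cvgM; [exact: cvg_cst | exact: cp].
  by rewrite I2Z // mulNr.
rewrite -/M -IG.
have key x y : - B <= x <= B -> - B <= y <= B -> `|(g (x, y) - g (0, 0)) * poisson eps (x, y)| <= G (x, y).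
  move=> xB yB; rewrite normrM (gtr0_norm (poisson_gt0 _)).
  set p := poisson eps (x, y); have p0 : 0 < p := poisson_gt0 _.
  set u := `|x| + `|y|.
  have u0 : 0 <= u by rewrite addr_ge0.
  have um : u ^+ 4 * p <= 64 * pi * B * eps by apply: (@poisson_moment (x, y)); rewrite ler_norml.
  apply: (@le_trans _ _ (L * u * p)); first by rewrite ler_wpM2r ?(ltW p0) //; exact: (gL (x, y)).
  rewrite /G /M -/p; move: um; move: p p0 (64 * pi * B * eps) => p' p0' K um.
  have -> : L * dl * p' + L * (K / dl ^+ 3) = L * (dl * p' + K / dl ^+ 3) by ring.
  rewrite -mulrA ler_wpM2l //.
  (* Either u <= dl, or u^4 / dl^3 >= u. *)
  have ud : u <= dl + u ^+ 4 / dl ^+ 3.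
    have [le|lt] := leP u dl; first by rewrite (le_trans le) // lerDl divr_ge0 ?exprn_ge0 // ltW.
    apply: (@le_trans _ _ (u ^+ 4 / dl ^+ 3)); last by rewrite lerDr ltW.
    rewrite ler_pdivlMr ?exprn_gt0 // [u ^+ 4]exprS ler_wpM2l // ler_pXn2r ?nnegrE //; exact: ltW.
  apply: (@le_trans _ _ ((dl + u ^+ 4 / dl ^+ 3) * p')); first by rewrite ler_wpM2r // ltW.
  by rewrite mulrDl lerD2l mulrAC ler_wpM2r // invr_ge0 exprn_ge0 // ltW.
rewrite ler_norml; apply/andP; split; last first.
  apply: le_I2 => // x y xB yB; exact: le_trans (ler_norm _) (key x y xB yB).
rewrite -mulN1r -I2Z //; apply: le_I2 => //.
  by move=> y; apply: cvgM; [exact: cvg_cst | exact: cG].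
move=> x y xB yB; rewrite mulN1r lerNl; apply: le_trans (key x y xB yB).
by rewrite -normrN ler_norm.
Qed.

End Poisson.

End RealEstimates.

(** * Test functions in boxes and their averages against a kernel *)

Section BoxSupport.
Variable R : realType.
Local Notation V := (spacetime R).

Definition box (r : R) : set V := `[- r, r] `*` (`[- r, r] `*` `[- r, r]).

Lemma box_compact r : compact (box r).
Proof. by apply: compact_setX; [|apply: compact_setX]; exact: segment_compact. Qed.

Lemma box_closed r : closed (box r).
Proof. apply: compact_closed; [exact: norm_hausdorff | exact: box_compact]. Qed.

Lemma boxP r (p : V) : box r p <-> [/\ `|p.1| <= r, `|p.2.1| <= r & `|p.2.2| <= r].
Proof.
split; first by move=> [h1 [h2 h3]]; move: h1 h2 h3; rewrite /= !in_itv /= -!ler_norml.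
by move=> [h1 h2 h3]; split; [|split]; rewrite /= in_itv /= -ler_norml.
Qed.

Lemma box_ge0 r p : box r p -> 0 <= r.
Proof. by move=> /boxP [h _ _]; exact: le_trans (normr_ge0 _) h. Qed.

Lemma box_sub r r' (p q : V) : box r (p + q) -> box r' q -> box (r + r') p.
Proof.
move=> /boxP [h1 h2 h3] /boxP [k1 k2 k3]; apply/boxP.
have key (a b : R) : `|a + b| <= r -> `|b| <= r' -> `|a| <= r + r'.
  move=> ab br; rewrite -[a](addrK b); apply: le_trans (ler_normB _ _) _.
  exact: lerD.
by split; [exact: key h1 k1 | exact: key h2 k2 | exact: key h3 k3].
Qed.

Lemma compact_box (K : set V) : compact K -> exists2 r, 0 < r & K `<=` box r.
Proof.
move=> /compact_bounded [M [Mr HM]].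
exists (`|M| + 1); first by rewrite ltr_wpDl.
move=> p Kp; apply/boxP.
have := HM (`|M| + 1) _ p Kp; rewrite /= !prod_normE !ge_max => h.
have /h /and3P [h1 h2 h3] : M < `|M| + 1 by rewrite (le_lt_trans (ler_norm _)) // ltrDl.
by split.
Qed.

(** Supports are tracked by cubes, so that one continuity bound for E serves all functions built
    from f. *)
Definition boxed (r : R) (f : V -> R) := smooth_on setT f /\ forall p, ~ box r p -> f p = 0.

Lemma boxed_supp r f : boxed r f -> supp f `<=` box r.
Proof.
move=> [_ f0] p cp; apply: box_closed; apply: closure_subset cp => q /= fq.
by apply: contrapT => /f0 E; move: fq; rewrite E eqxx.
Qed.

Lemma boxed_test r f : boxed r f -> test_function f.
Proof.
move=> bf; split; first by case: bf.
by apply: subclosed_compact (boxed_supp bf); [exact: closed_closure | exact: box_compact].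
Qed.

Lemma test_boxed f : test_function f -> exists2 r, 0 < r & boxed r f.
Proof.
move=> [sf /compact_box [r r0 H]]; exists r => //; split=> // p np.
apply/eqP/negPn/negP => fp; apply: np; apply: H; exact: subset_closure.
Qed.

Lemma boxed_widen r r' f : r <= r' -> boxed r f -> boxed r' f.
Proof.
move=> rr [sf f0]; split=> // p np; apply: f0 => /boxP [h1 h2 h3]; apply: np.
by apply/boxP; split; apply: le_trans rr.
Qed.

Lemma pds_rcons s (k : 'I_3) (f : V -> R) : pds (rcons s k) f = pds s (pd k f).
Proof. by rewrite /pds foldr_rcons. Qed.

Lemma boxed_pd r k f : boxed r f -> boxed r (pd k f).
Proof.
move=> [sf f0]; split; first by move=> s p _; rewrite -pds_rcons; exact: sf.
move=> p np.
have nf : \forall q \near p, f q = 0.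
  have : nbhs p (~` box r) by apply: open_nbhs_nbhs; split => //; exact: closed_openC (@box_closed r).
  by apply: filterS => q; exact: f0.
rewrite /pd (near_eq_derive (g := fun=> 0) _ nf).
by have [_ ->] := dcst (0 : R) p (axis R k).
Qed.

Lemma boxed_bounded r f : boxed r f -> exists2 M, 0 <= M & forall p, `|f p| <= M.
Proof.
move=> [sf f0].
have cf : continuous f by exact: (smooth_cts (s := [::]) sf).
have : compact (f @` box r).
  by apply: continuous_compact; [exact: continuous_subspaceT | exact: box_compact].
move=> /compact_bounded [M [Mr HM]]; exists (`|M| + 1); first by rewrite addr_ge0.
move=> p; have [bp|np] := pselect (box r p); last by rewrite f0 // normr0 addr_ge0.
apply: (HM (`|M| + 1)); last by exists p.
by rewrite (le_lt_trans (ler_norm _)) // ltrDl.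
Qed.

Lemma boxed_pds_bounded r f k : boxed r f ->
  exists2 M, 0 <= M & forall s p, (size s <= k)%N -> `|pds s f p| <= M.
Proof.
elim: k f => [|k ih] f bf.
  have [M M0 HM] := boxed_bounded bf; exists M => // -[|//] p _; exact: HM.
have [M M0 HM] := boxed_bounded bf.
have /choice [N HN] : forall a : 'I_3, exists N, 0 <= N /\
    forall s p, (size s <= k)%N -> `|pds s (pd a f) p| <= N.
  by move=> a; have [N N0 HN] := ih _ (boxed_pd a bf); exists N.
exists (M + \sum_a N a); first by rewrite addr_ge0 // sumr_ge0 // => a _; case: (HN a).
move=> s p; case/lastP: s => [_|s a]; first by rewrite (le_trans (HM p)) // lerDl sumr_ge0 // => a _; case: (HN a).
rewrite size_rcons ltnS pds_rcons => sk; have [_ /(_ s p sk) h] := HN a.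
apply: (le_trans h); rewrite (bigD1 a) //= addrA [M + _]addrC -addrA lerDl addr_ge0 //.
by rewrite sumr_ge0 // => b _; case: (HN b).
Qed.

Lemma boxed_pds r s f : boxed r f -> boxed r (pds s f).
Proof. by elim: s => [//|a s ih] /ih; exact: boxed_pd. Qed.

Section Average.
Variables (r r' : R) (f : V -> R) (sig : R * R -> V) (a b c d : R).
Hypotheses (bf : boxed r f) (csig : continuous sig) (ab : a <= b) (cd : c <= d).
Hypothesis sig_box : forall x y, a <= x <= b -> c <= y <= d -> box r' (sig (x, y)).

(** The average of translates of [g] over a two-dimensional face parametrised by [sig], with weight
    [k]; these arise as boundary terms. *)
Definition face (g k : V -> R) (sig : R * R -> V) (a b c d : R) : V -> R :=
  fun p => I2 a b c d (fun z => g (p + sig z) * k (sig z)).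

Lemma face_fam k : continuous k -> smooth_fam (fun z p => f (p + sig z) * k (sig z)).
Proof.
move=> ck; have [sf _] := bf.
exact: (smooth_fam_reparam (phi := sig) csig (smooth_fam_conv sf ck)).
Qed.

Lemma pds_face k s : continuous k ->
  pds s (face f k sig a b c d) = face (pds s f) k sig a b c d.
Proof.
move=> ck; have [_ E] := smooth_fam_I2 ab cd (face_fam ck); apply: etrans (E s) _.
apply/funext => p; apply: eq_I2 => x y _ _.
by have [sf _] := bf; rewrite pds_translate_scale.
Qed.

Lemma face_zero k p : ~ box (r + r') p -> face f k sig a b c d p = 0.
Proof.
move=> np; rewrite /face (@eq_I2 _ _ _ _ _ _ (fun=> 0)); first by rewrite /I2 !RI_cst // !mul0r.
move=> x y xab ycd; have [_ f0] := bf.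
rewrite f0 ?mul0r // => h; apply: np; exact: box_sub h (sig_box xab ycd).
Qed.

Lemma face_boxed k : continuous k -> boxed (r + r') (face f k sig a b c d).
Proof.
move=> ck; split; first by have [] := smooth_fam_I2 ab cd (face_fam ck).
by move=> p; exact: face_zero.
Qed.

Lemma face_bound k m M : continuous k -> (forall p, `|f p| <= M) ->
  (forall x y, a <= x <= b -> c <= y <= d -> `|k (sig (x, y))| <= m) ->
  forall p, `|face f k sig a b c d p| <= M * m * (d - c) * (b - a).
Proof.
move=> ck fM km p; apply: I2_bound => //.
  have [sf _] := bf; have cf : continuous f := smooth_cts (s := [::]) sf.
  move=> z; apply: cvgM.
    apply: (@continuous_comp _ _ _ (fun z => p + sig z) f); last exact: cf.
    by apply: cvgD; [exact: cvg_cst | exact: csig].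
  by apply: (@continuous_comp _ _ _ sig k); [exact: csig | exact: ck].
by move=> x y xab ycd; rewrite normrM ler_pM // km.
Qed.

End Average.

Lemma cts_conv (f k : V -> R) (p : V) : continuous f -> continuous k -> continuous (fun q => f (p + q) * k q).
Proof.
move=> cf ck q; apply: cvgM; last exact: ck.
apply: (@continuous_comp _ _ _ (fun z => p + z) f); last exact: cf.
by apply: cvgD; [exact: cvg_cst | exact: cvg_id].
Qed.

(** A correlation of [f] with [k] over the box [0, T] x [-B, B]^2: a smooth function of p however
    rough [k] is, since derivatives fall on [f]. *)
Definition conv3 (f : V -> R) (T B : R) (k : V -> R) : V -> R :=
  fun p => I3 T B (fun q => f (p + q) * k q).

Section Convolution.
Variables (r : R) (f : V -> R) (T B : R).
Hypotheses (bf : boxed r f) (T0 : 0 < T) (B0 : 0 < B).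

Lemma pds_conv3 k s : continuous k -> pds s (conv3 f T B k) = conv3 (pds s f) T B k.
Proof.
move=> ck; have [sf _] := bf.
have [_ E] := smooth_fam_I3 (ltW T0) (ltW B0) (smooth_fam_conv sf ck).
apply: etrans (E s) _; apply/funext => p; apply: eq_I3 => t x y _ _ _.
by rewrite pds_translate_scale.
Qed.

Lemma conv3_boxed k : continuous k -> boxed (r + (T + B)) (conv3 f T B k).
Proof.
move=> ck; have [sf f0] := bf; split.
  by have [] := smooth_fam_I3 (ltW T0) (ltW B0) (smooth_fam_conv sf ck).
move=> p np; rewrite /conv3 (@eq_I3 _ _ _ _ (fun=> 0)).
  by rewrite /I3 /I2 !RI0.
move=> t x y tI xI yI; rewrite f0 ?mul0r // => h; apply: np; apply: (box_sub h).
have TB : T <= T + B by rewrite lerDl ltW.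
have BT : B <= T + B by rewrite lerDr ltW.
apply/boxP; split; rewrite /= ler_norml.
- by move: tI TB; lra.
- by move: xI BT; lra.
- by move: yI BT; lra.
Qed.

Lemma conv3_lin (k k' : V -> R) (c : R) : continuous k -> continuous k' ->
  conv3 f T B (fun q => c * k q + k' q) = (fun p => c * conv3 f T B k p + conv3 f T B k' p).
Proof.
move=> ck ck'; have [sf _] := bf; have cf : continuous f := smooth_cts (s := [::]) sf.
apply/funext => p; rewrite /conv3 -(I3Z T c (ltW B0) (cts_conv (p := p) cf ck)).
have c1 : continuous (fun q => c * (f (p + q) * k q)).
  by move=> q; apply: cvgM; [exact: cvg_cst | exact: cts_conv].
rewrite -(I3D T (ltW B0) c1 (cts_conv (p := p) cf ck')).
by apply: eq_I3 => t x y _ _ _; ring.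
Qed.

Section ByParts.
Variables (k : V -> R) (k' : 'I_3 -> V -> R).
Hypotheses (ck : continuous k) (ck' : forall a, continuous (k' a)).
Hypothesis dk : forall a q, is_derive q (axis R a) k (k' a q).

Let G (p q : V) := f (p + q) * k q.
Let G' (p : V) a (q : V) := pd a f (p + q) * k q + f (p + q) * k' a q.

Lemma conv3_dG (p : V) a (q : V) : is_derive q (axis R a) (G p) (G' p a q).
Proof.
have [sf _] := bf; have D := smooth_derive [::] (q + p) a sf.
have D' := is_derive_shift D.
have E : (fun x => pds [::] f (x + p)) = (fun x => f (p + x)) by apply/funext => x; rewrite addrC.
rewrite E in D'; apply: eq_derive_val (dM D' (dk a q)) _.
by rewrite /G' addrC [q + p]addrC addrC.
Qed.

Lemma conv3_cG p : continuous (G p).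
Proof. by have [sf _] := bf; apply: cts_conv => //; exact: (smooth_cts (s := [::]) sf). Qed.

Lemma conv3_cG' p a : continuous (G' p a).
Proof.
have [sf _] := bf => q; apply: cvgD.
  by apply: cts_conv => //; exact: (smooth_cts (s := [:: a]) sf).
by apply: cts_conv => //; exact: (smooth_cts (s := [::]) sf).
Qed.

Lemma conv3_split p a : I3 T B (G' p a) = conv3 (pd a f) T B k p + conv3 f T B (k' a) p.
Proof.
have [sf _] := bf; apply: I3D; first exact: ltW.
  by apply: cts_conv => //; exact: (smooth_cts (s := [:: a]) sf).
by apply: cts_conv => //; exact: (smooth_cts (s := [::]) sf).
Qed.

Definition face0 (t : R) (y : R * R) : V := (t, y).
Definition face1 (x : R) (z : R * R) : V := (z.1, (x, z.2)).
Definition face2 (x : R) (z : R * R) : V := (z.1, (z.2, x)).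

Lemma face0_cts t : continuous (face0 t).
Proof. by move=> z; apply: cts_pairing; [exact: cvg_cst | exact: cvg_id]. Qed.
Lemma face1_cts x : continuous (face1 x).
Proof.
move=> z; apply: cts_pairing; first exact: cvg_fst.
by apply: cts_pairing; [exact: cvg_cst | exact: cvg_snd].
Qed.
Lemma face2_cts x : continuous (face2 x).
Proof.
move=> z; apply: cts_pairing; first exact: cvg_fst.
by apply: cts_pairing; [exact: cvg_snd | exact: cvg_cst].
Qed.

(** As f(p + q) depends only on the sum, its p-derivative is a q-derivative, and integration by
    parts moves it onto [k] at the cost of the faces q.1 = T and q.1 = 0. *)
Lemma pd0_conv3 : pd 0 (conv3 f T B k) = fun p =>
  face f k (face0 T) (- B) B (- B) B p - face f k (face0 0) (- B) B (- B) B p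
  - conv3 f T B (k' 0) p.
Proof.
rewrite -[LHS]/(pds [:: 0] (conv3 f T B k)) (pds_conv3 _ ck); apply/funext => p.
apply: (addIr (conv3 f T B (k' 0) p)); rewrite subrK; apply: etrans (esym (conv3_split p 0)) _.
exact: (I3_pd0 T0 B0 (conv3_cG (p := p)) (fun a => conv3_cG' (p := p) (a := a)) (conv3_dG p)).
Qed.

Lemma pd1_conv3 : pd 1 (conv3 f T B k) = fun p =>
  face f k (face1 B) 0 T (- B) B p - face f k (face1 (- B)) 0 T (- B) B p
  - conv3 f T B (k' 1) p.
Proof.
rewrite -[LHS]/(pds [:: 1] (conv3 f T B k)) (pds_conv3 _ ck); apply/funext => p.
apply: (addIr (conv3 f T B (k' 1) p)); rewrite subrK; apply: etrans (esym (conv3_split p 1)) _.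
have E := I3_pd1 T B0 (conv3_cG (p := p)) (fun a => conv3_cG' (p := p) (a := a)) (conv3_dG p).
apply: etrans E _; have BB : - B <= B by move: B0; lra.
have c1 x : continuous (fun z => G p (face1 x z)) := cts_face1 (x := x) (conv3_cG (p := p)).
have cN : continuous (fun z => -1 * G p (face1 (- B) z)).
  by move=> z; apply: cvgM; [exact: cvg_cst | exact: c1].
apply: etrans (_ : I2 0 T (- B) B (fun z => G p (face1 B z) + -1 * G p (face1 (- B) z)) = _).
  by apply: eq_I2 => x y _ _; rewrite mulN1r.
by rewrite (I2D 0 T BB (c1 B) cN) (I2Z 0 T (-1) BB (c1 (- B))) mulN1r.
Qed.

Lemma pd2_conv3 : pd 2%R (conv3 f T B k) = fun p =>
  face f k (face2 B) 0 T (- B) B p - face f k (face2 (- B)) 0 T (- B) B p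
  - conv3 f T B (k' 2%R) p.
Proof.
rewrite -[LHS]/(pds [:: 2%R] (conv3 f T B k)) (pds_conv3 _ ck); apply/funext => p.
apply: (addIr (conv3 f T B (k' 2%R) p)); rewrite subrK; apply: etrans (esym (conv3_split p 2%R)) _.
have E := I3_pd2 T B0 (fun a => conv3_cG' (p := p) (a := a)) (conv3_dG p).
apply: etrans E _; have BB : - B <= B by move: B0; lra.
have c2 x : continuous (fun z => G p (face2 x z)) := cts_face2 (x := x) (conv3_cG (p := p)).
have cN : continuous (fun z => -1 * G p (face2 (- B) z)).
  by move=> z; apply: cvgM; [exact: cvg_cst | exact: c2].
apply: etrans (_ : I2 0 T (- B) B (fun z => G p (face2 B z) + -1 * G p (face2 (- B) z)) = _).
  by apply: eq_I2 => x y _ _; rewrite mulN1r.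
by rewrite (I2D 0 T BB (c2 B) cN) (I2Z 0 T (-1) BB (c2 (- B))) mulN1r.
Qed.

End ByParts.
End Convolution.
End BoxSupport.

(** * Bounds on complex moduli by reals *)

Section ComplexBounds.
Variable R : realType.
Local Notation C := R[i].
Implicit Types (x y z : C) (a b : R).

Definition cb x a := `|x| <= a%:C.

Lemma cbD x y a b : cb x a -> cb y b -> cb (x + y) (a + b).
Proof. by rewrite /cb => xa yb; rewrite rmorphD /= (le_trans (ler_normD _ _)) // lerD. Qed.

Lemma cbN x a : cb x a -> cb (- x) a.
Proof. by rewrite /cb normrN. Qed.

Lemma cb0 a : 0 <= a -> cb 0 a.
Proof. by rewrite /cb normr0 ler0c. Qed.

Lemma cb_le x a b : cb x a -> a <= b -> cb x b.
Proof. by rewrite /cb => xa ab; rewrite (le_trans xa) // lecR. Qed.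

Lemma cb_ge0 x a : cb x a -> 0 <= a.
Proof. by rewrite /cb => xa; rewrite -ler0c (le_trans (normr_ge0 x)). Qed.

Lemma norm_real_part z : `|z| = (complex.Re `|z|)%:C.
Proof. by rewrite normc_def. Qed.

Lemma cbM z : exists2 c : R, 0 <= c & forall x a, cb x a -> cb (z * x) (c * a).
Proof.
have zE := norm_real_part z.
have z0 : 0 <= complex.Re `|z| by rewrite -ler0c -zE.
exists (complex.Re `|z|) => // x a xa.
by rewrite /cb normrM zE rmorphM /= ler_wpM2l // ler0c.
Qed.

Lemma cb_real c : cb c%:C `|c|.
Proof.
by rewrite /cb normc_def /= expr0n addr0 sqrtr_sqr.
Qed.

Lemma cbZ (c : R) x a : cb x a -> cb (c%:C * x) (`|c| * a).
Proof.
by rewrite /cb => xa; rewrite normrM rmorphM ler_pM //; exact: cb_real.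
Qed.

Lemma cbZi x a : cb x a -> cb ((0 +i* 1) * x) a.
Proof.
rewrite /cb normrM => xa; have -> : `|0 +i* 1 : C| = 1.
  by rewrite normc_def /= expr0n expr1n add0r sqrtr1.
by rewrite mul1r.
Qed.

Lemma cb_sum (I : Type) (r : seq I) (F : I -> C) (a : I -> R) :
  (forall i, cb (F i) (a i)) -> cb (\sum_(i <- r) F i) (\sum_(i <- r) a i).
Proof.
move=> H; elim: r => [|i r ih]; first by rewrite !big_nil; exact: cb0.
by rewrite !big_cons; exact: cbD.
Qed.

Lemma cb_complex a b c : `|a| <= c -> `|b| <= c -> cb (a +i* b) (c + c).
Proof.
move=> ac bc; have -> : a +i* b = a%:C + (0 +i* 1) * b%:C.
  by apply: complexP; rewrite ?(cReD, cImD, cReM, cImM) /=; ring.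
by apply: cbD; [|apply: cbZi]; apply: cb_le (cb_real _) _.
Qed.

Lemma cb_small x K : (forall eta, 0 < eta -> eta < 1 -> cb x (K * eta)) -> x = 0.
Proof.
move=> H; apply/eqP; rewrite -normr_eq0; apply/eqP.
have xE := norm_real_part x.
rewrite xE; congr (_%:C); apply/eqP; rewrite eq_le; apply/andP; split; last first.
  by rewrite -ler0c -xE.
apply/ler_addgt0Pr => e e0; rewrite add0r -lecR -xE.
pose c := `|K| + e + 1; have c0 : 0 < c by rewrite ltr_wpDl // addr_ge0 // ltW.
have ec : 0 < e / c by rewrite divr_gt0.
have ec1 : e / c < 1 by rewrite ltr_pdivrMr // mul1r /c addrAC ltrDr ltr_wpDl.
apply: cb_le (H _ ec ec1) _.
rewrite mulrA ler_pdivrMr // mulrC ler_wpM2l //; first exact: ltW.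
by rewrite /c; have := ler_norm K; lra.
Qed.

End ComplexBounds.

(** * Linearity and finite order of the distribution *)

Section DistributionCalculus.
Variables (R : realType) (n : nat) (E : (spacetime R -> R) -> 'M[R[i]]_n).
Hypothesis dE : is_distribution E.
Local Notation C := R[i].
Local Notation V := (spacetime R).

Lemma E_lin r (a : R) (f g : V -> R) : boxed r f -> boxed r g ->
  E (fun p => a * f p + g p) = a%:C *: E f + E g.
Proof. by move=> bf bg; have [H _] := dE; apply: H; [exact: boxed_test bf | exact: boxed_test bg]. Qed.

Lemma boxed0 r : boxed r (fun _ : V => 0 : R).
Proof.
split=> // s p _; have -> : pds s (fun _ : V => 0 : R) = fun=> 0.
  elim: s => [//|k s ih]; rewrite /= -/(pds s _) ih; apply/funext => q.
  by rewrite /pd; have [_ ->] := dcst (0 : R) q (axis R k).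
by split=> [|k]; [exact: cst_continuous | case: (dcst (0 : R) p (axis R k))].
Qed.

Lemma E0 : E (fun=> 0) = 0.
Proof.
have := E_lin 1 (boxed0 0) (boxed0 0); rewrite scale1r.
have -> : (fun p : V => 1 * (0 : R) + 0) = (fun=> 0) by apply/funext => p; rewrite mulr0 addr0.
by move/eqP; rewrite -subr_eq0 opprD addrA subrr sub0r oppr_eq0 => /eqP.
Qed.

Lemma E_scale r (a : R) (f : V -> R) : boxed r f -> E (fun p => a * f p) = a%:C *: E f.
Proof.
move=> bf; rewrite -[RHS]addr0 -E0 -(E_lin a bf (boxed0 r)); congr (E _).
by apply/funext => p; rewrite addr0.
Qed.

Lemma E_sub r (f g : V -> R) : boxed r f -> boxed r g -> E (fun p => f p - g p) = E f - E g.
Proof.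
move=> bf bg; have := E_lin (-1) bg bf.
have -> : (fun p => -1 * g p + f p) = (fun p => f p - g p) by apply/funext => p; ring.
by move=> ->; rewrite rmorphN scaleN1r addrC.
Qed.

Lemma E_bound r : exists C0 k, 0 <= C0 /\ forall f M, boxed r f ->
  (forall s p, (size s <= k)%N -> `|pds s f p| <= M) -> forall i j, cb (E f i j) (C0 * M).
Proof.
have [_ /(_ _ (box_compact (R := R) (r := r)))] := dE.
move=> [C0 [k H]]; exists `|C0|, k; split=> // f M bf HM i j.
have M0 : 0 <= M by apply: le_trans (HM [::] (0, (0, 0)) isT); exact: normr_ge0.
apply: (@cb_le _ _ (C0 * M)); last by rewrite ler_wpM2r // ler_norm.
by apply: H HM _ _; [exact: boxed_test bf | exact: boxed_supp].
Qed.

End DistributionCalculus.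

Section SmoothLinear.
Variable R : realType.
Local Notation V := (spacetime R).

Lemma pds_lin s (a : R) (f g : V -> R) : smooth_on setT f -> smooth_on setT g ->
  pds s (fun p => a * f p + g p) = (fun p => a * pds s f p + pds s g p).
Proof.
move=> sf sg; elim: s => [//|k s ih].
rewrite /= -!/(pds s _) ih; apply/funext => p.
have [_ E] := dD (dM (dcst a p (axis R k)) (smooth_derive s p k sf)) (smooth_derive s p k sg).
by apply: etrans E _; rewrite mul0r add0r.
Qed.

Lemma smooth_lin (a : R) (f g : V -> R) : smooth_on setT f -> smooth_on setT g ->
  smooth_on setT (fun p => a * f p + g p).
Proof.
move=> sf sg s p _; rewrite pds_lin //; split.
  apply: cvgD; last exact: smooth_cts.
  by apply: cvgM; [exact: cvg_cst | exact: smooth_cts].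
move=> k.
by have [] := dD (dM (dcst a p (axis R k)) (smooth_derive s p k sf)) (smooth_derive s p k sg).
Qed.

Lemma boxed_lin r (a : R) (f g : V -> R) : boxed r f -> boxed r g ->
  boxed r (fun p => a * f p + g p).
Proof.
move=> [sf f0] [sg g0]; split; first exact: smooth_lin.
by move=> p np; rewrite f0 // g0 // mulr0 addr0.
Qed.

Lemma boxed_sub r (f g : V -> R) : boxed r f -> boxed r g -> boxed r (fun p => f p - g p).
Proof.
move=> bf bg; have -> : (fun p => f p - g p) = (fun p => -1 * g p + f p).
  by apply/funext => p; ring.
exact: boxed_lin.
Qed.

End SmoothLinear.

Lemma addr_shuffle (U : zmodType) (a b g s : U) : a + (b + (g + s)) = g + (a + b + s).
Proof. by rewrite [RHS]addrCA -[RHS]addrA. Qed.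

(** * Matrix bookkeeping for the system *)

Section MatrixSystem.
Variables (R : realType) (n : nat) (P Q : 'M[R[i]]_n).
Local Notation C := R[i].

Lemma scale_sub_comb (U : lmodType C) (c : C) (X X' Y Y' : U) :
  (X + c *: X') - (Y + c *: Y') = (X - Y) + c *: (X' - Y').
Proof. by rewrite scalerBr opprD addrACA. Qed.

Lemma system_comb (c : C) (a a' b b' d d' e e' g g' h h' : 'M[C]_n) :
  (a + c *: a' - (e + c *: e')) + P *m (b + c *: b' - (g + c *: g'))
    + Q *m (d + c *: d' - (h + c *: h')) =
  ((a - e) + P *m (b - g) + Q *m (d - h)) +
  c *: ((a' - e') + P *m (b' - g') + Q *m (d' - h')).
Proof.
rewrite (scale_sub_comb c a) (scale_sub_comb c b) (scale_sub_comb c d).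
move: (a - e) (a' - e') (b - g) (b' - g') (d - h) (d' - h') => x x' y y' z z'.
rewrite (mulmxDr P y) (mulmxDr Q z) -(scalemxAr c P y') -(scalemxAr c Q z') !scalerDr.
by rewrite (addrACA x) (addrACA (x + P *m y)).
Qed.

Lemma system_entry (a b c d e g : 'M[C]_n) (s : C) l j :
  (a - d) + P *m (b - e) + Q *m (c - g) = - s%:M ->
  a l j + (P *m b) l j + (Q *m c) l j =
  - (s *+ (l == j)) + (d l j + \sum_k (P l k * e k j + Q l k * g k j)).
Proof.
rewrite !mulmxBr => /matrixP /(_ l j).
rewrite big_split /= !mxE => E.
move: E; set x := \sum_i _; set y := \sum_i _; set z := \sum_i _; set w := \sum_i _.
move: (a l j) (d l j) (s *+ _) => a' d' s' E.
transitivity ((a' - d') + (x - y) + (z - w) + (d' + (y + w))); first by ring.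
by rewrite E.
Qed.

Lemma complex_split (a b : R) : a +i* b = a%:C + (0 +i* 1) * b%:C.
Proof. by apply: complexP; rewrite ?(cReD, cImD, cReM, cImM) /=; ring. Qed.

Lemma neg_scalar_comb (X Y : 'M[C]_n) (a b : R) : X = - a%:C%:M -> Y = - b%:C%:M ->
  X + (0 +i* 1) *: Y = - (a +i* b)%:M.
Proof.
move=> -> ->; rewrite scalerN scale_scalar_mx -opprD complex_split.
by move: (a%:C) (_ * _) => x y; rewrite [(x + y)%:M]raddfD.
Qed.

Lemma system_comb_scalar (a a' b b' d d' e e' g g' h h' : 'M[C]_n) (x y : R) :
  (a - e) + P *m (b - g) + Q *m (d - h) = - x%:C%:M ->
  (a' - e') + P *m (b' - g') + Q *m (d' - h') = - y%:C%:M ->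
  (a + (0 +i* 1) *: a' - (e + (0 +i* 1) *: e')) + P *m (b + (0 +i* 1) *: b' - (g + (0 +i* 1) *: g'))
    + Q *m (d + (0 +i* 1) *: d' - (h + (0 +i* 1) *: h')) = - (x +i* y)%:M.
Proof. by move=> H1 H2; rewrite system_comb; exact: neg_scalar_comb. Qed.

(** With X and Y standing for E applied to boundary and interior terms of the l-th entry of a row of
    the kernel, summing the entries (l, j) forms the matrix product of that row with E. The interior
    terms then regroup into the adjoint system satisfied by the row and cancel. *)
Lemma system_trace (X0 X1 X2 Y0 Y1 Y2 : 'I_n -> 'M[C]_n) (s : 'I_n -> C) j :
  (forall l, (X0 l - Y0 l) + P *m (X1 l - Y1 l) + Q *m (X2 l - Y2 l) = - (s l)%:M) ->
  (forall k, Y0 k + \sum_l (P l k *: Y1 l + Q l k *: Y2 l) = 0) ->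
  \sum_l (X0 l l j + (P *m X1 l) l j + (Q *m X2 l) l j) = - s j.
Proof.
move=> H0 H.
rewrite (eq_bigr _ (fun l _ => system_entry l j (H0 l))) big_split /= (bigD1 j) //= eqxx mulr1n.
rewrite [X in _ + X + _]big1 ?addr0; last by move=> l lj; rewrite (negbTE lj) oppr0.
rewrite -[RHS]addr0; congr (_ + _); rewrite big_split /= exchange_big /= -big_split /=.
apply: big1 => k _; have := congr1 (fun M : 'M[C]_n => M k j) (H k).
rewrite mxE summxE [RHS]mxE => E; apply: etrans E; congr (_ + _).
by apply: eq_bigr => l _; rewrite !mxE.
Qed.

Lemma system_opp (x y z a b c s : 'M[C]_n) : x = a -> y = b -> z = c ->
  - x + P *m (- y) + Q *m (- z) = s -> a + P *m b + Q *m c = - s.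
Proof.
by move=> -> -> -> <-; rewrite (mulmxN _ b) (mulmxN _ c) opprD opprD !opprK.
Qed.

End MatrixSystem.

(** * Integration by parts against E *)

Section FundamentalIdentity.
Variables (R : realType) (n : nat) (A : 'M[R[i]]_n).
Variable E : (spacetime R -> R) -> 'M[R[i]]_n.
Hypothesis HE : fundamental_solution A E.
Local Notation C := R[i].
Local Notation V := (spacetime R).
Variables (r : R) (f : V -> R) (T B : R).
Hypotheses (bf : boxed r f) (T0 : 0 < T) (B0 : 0 < B).

Lemma fundamental_distribution : is_distribution E. Proof. by case: HE. Qed.
Local Notation dE := fundamental_distribution.
Local Notation r1 := (r + (T + B)).

Let BB : - B <= B. Proof. by move: B0; lra. Qed.
Let T0' : 0 <= T. Proof. exact: ltW. Qed.

Lemma face0_box t x y : 0 <= t <= T -> - B <= x <= B -> - B <= y <= B -> box (T + B) (face0 t (x, y)).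
Proof.
move=> tI xI yI; apply/boxP; split; rewrite /= ler_norml; move: tI xI yI T0 B0; lra.
Qed.

Lemma face1_box b t y : - B <= b <= B -> 0 <= t <= T -> - B <= y <= B -> box (T + B) (face1 b (t, y)).
Proof. by move=> bI tI yI; exact: (@face0_box t b y). Qed.

Lemma face2_box b t x : - B <= b <= B -> 0 <= t <= T -> - B <= x <= B -> box (T + B) (face2 b (t, x)).
Proof. by move=> bI tI xI; exact: (@face0_box t x b). Qed.

Lemma face0_boxed t k : 0 <= t <= T -> continuous k ->
  boxed r1 (face f k (face0 t) (- B) B (- B) B).
Proof.
move=> tI ck; apply: (face_boxed bf) => //; first exact: face0_cts.
by move=> x y; exact: face0_box.
Qed.

Lemma face1_boxed b k : - B <= b <= B -> continuous k ->
  boxed r1 (face f k (face1 b) 0 T (- B) B).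
Proof.
move=> bI ck; apply: (face_boxed bf) => //; first exact: face1_cts.
by move=> x y; exact: face1_box.
Qed.

Lemma face2_boxed b k : - B <= b <= B -> continuous k ->
  boxed r1 (face f k (face2 b) 0 T (- B) B).
Proof.
move=> bI ck; apply: (face_boxed bf) => //; first exact: face2_cts.
by move=> x y; exact: face2_box.
Qed.

(** The boundary term in the direction a: the difference of the two opposite faces of the box. *)
Definition bd (a : 'I_3) (k : V -> R) : V -> R := fun p =>
  match val a with
  | 0%N => face f k (face0 T) (- B) B (- B) B p - face f k (face0 0) (- B) B (- B) B p
  | 1%N => face f k (face1 B) 0 T (- B) B p - face f k (face1 (- B)) 0 T (- B) B p
  | _ => face f k (face2 B) 0 T (- B) B p - face f k (face2 (- B)) 0 T (- B) B p
  end.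

Let Bin : - B <= B <= B. Proof. by rewrite BB lexx. Qed.
Let NBin : - B <= - B <= B. Proof. by rewrite BB lexx. Qed.
Let Tin : 0 <= T <= T. Proof. by rewrite T0' lexx. Qed.
Let zin : 0 <= (0 : R) <= T. Proof. by rewrite T0' lexx. Qed.

Lemma bd_boxed a k : continuous k -> boxed r1 (bd a k).
Proof.
move=> ck; case: a => [[|[|m]] i].
- exact: (boxed_sub (face0_boxed Tin ck) (face0_boxed zin ck)).
- exact: (boxed_sub (face1_boxed Bin ck) (face1_boxed NBin ck)).
- exact: (boxed_sub (face2_boxed Bin ck) (face2_boxed NBin ck)).
Qed.

Lemma pd_conv3 (k : V -> R) (k' : 'I_3 -> V -> R) a : continuous k ->
  (forall a, continuous (k' a)) -> (forall a q, is_derive q (axis R a) k (k' a q)) ->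
  pd a (conv3 f T B k) = (fun p => bd a k p - conv3 f T B (k' a) p).
Proof.
move=> ck ck' dk; case: a => [[|[|[|//]]] i].
- have -> : Ordinal i = 0 by exact/val_inj.
  exact: (pd0_conv3 bf T0 B0 ck ck' dk).
- have -> : Ordinal i = 1 by exact/val_inj.
  exact: (pd1_conv3 bf T0 B0 ck ck' dk).
have -> : Ordinal i = 2%R by exact/val_inj.
exact: (pd2_conv3 bf T0 B0 ck ck' dk).
Qed.

Definition Econv k := E (conv3 f T B k).

Lemma Econv_lin (c : R) (k k' : V -> R) : continuous k -> continuous k' ->
  Econv (fun q => c * k q + k' q) = c%:C *: Econv k + Econv k'.
Proof.
move=> ck ck'; rewrite /Econv (conv3_lin T bf B0 c ck ck').
exact: (E_lin dE c (conv3_boxed bf T0 B0 ck) (conv3_boxed bf T0 B0 ck')).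
Qed.

Lemma E_pd_conv3 (k : V -> R) (k' : 'I_3 -> V -> R) a : continuous k ->
  (forall a, continuous (k' a)) -> (forall a q, is_derive q (axis R a) k (k' a q)) ->
  E (pd a (conv3 f T B k)) = E (bd a k) - Econv (k' a).
Proof.
move=> ck ck' dk; rewrite (pd_conv3 a ck ck' dk).
exact: (E_sub dE (bd_boxed a ck) (conv3_boxed bf T0 B0 (@ck' a))).
Qed.

Lemma fundamental_conv3 (k : V -> R) (k' : 'I_3 -> V -> R) : continuous k ->
  (forall a, continuous (k' a)) -> (forall a q, is_derive q (axis R a) k (k' a q)) ->
  (E (bd 0 k) - Econv (k' 0)) + A1 A *m (E (bd 1 k) - Econv (k' 1))
    + A2 A *m (E (bd 2%R k) - Econv (k' 2%R)) = - ((conv3 f T B k (0, (0, 0)))%:C)%:M.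
Proof.
move=> ck ck' dk; have [_ _ H] := HE.
exact: (system_opp (E_pd_conv3 0 ck ck' dk) (E_pd_conv3 1 ck ck' dk) (E_pd_conv3 2%R ck ck' dk)
  (H _ (boxed_test (conv3_boxed bf T0 B0 ck)))).
Qed.

Local Notation ii := (0 +i* 1 : C).
Definition Re_f (k : V -> C) := fun q => complex.Re (k q).
Definition Im_f (k : V -> C) := fun q => complex.Im (k q).
(** E acts on real test functions; complex kernels are handled by complex linearity over their real
    and imaginary parts. *)
Definition EconvC (k : V -> C) := Econv (Re_f k) + ii *: Econv (Im_f k).
Definition EbdC a (k : V -> C) := E (bd a (Re_f k)) + ii *: E (bd a (Im_f k)).
Definition conv0C (k : V -> C) : C :=
  conv3 f T B (Re_f k) (0, (0, 0)) +i* conv3 f T B (Im_f k) (0, (0, 0)).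

Lemma complex_comb (X Y X' Y' : 'M[C]_n) (c : C) :
  (complex.Re c)%:C *: X + ((- complex.Im c)%:C *: Y + X') +
    ii *: ((complex.Re c)%:C *: Y + ((complex.Im c)%:C *: X + Y')) =
  c *: (X + ii *: Y) + (X' + ii *: Y').
Proof.
apply/matrixP => i j; rewrite !mxE.
move: (X i j) (Y i j) (X' i j) (Y' i j) => x y x' y'.
by apply: complexP; rewrite ?(cReD, cImD) ?(cReM, cImM) ?(cReD, cImD) ?(cReM, cImM) /=; ring.
Qed.

Lemma EconvC_lin (c : C) (k k' : V -> C) : (forall q, ccont q k) -> (forall q, ccont q k') ->
  EconvC (fun q => c * k q + k' q) = c *: EconvC k + EconvC k'.
Proof.
move=> ck ck'.
have cr : continuous (Re_f k) by move=> q; case: (ck q).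
have ci : continuous (Im_f k) by move=> q; case: (ck q).
have cr' : continuous (Re_f k') by move=> q; case: (ck' q).
have ci' : continuous (Im_f k') by move=> q; case: (ck' q).
have clin a (u v : V -> R) : continuous u -> continuous v -> continuous (fun q => a * u q + v q).
  by move=> cu cv q; apply: cvgD; [apply: cvgM; [exact: cvg_cst | exact: cu] | exact: cv].
rewrite /EconvC.
have -> : Re_f (fun q => c * k q + k' q) = (fun q => complex.Re c * Re_f k q +
    (- complex.Im c * Im_f k q + Re_f k' q)).
  by apply/funext => q; rewrite /Re_f cReD cReM /Im_f; ring.
have -> : Im_f (fun q => c * k q + k' q) = (fun q => complex.Re c * Im_f k q +
    (complex.Im c * Re_f k q + Im_f k' q)).
  by apply/funext => q; rewrite /Im_f cImD cImM /Re_f; ring.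
rewrite !Econv_lin //; [exact: complex_comb | exact: clin | exact: clin].
Qed.

Lemma EconvC0 : EconvC (fun=> 0) = 0.
Proof.
have c0 : forall q : V, ccont q (fun=> 0 : C) by move=> q; exact: ccont_cst.
have := EconvC_lin 1 c0 c0; rewrite scale1r.
have -> : (fun q : V => 1 * (0 : C) + 0) = (fun=> 0) by apply/funext => p; rewrite mulr0 addr0.
by move/eqP; rewrite -subr_eq0 opprD addrA subrr sub0r oppr_eq0 => /eqP.
Qed.

Lemma EconvC_sum (I : Type) (s : seq I) (a b : I -> C) (u v : I -> V -> C) (g : V -> C) :
  (forall q, ccont q g) -> (forall i q, ccont q (u i)) -> (forall i q, ccont q (v i)) ->
  EconvC (fun q => g q + \sum_(i <- s) (u i q * a i + v i q * b i)) =
  EconvC g + \sum_(i <- s) (a i *: EconvC (u i) + b i *: EconvC (v i)).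
Proof.
move=> cg cu cv; elim: s => [|i s ih].
  rewrite big_nil addr0; congr (EconvC _); apply/funext => q.
  by rewrite big_nil addr0.
have cS : forall q, ccont q (fun q => g q + \sum_(i <- s) (u i q * a i + v i q * b i)).
  move=> q; apply: ccontD => //; apply: ccont_sum => j.
  by apply: ccontD; apply: ccontM => //; exact: ccont_cst.
have cS' : forall q, ccont q (fun q => b i * v i q + (g q + \sum_(i <- s) (u i q * a i + v i q * b i))).
  by move=> q; apply: ccontD => //; apply: ccontM => //; exact: ccont_cst.
have -> : (fun q => g q + \sum_(j <- i :: s) (u j q * a j + v j q * b j)) =
  (fun q => a i * u i q + (b i * v i q + (g q + \sum_(j <- s) (u j q * a j + v j q * b j)))).
  by apply/funext => q; rewrite big_cons; ring.
rewrite (EconvC_lin _ (cu i) cS') (EconvC_lin _ (cv i) cS) ih big_cons.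
exact: addr_shuffle.
Qed.

Section Kernel.
Variables (kap : 'I_n -> V -> C) (kap' : 'I_3 -> 'I_n -> V -> C).
Hypotheses (ck : forall l q, ccont q (kap l)) (ck' : forall a l q, ccont q (kap' a l)).
Hypothesis dk : forall a l q,
  is_derive q (axis R a) (Re_f (kap l)) (Re_f (kap' a l) q) /\
  is_derive q (axis R a) (Im_f (kap l)) (Im_f (kap' a l) q).
Hypothesis sys : forall k q,
  kap' 0 k q + \sum_l (kap' 1 l q * A1 A l k + kap' 2%R l q * A2 A l k) = 0.

Lemma fundamental_row l :
  (EbdC 0 (kap l) - EconvC (kap' 0 l)) + A1 A *m (EbdC 1 (kap l) - EconvC (kap' 1 l))
    + A2 A *m (EbdC 2%R (kap l) - EconvC (kap' 2%R l)) = - (conv0C (kap l))%:M.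
Proof.
have H1 := fundamental_conv3 (k := Re_f (kap l)) (k' := fun a => Re_f (kap' a l))
  (fun q => (ck l q).1) (fun a q => (ck' a l q).1) (fun a q => (dk a l q).1).
have H2 := fundamental_conv3 (k := Im_f (kap l)) (k' := fun a => Im_f (kap' a l))
  (fun q => (ck l q).2) (fun a q => (ck' a l q).2) (fun a q => (dk a l q).2).
exact: system_comb_scalar H1 H2.
Qed.

(** For a row of scalar kernels solving the adjoint system, only the faces of the box and the value
    at the origin, contributed by the delta, survive. *)
Lemma fundamental_trace (j : 'I_n) :
  \sum_l (EbdC 0 (kap l) l j + (A1 A *m EbdC 1 (kap l)) l j + (A2 A *m EbdC 2%R (kap l)) l j) =
  - conv0C (kap j).
Proof.
apply: (system_trace (s := fun l => conv0C (kap l)) j fundamental_row) => k.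
have E1 := EconvC_sum (index_enum 'I_n) (fun l => A1 A l k) (fun l => A2 A l k)
  (ck' 0 k) (fun l => ck' 1 l) (fun l => ck' 2%R l).
apply: etrans (esym E1) _; rewrite -EconvC0; congr EconvC; apply/funext => q; exact: sys.
Qed.

End Kernel.

End FundamentalIdentity.

Section Combinations.
Variables (R : realType) (n : nat).
Local Notation C := R[i].

Lemma sub_of_eq0 (U : zmodType) (x y : U) : x = 0 -> x - y = - y.
Proof. by move=> ->; rewrite sub0r. Qed.

Lemma sum_ord_const (x : R) : \sum_(k < n) x = n%:R * x.
Proof. by rewrite sumr_const card_ord mulr_natl. Qed.

Lemma initial_comb (x y a b F : 'M[C]_n) (c : R) : x = - a -> y = - b ->
  a = (- c)%:C *: F -> b = 0 -> x + (0 +i* 1) *: y = c%:C *: F.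
Proof. by move=> -> -> -> ->; rewrite oppr0 scaler0 addr0 rmorphN scaleNr opprK. Qed.

Lemma trace_solve (F w u v : 'I_n -> C) i s : (forall l, w l = (i == l)%:R%:C * F l) ->
  \sum_l (w l + u l + v l) = - s -> F i = - s - \sum_l (u l + v l).
Proof.
move=> e0 <-; rewrite -sumrB (bigD1 i) //= big1 => [|l li].
  by rewrite e0 eqxx mul1r addr0; ring.
by rewrite e0 eq_sym (negbTE li) mul0r; ring.
Qed.

Lemma cb_mulmx (P X : 'M[C]_n) (c D : R) l j :
  (forall k x a, cb x a -> cb (P l k * x) (c * a)) -> (forall k, cb (X k j) D) ->
  cb ((P *m X) l j) (\sum_(k < n) c * D).
Proof. by move=> cP cX; rewrite mxE; apply: cb_sum => k; exact: cP. Qed.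

End Combinations.

(** * Estimates of the boundary terms *)

Section FaceEstimates.
Variables (R : realType) (n : nat) (A : 'M[R[i]]_n).
Variable E : (spacetime R -> R) -> 'M[R[i]]_n.
Hypothesis HE : fundamental_solution A E.
Local Notation C := R[i].
Local Notation V := (spacetime R).
Variables (r : R) (f : V -> R) (T B : R).
Hypotheses (bf : boxed r f) (rT : r < T) (T0 : 0 < T) (B0 : 0 < B).
Local Notation dE := (fundamental_distribution HE).
Local Notation r1 := (r + (T + B)).

Let BB : - B <= B. Proof. by move: B0; lra. Qed.
Let T0' : 0 <= T. Proof. exact: ltW. Qed.
Let Bin : - B <= B <= B. Proof. by rewrite BB lexx. Qed.
Let NBin : - B <= - B <= B. Proof. by rewrite BB lexx. Qed.
Let Tin : 0 <= T <= T. Proof. by rewrite T0' lexx. Qed.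
Let zin : 0 <= (0 : R) <= T. Proof. by rewrite T0' lexx. Qed.

(** Translating by time T > r pushes the support of f into p.1 <= r - T < 0, where E vanishes. *)
Lemma E_face_future k : continuous k -> E (face f k (face0 T) (- B) B (- B) B) = 0.
Proof.
move=> ck; have [_ H _] := HE.
have bF := face0_boxed bf T0 B0 Tin ck.
apply: H; first exact: boxed_test bF.
move=> p cp /=.
have cl : closed [set q : V | q.1 <= r - T].
  apply: (@closed_comp _ _ (fun q : V => q.1) [set x | x <= r - T]); last exact: closed_le.
  by move=> q _; exact: cvg_fst.
have : p.1 <= r - T.
  apply: cl; apply: closure_subset cp => q /= Fq; apply/negPn/negP; rewrite -ltNge => qT.
  move/negP: Fq; apply; apply/eqP; rewrite /face (@eq_I2 _ _ _ _ _ _ (fun=> 0)).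
    by rewrite /I2 !RI0.
  move=> x y _ _; have [_ f0] := bf; rewrite f0 ?mul0r // => /boxP [h _ _].
  by move: (le_trans (ler_norm _) h); rewrite /= => h'; move: qT h'; lra.
by move=> h; apply: le_lt_trans h _; move: rT; lra.
Qed.

Variables (C0 M : R) (K : nat).
Hypothesis C00 : 0 <= C0.
Hypothesis EC : forall f M, boxed r1 f ->
  (forall s p, (size s <= K)%N -> `|pds s f p| <= M) -> forall i j, cb (E f i j) (C0 * M).
Hypothesis fM : forall s p, (size s <= K)%N -> `|pds s f p| <= M.

Let area := (B - - B) * (T - 0).

Lemma M_ge0 : 0 <= M.
Proof. by apply: le_trans (fM (s := [::]) (0, (0, 0)) isT); exact: normr_ge0. Qed.

Lemma E_face_bound (sig : R * R -> V) k m i j : continuous sig -> continuous k ->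
  boxed r1 (face f k sig 0 T (- B) B) ->
  (forall x y, 0 <= x <= T -> - B <= y <= B -> `|k (sig (x, y))| <= m) ->
  cb (E (face f k sig 0 T (- B) B) i j) (C0 * (M * m * area)).
Proof.
move=> cs ck bF km; apply: EC => // s p sK.
rewrite (pds_face bf cs T0' BB s ck) /area mulrA.
by apply: (face_bound (boxed_pds s bf)) => // q; exact: fM.
Qed.

Lemma Ebd_split a k : continuous k -> E (bd f T B a k) =
  match val a with
  | 0%N => - E (face f k (face0 0) (- B) B (- B) B)
  | 1%N => E (face f k (face1 B) 0 T (- B) B) - E (face f k (face1 (- B)) 0 T (- B) B)
  | _ => E (face f k (face2 B) 0 T (- B) B) - E (face f k (face2 (- B)) 0 T (- B) B)
  end.
Proof.
move=> ck; case: a => [[|[|m]] i] /=.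
- exact: etrans (E_sub dE (face0_boxed bf T0 B0 Tin ck) (face0_boxed bf T0 B0 zin ck))
    (sub_of_eq0 _ (E_face_future ck)).
- exact: (E_sub dE (face1_boxed bf T0 B0 Bin ck) (face1_boxed bf T0 B0 NBin ck)).
- exact: (E_sub dE (face2_boxed bf T0 B0 Bin ck) (face2_boxed bf T0 B0 NBin ck)).
Qed.

Definition small_on_sides (k : V -> R) m := forall t x, 0 <= t <= T -> - B <= x <= B ->
  [/\ `|k (t, (B, x))| <= m, `|k (t, (- B, x))| <= m,
      `|k (t, (x, B))| <= m & `|k (t, (x, - B))| <= m].

Lemma Ebd_side a k m i j : val a != 0%N -> continuous k -> small_on_sides k m ->
  cb (E (bd f T B a k) i j) (2 * (C0 * (M * m * area))).
Proof.
move=> a0 ck sm; rewrite Ebd_split // mulr_natl mulr2n.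
case: a a0 => [[|[|q]] ?] //= _; rewrite mxE; apply: cbD.
- apply: E_face_bound => //; [exact: face1_cts | exact: (face1_boxed bf T0 B0 Bin ck) |].
  by move=> x y xI yI; have [] := sm _ _ xI yI.
- rewrite mxE; apply: cbN.
  apply: E_face_bound => //; [exact: face1_cts | exact: (face1_boxed bf T0 B0 NBin ck) |].
  by move=> x y xI yI; have [] := sm _ _ xI yI.
- apply: E_face_bound => //; [exact: face2_cts | exact: (face2_boxed bf T0 B0 Bin ck) |].
  by move=> x y xI yI; have [] := sm _ _ xI yI.
- rewrite mxE; apply: cbN.
  apply: E_face_bound => //; [exact: face2_cts | exact: (face2_boxed bf T0 B0 NBin ck) |].
  by move=> x y xI yI; have [] := sm _ _ xI yI.
Qed.

Lemma EbdC_side a (k : V -> C) m i j : val a != 0%N -> (forall q, ccont q k) ->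
  small_on_sides (Re_f k) m -> small_on_sides (Im_f k) m ->
  cb (EbdC E f T B a k i j) (4 * (C0 * (M * m * area))).
Proof.
move=> a0 ck s1 s2.
have cr : continuous (Re_f k) by move=> q; case: (ck q).
have ci : continuous (Im_f k) by move=> q; case: (ck q).
have -> : 4 * (C0 * (M * m * area)) = 2 * (C0 * (M * m * area)) + 2 * (C0 * (M * m * area)) by ring.
rewrite mxE; apply: cbD; first exact: Ebd_side.
by rewrite mxE; apply: cbZi; exact: Ebd_side.
Qed.

Lemma conv0C_bound (k : V -> C) m : (forall q, ccont q k) -> 0 <= m ->
  (forall q, f q != 0 -> `|Re_f k q| <= m /\ `|Im_f k q| <= m) ->
  cb (conv0C f T B k) (2 * (M * m * (B - - B) * (B - - B) * (T - 0))).
Proof.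
move=> ck m0 km.
have cr : continuous (Re_f k) by move=> q; case: (ck q).
have ci : continuous (Im_f k) by move=> q; case: (ck q).
have [sf _] := bf; have cf : continuous f := smooth_cts (s := [::]) sf.
rewrite mulr_natl mulr2n; apply: cb_complex.
- apply: I3_bound => //; [exact: ltW | exact: cts_conv |] => t x y _ _ _.
  have [z|nz] := eqVneq (f ((0, (0, 0)) + (t, (x, y)))) 0.
    by rewrite z mul0r normr0 mulr_ge0 // M_ge0.
  rewrite normrM ler_pM //; first exact: (fM (s := [::])).
  have E' : ((0, (0, 0)) + (t, (x, y)) : V) = (t, (x, y)) by congr (_, (_, _)); rewrite /= add0r.
  by rewrite E' in nz; have [] := km _ nz.
- apply: I3_bound => //; [exact: ltW | exact: cts_conv |] => t x y _ _ _.
  have [z|nz] := eqVneq (f ((0, (0, 0)) + (t, (x, y)))) 0.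
    by rewrite z mul0r normr0 mulr_ge0 // M_ge0.
  rewrite normrM ler_pM //; first exact: (fM (s := [::])).
  have E' : ((0, (0, 0)) + (t, (x, y)) : V) = (t, (x, y)) by congr (_, (_, _)); rewrite /= add0r.
  by rewrite E' in nz; have [] := km _ nz.
Qed.

(** The face t = T drops out and the face t = 0 enters with a minus sign, which cancels the one in
    the initial value of the kernel; that value is real. *)
Lemma EbdC_initial (k : V -> C) (p0 : V -> R) (c : R) : (forall q, ccont q k) -> continuous p0 ->
  (forall y, k (0, y) = (c * - p0 (0, y))%:C) ->
  EbdC E f T B 0 k = c%:C *: E (face f p0 (face0 0) (- B) B (- B) B).
Proof.
move=> ck cp kE.
have cr : continuous (Re_f k) by move=> q; case: (ck q).
have ci : continuous (Im_f k) by move=> q; case: (ck q).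
have [sf _] := bf; have cf : continuous f := smooth_cts (s := [::]) sf.
have f2 : face f (Im_f k) (face0 0) (- B) B (- B) B = fun=> 0.
  apply/funext => p; apply: etrans (_ : I2 (- B) B (- B) B (fun=> 0) = 0).
    by apply: eq_I2 => x y _ _; rewrite /Im_f /face0 kE mulr0.
  by rewrite /I2 !RI0.
have f1 : face f (Re_f k) (face0 0) (- B) B (- B) B =
    fun p => - c * face f p0 (face0 0) (- B) B (- B) B p.
  apply/funext => p.
  have cfp : continuous (fun z => f (p + face0 0 z) * p0 (face0 0 z)).
    move=> z; apply: cvgM.
      apply: (@continuous_comp _ _ _ (fun z => p + face0 0 z) f); last exact: cf.
      by apply: cvgD; [exact: cvg_cst | exact: face0_cts].
    by apply: (@continuous_comp _ _ _ (face0 0) p0); [exact: face0_cts | exact: cp].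
  apply: etrans (I2Z (- B) B (- c) BB cfp).
  by apply: eq_I2 => x y _ _; rewrite /Re_f /face0 kE /=; ring.
have e1 : E (bd f T B 0 (Re_f k)) = - E (face f (Re_f k) (face0 0) (- B) B (- B) B) := Ebd_split 0 cr.
have e2 : E (bd f T B 0 (Im_f k)) = - E (face f (Im_f k) (face0 0) (- B) B (- B) B) := Ebd_split 0 ci.
rewrite f1 in e1; rewrite f2 in e2.
exact: initial_comb e1 e2 (E_scale dE (- c) (face0_boxed bf T0 B0 zin cp)) (E0 dE).
Qed.

Section KernelFace.
Variables (kap : 'I_n -> V -> C) (kap' : 'I_3 -> 'I_n -> V -> C) (p0 : V -> R) (i j : 'I_n) (m c : R).
Hypotheses (ck : forall l q, ccont q (kap l)) (ck' : forall a l q, ccont q (kap' a l)).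
Hypothesis dk : forall a l q,
  is_derive q (axis R a) (Re_f (kap l)) (Re_f (kap' a l) q) /\
  is_derive q (axis R a) (Im_f (kap l)) (Im_f (kap' a l) q).
Hypothesis sys : forall k q,
  kap' 0 k q + \sum_l (kap' 1 l q * A1 A l k + kap' 2%R l q * A2 A l k) = 0.
Hypotheses (cp0 : continuous p0) (m0 : 0 <= m).
Hypothesis init : forall l y, kap l (0, y) = ((i == l)%:R * - p0 (0, y))%:C.
Hypothesis small_supp : forall l q, f q != 0 -> `|Re_f (kap l) q| <= m /\ `|Im_f (kap l) q| <= m.
Hypothesis small_sides : forall l, small_on_sides (Re_f (kap l)) m /\ small_on_sides (Im_f (kap l)) m.
Hypothesis cA1 : forall l k x a, cb x a -> cb (A1 A l k * x) (c * a).
Hypothesis cA2 : forall l k x a, cb x a -> cb (A2 A l k * x) (c * a).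

(** The trace identity is solved for the initial face; the value at the origin and the lateral faces
    are each linear in the bound m for the kernel on the support of f and on the sides. *)
Lemma poisson_face_bound :
  cb (E (face f p0 (face0 0) (- B) B (- B) B) i j)
    ((2 * (M * (B - - B) * (B - - B) * (T - 0)) +
     n%:R * (n%:R * (2 * (c * (4 * (C0 * (M * area))))))) * m).
Proof.
have tr := fundamental_trace HE bf T0 B0 ck ck' dk sys j.
set F := E (face f p0 _ _ _ _ _).
have e0 l : EbdC E f T B 0 (kap l) l j = (i == l)%:R%:C * F l j.
  by rewrite (EbdC_initial (ck l) cp0 (init l)) mxE.
pose S := \sum_l ((A1 A *m EbdC E f T B 1 (kap l)) l j + (A2 A *m EbdC E f T B 2%R (kap l)) l j).
(* At time zero the kernel is scalar, so among the initial faces of the row only the one with l = i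
   contributes. *)
have FE : F i j = - conv0C f T B (kap j) - S.
  exact: trace_solve e0 tr.
rewrite FE mulrDl; apply: cbD.
  apply: cbN; have := conv0C_bound (ck j) m0 (small_supp j).
  by congr cb; ring.
apply: cbN.
pose D := c * (4 * (C0 * (M * m * area))).
have side l a k : val a != 0%N -> cb (EbdC E f T B a (kap l) k j) (4 * (C0 * (M * m * area))).
  by move=> a0; have [s1 s2] := small_sides l; exact: EbdC_side.
have -> : n%:R * (n%:R * (2 * (c * (4 * (C0 * (M * area)))))) * m = \sum_(l < n) \sum_(k < n) (D + D).
  by rewrite !sum_ord_const /D; move: (n%:R) area => N a; ring.
apply: cb_sum => l; rewrite big_split /=; apply: cbD.
  by apply: cb_mulmx => k; [exact: cA1 | exact: side].
by apply: cb_mulmx => k; [exact: cA2 | exact: side].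
Qed.

End KernelFace.

End FaceEstimates.

(** * Goodness far from the time axis and uniform smallness *)

Section FormBound.
Variables (R : realType) (n : nat).
Local Notation C := R[i].

Lemma cb_mul (x y : C) (a b : R) : cb x a -> cb y b -> cb (x * y) (a * b).
Proof. by rewrite /cb => xa yb; rewrite normrM rmorphM ler_pM. Qed.

Lemma cb_Re (x : C) (a : R) : cb x a -> `|complex.Re x| <= a.
Proof.
rewrite /cb normc_def lecR; apply: le_trans.
by rewrite -sqrtr_sqr ler_wsqrtr // lerDl sqr_ge0.
Qed.

Lemma cb_entry (v : 'cV[C]_n) i : cb (v i 0) (Num.sqrt (nsq v)).
Proof.
rewrite /cb normc_def lecR ler_wsqrtr // nsqE (bigD1 i) //= lerDl.
by apply: sumr_ge0 => k _; rewrite addr_ge0 ?sqr_ge0.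
Qed.

Lemma form_bound (P : 'M[C]_n) : exists2 c, 0 <= c & forall v : 'cV[C]_n,
  `|complex.Re (form P v v)| <= c * nsq v.
Proof.
have /choice [d Hd] : forall ij : 'I_n * 'I_n, exists d : R, 0 <= d /\ forall x a, cb x a -> cb (P ij.1 ij.2 * x) (d * a).
  by move=> ij; have [d d0 Hd] := cbM (P ij.1 ij.2); exists d.
exists (\sum_j \sum_i d (i, j)).
  by apply: sumr_ge0 => j _; apply: sumr_ge0 => i _; case: (Hd (i, j)).
move=> v; apply: cb_Re; rewrite /form mxE.
have sv := sqr_sqrtr (nsq_ge0 v).
set s := Num.sqrt (nsq v) in sv.
have -> : (\sum_j \sum_i d (i, j)) * nsq v = \sum_j \sum_i (d (i, j) * s * s).
  rewrite mulr_suml; apply: eq_bigr => j _; rewrite mulr_suml; apply: eq_bigr => i _.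
  by rewrite -sv; ring.
apply: cb_sum => j; rewrite mxE mulr_suml; apply: cb_sum => i.
apply: cb_mul (cb_entry v j); rewrite !mxE mulrC; have [_ H] := Hd (i, j); apply: H.
by rewrite /cb norm_conjC; exact: cb_entry.
Qed.

End FormBound.

Section FarRegion.
Variables (R : realType) (n : nat) (P Q : 'M[R[i]]_n).
Hypotheses (hP : P ^t* = P) (hQ : Q ^t* = Q).
Local Notation C := R[i].
Local Notation V := (spacetime R).

Definition Xq (q : V) : 'M[C]_n := Bq P q + (0 +i* 1) *: Dq Q q.

Lemma form_affine (a b : R) (H : 'M[C]_n) (v : 'cV[C]_n) :
  complex.Re (form (a%:C%:M - b%:C *: H) v v) = a * nsq v - b * complex.Re (form H v v).
Proof.
rewrite formDl formNl formZl form_scalar cReD cReN.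
by move: (form H v v) (nsq v) => z N; rewrite !cReM /= !mul0r !subr0.
Qed.

Lemma dominated_neq0 (a b x N c : R) : `|x| <= c * N -> 0 < N -> `|b| * c < `|a| ->
  a * N - b * x != 0.
Proof.
move=> xc N0 ba; rewrite subr_eq0; apply/eqP => E.
have : `|a| * N <= `|b| * c * N.
  by rewrite -mulrA -{1}(gtr0_norm N0) -normrM E normrM ler_wpM2l.
by rewrite ler_pM2r // leNgt ba.
Qed.

(** The numerical values of P and Q are bounded, so when x1 or x2 dominates t the corresponding
    Hermitian part of X_q has a form without nontrivial zeros, and no nonzero vector is
    isotropic. *)
Lemma far_good : exists2 c : R, 0 <= c & forall t y1 y2,
  `|t| * c < `|y1| \/ `|t| * c < `|y2| -> good (Xq (t, (y1, y2))).
Proof.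
have [c1 c10 H1] := form_bound P; have [c2 c20 H2] := form_bound Q.
exists (c1 + c2); first by rewrite addr_ge0.
move=> t y1 y2 h.
have E (v : 'cV[C]_n) : form (Xq (t, (y1, y2))) v v =
    (y1 * nsq v - t * complex.Re (form P v v)) +i* (y2 * nsq v - t * complex.Re (form Q v v)).
  rewrite /Xq formDl formZl (herm_form _ (Bq_herm hP _)) (herm_form _ (Dq_herm hQ _)).
  rewrite -complex_split; congr (_ +i* _); exact: form_affine.
case: h => h.
  apply: (@good_definite _ _ 1) => v v0; rewrite E mul1r /=.
  apply: (dominated_neq0 (H1 v)); first by rewrite nsq_gt0.
  by apply: le_lt_trans h; rewrite ler_wpM2l // lerDl.
apply: (@good_definite _ _ (0 +i* (-1))) => v v0; rewrite E cReM /= mul0r sub0r mulN1r opprK.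
apply: (dominated_neq0 (H2 v)); first by rewrite nsq_gt0.
by apply: le_lt_trans h; rewrite ler_wpM2l // lerDr.
Qed.

(** The limit in [kernel_to0] is locally uniform in q, hence uniform on compact sets. *)
Lemma kernel_unif (K : set V) : compact K -> (forall q, K q -> good (Xq q)) ->
  forall eta : R, 0 < eta -> exists2 e0, 0 < e0 & forall eps, 0 < eps -> eps < e0 ->
    forall q i j, K q -> `|complex.Re (kernel eps (Bq P q) (Dq Q q) i j)| <= eta /\
      `|complex.Im (kernel eps (Bq P q) (Dq Q q) i j)| <= eta.
Proof.
move=> /compact_near_coveringP cK gK eta eta0.
pose G (e : R) (q : V) := 0 < e -> forall i j,
  `|complex.Re (kernel e (Bq P q) (Dq Q q) i j)| <= eta /\
  `|complex.Im (kernel e (Bq P q) (Dq Q q) i j)| <= eta.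
have nG q : K q -> \forall q' \near q & e \near (0 : R), G e q'.
  move=> Kq; have cB' : forall x : V, mcont x (Bq P) by move=> x; apply: (mcont_Bq P (f := id)); exact: cvg_id.
  have cD' : forall x : V, mcont x (Dq Q) by move=> x; apply: (mcont_Dq Q (f := id)); exact: cvg_id.
  have H i j := kernel_to0 (x0 := q) (Bq_herm hP) (Dq_herm hQ) cB' cD' i j (gK q Kq) eta0.
  have H2 : \forall z \near (0 : R, q), G z.1 z.2.
    have := filter_forall (nbhs_filter _) (fun i => filter_forall (nbhs_filter _) (fun j => H i j)).
    by apply: filterS => z Hz z0 i j; exact: Hz.
  have [[U W] /= [hU hW] UW] := H2.
  by exists (W, U) => //= -[x e] [/= Wx Ue]; exact: (UW (e, x)).
have := cK R (nbhs (0 : R)) G _ nG.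
move=> [d /= d0 Hd]; exists d => // eps eps0 epsd q i j Kq.
apply: Hd => //; by rewrite /= sub0r normrN gtr0_norm.
Qed.

End FarRegion.

Lemma system_add (R : realType) n (a a' : R[i]) (u v u' v' p q : 'I_n -> R[i]) :
  a + \sum_l (u l * p l + v l * q l) = 0 -> a' + \sum_l (u' l * p l + v' l * q l) = 0 ->
  (a + a') + \sum_l ((u l + u' l) * p l + (v l + v' l) * q l) = 0.
Proof.
move=> E1 E2; have E := congr2 +%R E1 E2.
rewrite addrACA -big_split addr0 in E; apply: etrans E; congr (_ + _).
by apply: eq_bigr => l _; rewrite /= !mulrDl addrACA.
Qed.

(** * The lateral faces, the kernel row and the Poisson defect *)

Section Vanishing.
Variables (R : realType) (n : nat) (A : 'M[R[i]]_n).
Variable E : (spacetime R -> R) -> 'M[R[i]]_n.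
Hypothesis HE : fundamental_solution A E.
Local Notation C := R[i].
Local Notation V := (spacetime R).
Local Notation P := (A1 A).
Local Notation Q := (A2 A).
Local Notation dE := (fundamental_distribution HE).

Lemma cb_div (x : C) (m a : R) : 0 < m -> cb (m%:C * x) a -> cb x (a / m).
Proof.
move=> m0 H; have := cbZ m^-1 H; rewrite mulrA -rmorphM /= mulVf ?gt_eqF // mul1r.
by rewrite ger0_norm ?invr_ge0 ?ltW // mulrC.
Qed.

Lemma uniform_cbM (H : 'M[C]_n) : exists2 c : R, 0 <= c &
  forall l k x a, cb x a -> cb (H l k * x) (c * a).
Proof.
have /choice [d Hd] : forall ij : 'I_n * 'I_n, exists d : R, 0 <= d /\ forall x a, cb x a -> cb (H ij.1 ij.2 * x) (d * a).
  by move=> ij; have [d d0 Hd] := cbM (H ij.1 ij.2); exists d.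
exists (\sum_ij d ij); first by apply: sumr_ge0 => ij _; case: (Hd ij).
move=> l k x a xa; have [_ h] := Hd (l, k); apply: cb_le (h _ _ xa) _.
rewrite ler_wpM2r ?(cb_ge0 xa) // (bigD1 (l, k)) //= lerDl.
by apply: sumr_ge0 => ij _; case: (Hd ij).
Qed.

Definition side_faces (T B : R) : set V :=
  (`[0, T] `*` ([set B] `*` `[- B, B])) `|` (`[0, T] `*` ([set - B] `*` `[- B, B])) `|`
  ((`[0, T] `*` (`[- B, B] `*` [set B])) `|` (`[0, T] `*` (`[- B, B] `*` [set - B]))).

Lemma side_faces_compact T B : compact (side_faces T B).
Proof.
have c1 (a b : R) : compact `[a, b] by exact: segment_compact.
have c2 (a : R) : compact [set a] by exact: compact_set1.
by apply: compactU; apply: compactU; do ![apply: compact_setX => //].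
Qed.

Lemma side_faces_good T B c : 0 <= T -> T * c < B -> 0 < B -> 0 <= c ->
  (forall t y1 y2, `|t| * c < `|y1| \/ `|t| * c < `|y2| -> good (Xq P Q (t, (y1, y2)))) ->
  forall q, side_faces T B q -> good (Xq P Q q).
Proof.
move=> T0 TB B0 c0 far [t [y1 y2]].
have tc : t \in `[0, T] -> `|t| * c < B.
  rewrite in_itv /= => /andP[t0 tT]; apply: le_lt_trans TB; rewrite ler_wpM2r //.
  by rewrite ger0_norm.
have nB : `|B| = B by rewrite gtr0_norm.
by move=> [[|]|[|]] [/= /tc tB [/= h1 h2]]; apply: far;
  [left; rewrite h1 | left; rewrite h1 normrN | right; rewrite h2 | right; rewrite h2 normrN]; rewrite nB.
Qed.

Section Pole.
Variables (eps : R) (i : 'I_n).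
Hypothesis eps0 : 0 < eps.

(** The i-th row of the kernel, split over its two poles; [kap'] holds its partial derivatives. *)
Definition kap l (q : V) : C := kern P Q (0 +i* eps) i l q + kern P Q (0 +i* - eps) i l q.
Definition kap' a l (q : V) : C := kern' P Q (0 +i* eps) a i l q + kern' P Q (0 +i* - eps) a i l q.

Let p1 : complex.Im (0 +i* eps : C) != 0. Proof. by rewrite /= gt_eqF. Qed.
Let p2 : complex.Im (0 +i* - eps : C) != 0. Proof. by rewrite /= oppr_eq0 gt_eqF. Qed.
Let hP := A1_herm A.
Let hQ := A2_herm A.

Lemma kap_kernel l q : kap l q = kernel eps (Bq P q) (Dq Q q) i l.
Proof. by rewrite (kernelE hP hQ) // gt_eqF. Qed.

Lemma kap_cts l q : ccont q (kap l).
Proof. by apply: ccontD; apply: kern_cts. Qed.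

Lemma kap'_cts a l q : ccont q (kap' a l).
Proof. by apply: ccontD; apply: kern'_cts. Qed.

Lemma kap_der a l q :
  is_derive q (axis R a) (Re_f (kap l)) (Re_f (kap' a l) q) /\
  is_derive q (axis R a) (Im_f (kap l)) (Im_f (kap' a l) q).
Proof.
have [d1 d2] := cderD (kern_cder hP hQ p1 a i l q) (kern_cder hP hQ p2 a i l q).
by split; apply: line_is_derive.
Qed.

Lemma kap_system k q : kap' 0 k q + \sum_l (kap' 1 l q * P l k + kap' 2%R l q * Q l k) = 0.
Proof.
exact: (system_add (kern_system hP hQ p1 i k q) (kern_system hP hQ p2 i k q)).
Qed.

Lemma kap_initial l y : kap l (0, y) = ((i == l)%:R * - poisson eps y)%:C.
Proof. by rewrite kap_kernel (kernel_initial hP hQ). Qed.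

End Pole.

Lemma face0_shift0 (p : V) : p + face0 0 (0, 0) = p.
Proof. by case: p => t [a b]; congr (_, (_, _)); rewrite /= addr0. Qed.

Lemma face0_shift1 (p : V) w b : p + face0 0 (w, b) = w *: axis R 1 + (p + face0 0 (0, b)).
Proof.
case: p => t [u v]; congr (_, (_, _)); rewrite /= ?[_ *: _]mulr1 ?[_ *: _]mulr0 ?add0r ?addr0 //.
by rewrite addrC.
Qed.

Lemma face0_shift2 (p : V) w : p + face0 0 (0, w) = w *: axis R 2%R + (p + face0 0 (0, 0)).
Proof.
case: p => t [u v]; congr (_, (_, _)); rewrite /= ?[_ *: _]mulr1 ?[_ *: _]mulr0 ?add0r ?addr0 //.
by rewrite addrC.
Qed.

(** A derivative of order at most K of f is Lipschitz in space, with the bound on derivatives of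
    order K + 1 as constant, and it commutes with averaging; [poisson_average] then applies to it at
    each point. *)
Lemma poisson_defect (r T B eps dl M : R) (f : V -> R) K : boxed r f -> 0 < T -> 0 < B ->
  0 < eps -> 0 < dl -> (forall s p, (size s <= K.+1)%N -> `|pds s f p| <= M) ->
  forall s p, (size s <= K)%N ->
  `|pds s (fun p => - poisson_mass eps B * f p +
      face f (fun q => poisson eps q.2) (face0 0) (- B) B (- B) B p) p| <=
  M * dl * poisson_mass eps B + M * (64 * pi * B * eps / dl ^+ 3) * (2 * B) ^+ 2.
Proof.
move=> bf T0 B0 e0 dl0 fM s p sK.
have BB : - B <= B by move: B0; lra.
have M0 : 0 <= M by apply: le_trans (fM [::] p isT); exact: normr_ge0.
have cp : continuous (fun q : V => poisson eps q.2).
  move=> q; apply: (@continuous_comp _ _ _ (fun q : V => q.2) (poisson eps)); first exact: cvg_snd.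
  exact: poisson_cts.
have [sf _] := bf.
have [sF _] : boxed (r + (T + B)) (face f (fun q => poisson eps q.2) (face0 0) (- B) B (- B) B).
  by apply: face0_boxed => //; rewrite lexx ltW.
rewrite pds_lin // (pds_face bf (face0_cts (t := 0)) BB BB s cp).
pose g y := pds s f (p + face0 0 y).
have cg : continuous g.
  move=> y; apply: (@continuous_comp _ _ _ (fun y => p + face0 0 y) (pds s f)); last exact: smooth_cts.
  by apply: cvgD; [exact: cvg_cst | exact: face0_cts].
have gL y : `|g y - g (0, 0)| <= M * (`|y.1| + `|y.2|).
  have step a b : `|g (a, b) - g (0, b)| <= M * `|a|.
    have E1 w := face0_shift1 p w b.
    have := lipschitz_of_derive (h := fun w => g (w, b)) (h' := fun w => pds (1 :: s) f (p + face0 0 (w, b))) (L := M) 0 a.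
    rewrite subr0; apply; last by move=> w; apply: fM.
    move=> w; rewrite (_ : (fun w => g (w, b)) = (fun w => pds s f (w *: axis R 1 + (p + face0 0 (0, b))))).
      by rewrite E1; apply: is_derive_line; exact: smooth_derive.
    by apply/funext => w'; rewrite /g E1.
  have step2 b : `|g (0, b) - g (0, 0)| <= M * `|b|.
    have E1 w := face0_shift2 p w.
    have := lipschitz_of_derive (h := fun w => g (0, w)) (h' := fun w => pds (2%R :: s) f (p + face0 0 (0, w))) (L := M) 0 b.
    rewrite subr0; apply; last by move=> w; apply: fM.
    move=> w; rewrite (_ : (fun w => g (0, w)) = (fun w => pds s f (w *: axis R 2%R + (p + face0 0 (0, 0))))).
      by rewrite E1; apply: is_derive_line; exact: smooth_derive.
    by apply/funext => w'; rewrite /g E1.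
  case: y => a b; rewrite /= mulrDr -(subrKA (g (0, b))); apply: le_trans (ler_normD _ _) _.
  exact: lerD (step a b) (step2 b).
have := poisson_average e0 B0 cg M0 dl0 gL.
have -> : g (0, 0) = pds s f p by rewrite /g face0_shift0.
apply: le_trans; rewrite le_eqVlt; apply/orP; left; apply/eqP; congr (`|_|).
by rewrite addrC mulNr [poisson_mass eps B * _]mulrC.
Qed.

End Vanishing.

(** * Vanishing of E on the good set *)

Section Conclusion.
Variables (R : realType) (n : nat) (A : 'M[R[i]]_n).
Variable E : (spacetime R -> R) -> 'M[R[i]]_n.
Hypothesis HE : fundamental_solution A E.
Local Notation C := R[i].
Local Notation V := (spacetime R).
Local Notation P := (A1 A).
Local Notation Q := (A2 A).
Local Notation dE := (fundamental_distribution HE).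

Lemma supp_mem (f : V -> R) q : f q != 0 -> supp f q.
Proof. by move=> fq; apply: subset_closure. Qed.

Lemma quotient_estimate (X Y Z eta m : R) : 0 <= X -> 0 <= Y -> 1 <= m ->
  (X + (Z * m + Y)) / m <= X + (Z + Y).
Proof.
move=> X0 Y0 m1; have m0 : 0 < m by apply: lt_le_trans m1.
rewrite ler_pdivrMr //.
have h1 : X <= X * m by rewrite ler_peMr.
have h2 : Y <= Y * m by rewrite ler_peMr.
by move: h1 h2; rewrite !mulrDl; lra.
Qed.

(** For every eta the kernel is at most eta on the support of f and on the sides once eps is small.
    Then E of the Poisson average of f is O(eta), and so is E of its difference with m f, where m >=
    1 is the mass of the Poisson kernel on the square. Dividing by m bounds E f by a constant times
    eta. *)
Lemma E_vanish (f : V -> R) : test_function f ->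
  (forall q, supp f q -> good (Xq P Q q)) -> E f = 0.
Proof.
move=> tf gf; have [r r0 bf] := test_boxed tf.
have hP := A1_herm A; have hQ := A2_herm A.
have [c c0 far] := far_good hP hQ.
(* T > r puts the final face in the past; B > T c places the sides in the region where [far_good]
   applies. *)
pose T := r + 1; pose B := T * c + 1.
have T0 : 0 < T by rewrite addr_gt0.
have rT : r < T by rewrite ltrDl.
have B0 : 0 < B by rewrite ltr_wpDl // mulr_ge0 // ltW.
have TB : T * c < B by rewrite ltrDl.
have bf1 : boxed (r + (T + B)) f by apply: boxed_widen bf; rewrite lerDl addr_ge0 // ltW.
have [C0 [K [C00 EC]]] := E_bound dE (r + (T + B)).
have [M M0 fM] := boxed_pds_bounded K.+1 bf.
have fM' s p : (size s <= K)%N -> `|pds s f p| <= M by move=> sK; apply: fM; exact: leqW.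
have [d1 d10 D1] := uniform_cbM P; have [d2 d20 D2] := uniform_cbM Q.
pose d := d1 + d2.
have D1' l k x a : cb x a -> cb (P l k * x) (d * a).
  move=> xa; apply: cb_le (D1 l k x a xa) _.
  by rewrite ler_wpM2r ?(cb_ge0 xa) // lerDl.
have D2' l k x a : cb x a -> cb (Q l k * x) (d * a).
  move=> xa; apply: cb_le (D2 l k x a xa) _.
  by rewrite ler_wpM2r ?(cb_ge0 xa) // lerDr.
have cS : compact (supp f `|` side_faces T B).
  by apply: compactU; [case: tf | exact: side_faces_compact].
have gS q : (supp f `|` side_faces T B) q -> good (Xq P Q q).
  move=> [/gf //|]; exact: side_faces_good (ltW T0) TB B0 c0 far q.
apply/matrixP => i j; rewrite [RHS]mxE.
pose Kf := 2 * (M * (B - - B) * (B - - B) * (T - 0)) +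
     n%:R * (n%:R * (2 * (d * (4 * (C0 * (M * ((B - - B) * (T - 0)))))))).
pose L := 64 * pi * B; pose K2 := (2 * B) ^+ 2.
apply: (@cb_small _ _ (Kf + (C0 * M + C0 * (M * L * K2)))) => eta eta0 eta1.
have [e0 e00 small] := kernel_unif hP hQ cS gS eta0.
(* The splitting distance in the Poisson average will be eta; eps <= eta^4 makes the far part, of
   size eps / eta^3, at most a multiple of eta. *)
have [eps [eps0 epse0 epsB epseta]] : exists eps : R, [/\ 0 < eps, eps < e0, eps <= B & eps <= eta ^+ 4].
  have e4 : 0 < eta ^+ 4 by rewrite exprn_gt0.
  exists (Num.min (e0 / 2) (Num.min B (eta ^+ 4))); split.
  - by rewrite !lt_min divr_gt0 // B0.
  - by rewrite gt_min ltr_pdivrMr // ltr_pMr // ltr1n.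
  - by rewrite !ge_min lexx orbT.
  - by rewrite !ge_min lexx !orbT.
pose p0 (q : V) := poisson eps q.2.
have cp0 : continuous p0.
  move=> q; apply: (@continuous_comp _ _ _ (fun q : V => q.2) (poisson eps)); first exact: cvg_snd.
  exact: poisson_cts.
have smallk l q : (supp f `|` side_faces T B) q ->
    `|Re_f (kap A eps i l) q| <= eta /\ `|Im_f (kap A eps i l) q| <= eta.
  by move=> Sq; rewrite /Re_f /Im_f kap_kernel //; exact: small.
have sides l : small_on_sides T B (Re_f (kap A eps i l)) eta /\ small_on_sides T B (Im_f (kap A eps i l)) eta.
  have BB : `[- B, B]%classic B by rewrite /= in_itv /= lexx andbT; move: B0; lra.
  have side1 t x : 0 <= t <= T -> - B <= x <= B -> [/\ side_faces T B (t, (B, x)),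
      side_faces T B (t, (- B, x)), side_faces T B (t, (x, B)) & side_faces T B (t, (x, - B))].
    move=> tI xI; split.
    - by left; left; split; rewrite /= ?in_itv.
    - by left; right; split; rewrite /= ?in_itv.
    - by right; left; split; rewrite /= ?in_itv.
    - by right; right; split; rewrite /= ?in_itv.
  split=> t x tI xI; have [s1 s2 s3 s4] := side1 t x tI xI; split.
  - by have [] := smallk l _ (or_intror s1).
  - by have [] := smallk l _ (or_intror s2).
  - by have [] := smallk l _ (or_intror s3).
  - by have [] := smallk l _ (or_intror s4).
  - by have [] := smallk l _ (or_intror s1).
  - by have [] := smallk l _ (or_intror s2).
  - by have [] := smallk l _ (or_intror s3).
  - by have [] := smallk l _ (or_intror s4).
have fb := poisson_face_bound HE bf rT T0 B0 EC fM' (i := i) j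
  (kap_cts A i eps0) (kap'_cts A i eps0) (kap_der A i eps0) (kap_system A i eps0) cp0 (ltW eta0)
  (kap_initial A i eps0) (fun l q fq => smallk l q (or_introl (supp_mem fq))) sides D1' D2'.
set F := face f p0 (face0 0) (- B) B (- B) B in fb.
pose m := poisson_mass eps B.
have bF : boxed (r + (T + B)) F by apply: face0_boxed => //; rewrite lexx ltW.
have hb := EC _ _ (boxed_lin (- m) bf1 bF) (poisson_defect bf T0 B0 eps0 eta0 fM) i j.
rewrite (E_lin dE (- m) bf1 bF) in hb.
(* E applied to m f is E of the average minus E of the defect, and both have been estimated. *)
have mE : m%:C * E f i j = E F i j - ((- m)%:C *: E f + E F) i j.
  rewrite !mxE rmorphN /=; move: (m%:C) (E f i j) (E F i j) => x y z; ring.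
have m1 : 1 <= m.
  apply: le_trans (poisson_mass_ge eps0 B0 epsB).
  by have := pi_ge2 R; lra.
have m0 : 0 < m by apply: lt_le_trans m1.
have key := cb_div m0 (eq_ind _ (fun x => cb x _) (cbD fb (cbN hb)) _ (esym mE)).
apply: cb_le key _.
have L0 : 0 <= L by rewrite !mulr_ge0 ?pi_ge0 // ltW.
have Y1 : L * eps / eta ^+ 3 <= L * eta.
  rewrite -mulrA ler_wpM2l // ler_pdivrMr ?exprn_gt0 // -exprS //.
have Y0 : 0 <= C0 * (M * (L * eps / eta ^+ 3) * K2).
  have K20 : 0 <= K2 by exact: sqr_ge0.
  have Le0 : 0 <= L * eps / eta ^+ 3.
    by apply: divr_ge0; [apply: mulr_ge0 => //; exact: ltW | apply: exprn_ge0; exact: ltW].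
  exact: (mulr_ge0 C00 (mulr_ge0 (mulr_ge0 M0 Le0) K20)).
have Y2 : C0 * (M * (L * eps / eta ^+ 3) * K2) <= C0 * (M * L * K2) * eta.
  have -> : C0 * (M * L * K2) * eta = C0 * (M * (L * eta) * K2) by ring.
  by rewrite ler_wpM2l // ler_wpM2r ?sqr_ge0 // ler_wpM2l.
have Q1 := @quotient_estimate (Kf * eta) (C0 * (M * (L * eps / eta ^+ 3) * K2)) (C0 * (M * eta)) eta m
  (cb_ge0 fb) Y0 m1.
apply: le_trans (_ : Kf * eta + (C0 * (M * eta) + C0 * (M * (L * eps / eta ^+ 3) * K2)) <= _).
  apply: le_trans Q1; rewrite le_eqVlt; apply/orP; left; apply/eqP; congr (_ / _).
  by congr (_ + _); rewrite -/m -/L -/K2; ring.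
rewrite (mulrDl Kf) (mulrDl (C0 * M)); apply: lerD => //; apply: lerD => //.
by rewrite mulrA.
Qed.

Lemma good_scale (c : R) (X : 'M[C]_n) : 0 < c -> good X -> good (c%:C *: X).
Proof.
move=> c0 gX v mu nu v0 mn E'.
have cn : (c%:C : C) != 0 by rewrite eq_complex /= eqxx andbT gt_eqF.
have h : mu *: (X *m v) = nu *: (X ^t* *m v).
  apply: (can_inj (scalerK cn)); rewrite !scalerA [_ * mu]mulrC [_ * nu]mulrC -!scalerA.
  by rewrite (scalemxAl _ X) E' adjZ [_^*]conjc_real -(scalemxAl _ (X ^t* )).
by rewrite formZl; apply: (mulf_neq0 cn); exact: (gX v mu nu v0 mn h).
Qed.

(** X_q is homogeneous in q, so its goodness at (t, x) with t > 0 is that of x/t - A. *)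
Lemma Xq_scale (t : R) (z : C) : Xq P Q (t, (complex.Re z * t, complex.Im z * t)) = t%:C *: (z%:M - A).
Proof.
have e (a : R) (H : 'M[C]_n) : (a * t)%:C%:M - t%:C *: H = t%:C *: (a%:C%:M - H).
  by rewrite scalerBr scale_scalar_mx -rmorphM mulrC.
rewrite -Xz /Xq /Bq /Dq /= !e -/(Bz A z) -/(Dz A z); move: (Bz A z) (Dz A z) => X Y.
by rewrite scalerA [_ * t%:C]mulrC -scalerA -scalerDr.
Qed.

Lemma mcont_Xq q : mcont q (Xq P Q).
Proof.
apply: mcontD; first by apply: (mcont_Bq P (f := id)); exact: cvg_id.
by apply: mcontZ; [exact: ccont_cst | apply: (mcont_Dq Q (f := id)); exact: cvg_id].
Qed.

(** Good points form a neighbourhood of q, on whose interior E is represented by the zero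
    function. *)
Lemma dist_value0 (q : V) : good (Xq P Q q) -> dist_value E q 0.
Proof.
move=> gq; exists (interior [set q | good (Xq P Q q)]), (fun=> 0); split.
- exact: open_interior.
- exact: good_near (mcont_Xq q) gq.
- move=> i j; have h W : smooth_on W (fun _ : V => 0 : R).
    by move=> s p Wp; have [sf _] := boxed0 (0 : R); exact: sf.
  have r0 : (fun q : V => complex.Re ((0 : 'M[C]_n) i j)) = (fun=> 0) by apply/funext => p; rewrite mxE.
  have i0 : (fun q : V => complex.Im ((0 : 'M[C]_n) i j)) = (fun=> 0) by apply/funext => p; rewrite mxE.
  by rewrite r0 i0; split; exact: h.
- move=> f tf sf; rewrite (E_vanish tf); last by move=> p /sf /interior_subset.
  apply/matrixP => i j; rewrite [RHS]mxE [LHS]mxE.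
  have z : \int[@spacetime_measure R]_p (f p * 0) = 0 :> R.
    rewrite (_ : (fun p => f p * 0) = cst 0); last by apply/funext => p; rewrite mulr0.
    by rewrite /Rintegral integral0.
  by rewrite !mxE /= z.
- by [].
Qed.

End Conclusion.

Theorem corollary6p6 (R : realType) (n : nat) (A : 'M[R[i]]_n)
    (m : nat) (lambda : 'I_m -> R -> R) (mult : 'I_m -> nat)
    (Hlambda : eigenvalue_branches A lambda mult)
    (E : (spacetime R -> R) -> 'M[R[i]]_n)
    (HE : fundamental_solution A E)
    (t x1 x2 : R) (Ht : 0 < t)
    (Hx : Pi_A A lambda mult ((x1 / t) +i* (x2 / t))) :
  dist_value E (t, (x1, x2)) 0.
Proof.
apply: (dist_value0 HE).
have := good_scale Ht (lacuna_good Hlambda Hx).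
by rewrite -Xq_scale /= !divfK ?gt_eqF.
Qed.
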